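(* For $\boldsymbol{x},\boldsymbol{y}\in\Gamma$, $\boldsymbol{x}\neq\boldsymbol{y}$, put $\boldsymbol{r}=\boldsymbol{x}-\boldsymbol{y}$ and $r=|\boldsymbol{x}-\boldsymbol{y}|$. The kernel $\boldsymbol{\Sigma}(\boldsymbol{x},\boldsymbol{y})=\mathcal{T}_{\boldsymbol{x}}\mathbf{G}(\boldsymbol{x},\boldsymbol{y})$ of the adjoint of the elastic double layer boundary operator admits the decomposition $$\boldsymbol{\Sigma}(\boldsymbol{x},\boldsymbol{y})=\mathcal{T}_{\boldsymbol{x}}\mathbf{E}(\boldsymbol{x},\boldsymbol{y})+\ln(r)\,\mathbf{F}_{\boldsymbol{x}}(\boldsymbol{x},\boldsymbol{y})+\boldsymbol{R}_{\boldsymbol{\Sigma}}(\boldsymbol{x},\boldsymbol{y}),$$ with $$\mathcal{T}_{\boldsymbol{x}}\mathbf{E}(\boldsymbol{x},\boldsymbol{y})=-\frac{\boldsymbol{n}(\boldsymbol{x})\cdot\boldsymbol{r}}{2\pi r^2}\mathbf{I}+\frac{\mu}{\lambda+2\mu}\frac{\boldsymbol{\tau}(\boldsymbol{x})\cdot\boldsymbol{r}}{2\pi r^2}\mathbf{L}+\frac{\lambda+\mu}{\lambda+2\mu}\left(-\frac{(\boldsymbol{n}(\boldsymbol{x})\cdot\boldsymbol{r})\,\boldsymbol{r}\otimes\boldsymbol{r}}{\pi r^4}+\frac{\boldsymbol{n}(\boldsymbol{x})\cdot\boldsymbol{r}}{2\pi r^2}\mathbf{I}\right),$$ $$\mathbf{F}_{\boldsymbol{x}}(\boldsymbol{x},\boldsymbol{y})=-\frac{2}{\pi}\,\mathrm{Im}\left\{\mathcal{T}_{\boldsymbol{x}}\mathbf{G}(\boldsymbol{x},\boldsymbol{y})\right\},$$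 and $\boldsymbol{R}_{\boldsymbol{\Sigma}}(\boldsymbol{x},\boldsymbol{y})\to0$ when $\boldsymbol{x}\to\boldsymbol{y}$. Both $\mathbf{F}_{\boldsymbol{x}}(\boldsymbol{x},\boldsymbol{y})$ and $\boldsymbol{R}_{\boldsymbol{\Sigma}}(\boldsymbol{x},\boldsymbol{y})$ are analytic on $\Gamma$ if $\Gamma$ is smooth.
   Context: Setting: $\lambda,\mu,\rho,\omega$ are real constants with $\mu>0$, $\lambda+\mu>0$, $\rho>0$, $\omega>0$; $k_{\mathfrak p}=\omega\sqrt{\rho/(\lambda+2\mu)}$ and $k_{\mathfrak s}=\omega\sqrt{\rho/\mu}$. $\Gamma\subset\mathbb{R}^2$ is the piecewise smooth boundary (with finitely many corners) of a domain $\Omega\subset\mathbb{R}^2$ such that either $\Omega$ or $\mathbb{R}^2\setminus\overline{\Omega}$ is bounded. On $\Gamma$ (away from corners), $\boldsymbol{n}=(n_1,n_2)^\top$ is the unit normal and $\boldsymbol{\tau}=(\tau_1,\tau_2)^\top=(-n_2,n_1)^\top$ the unit tangent. Green's functions, for $\boldsymbol{x}\ne\boldsymbol{y}$ and $r=|\boldsymbol{x}-\boldsymbol{y}|$: for the Navier equation $\mu\Delta\boldsymbol{u}+(\lambda+\mu)\nabla(\nabla\cdot\boldsymbol{u})+\rho\omega^2\boldsymbol{u}=0$, $$\mathbf{G}(\boldsymbol{x},\boldsymbol{y})=\frac{i}{4\mu}\left\{H_0^{(1)}(k_{\mathfrak s}r)\,\mathbf{I}+\frac{1}{k_{\mathfrak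 s}^2}\nabla_{\boldsymbol{x}}\nabla_{\boldsymbol{x}}^\top\left(H_0^{(1)}(k_{\mathfrak s}r)-H_0^{(1)}(k_{\mathfrak p}r)\right)\right\},$$ and for the Lamé system (the case $\omega=0$), $$\mathbf{E}(\boldsymbol{x},\boldsymbol{y})=\frac{\lambda+3\mu}{4\pi\mu(\lambda+2\mu)}\left\{-\ln|\boldsymbol{x}-\boldsymbol{y}|\,\mathbf{I}+\frac{\lambda+\mu}{\lambda+3\mu}\frac{1}{r^2}(\boldsymbol{x}-\boldsymbol{y})(\boldsymbol{x}-\boldsymbol{y})^\top\right\}.$$ Here $H_0^{(1)}$ is the Hankel function of the first kind of order zero and $\mathbf{I}$ is the $2\times2$ identity matrix. The traction operator is $\mathcal{T}\boldsymbol{u}=2\mu\frac{\partial\boldsymbol{u}}{\partial\boldsymbol{n}}+\lambda(\nabla\cdot\boldsymbol{u})\boldsymbol{n}-\mu\,\boldsymbol{\tau}\,\mathrm{curl}\,\boldsymbol{u}$, with $\mathrm{curl}\,\boldsymbol{u}=\partial_{x_1}u_2-\partial_{x_2}u_1$. $\mathcal{T}_{\boldsymbol{x}}$ denotes the traction operator acting on the variable $\boldsymbol{x}$ (with $\boldsymbol{n}=\boldsymbol{n}(\boldsymbol{x})$, $\boldsymbol{\tau}=\boldsymbol{\tau}(\boldsymbol{x})$), applied to a matrix column by column. Further, $\mathbf{L}=\begin{pmatrix}0&1\\-1&0\end{pmatrix}$, $\otimes$ is the outer product of two vectors ($\boldsymbol{a}\otimes\boldsymbol{b}=\boldsymbol{a}\boldsymbol{b}^\top$),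 and $\mathrm{Im}$ is the entrywise imaginary part.
   Formalization: ''Analytic on Γ if Γ is smooth'' fails or has no meaning on merely smooth curves; what is proved is that F and R are infinitely differentiable in smooth parametrizations of Γ and jointly real-analytic in real-analytic parametrizations, diagonal included. *)

(* Defs.v *)
From Stdlib Require Import Reals List Factorial.
From Coquelicot Require Import Coquelicot.
Open Scope R_scope.

(** * Points of the plane, 2-vectors and 2x2 matrices *)

Definition R2 : Type := (R * R)%type.

Inductive ix : Type := i1 | i2.

Definition co (x : R2) (i : ix) : R :=
  match i with i1 => fst x | i2 => snd x end.

Definition delta (i j : ix) : R :=
  match i, j with i1, i1 => 1 | i2, i2 => 1 | _, _ => 0 end.

Definition Lmat (i j : ix) : R :=
  match i, j with i1, i2 => 1 | i2, i1 => -1 | _, _ => 0 end.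

Definition sub2 (x y : R2) : R2 := (fst x - fst y, snd x - snd y).
Definition dot (a b : R2) : R := fst a * fst b + snd a * snd b.
Definition len (x : R2) : R := sqrt (dot x x).
Definition dist2 (x y : R2) : R := len (sub2 x y).

(** The unit tangent attached to the unit normal [n]. *)
Definition tangent (n : R2) : R2 := (- snd n, fst n).

(** * Hankel function of the first kind of order zero, on the positive axis *)

Definition euler_gamma : R :=
  real (Lim_seq (fun n => sum_n_m (fun k => / INR k) 1 n - ln (INR n))).

Definition harmonic (k : nat) : R := sum_n_m (fun j => / INR j) 1 k.

Definition J0 (x : R) : R :=
  PSeries (fun k => (-1) ^ k / (INR (fact k)) ^ 2) ((x / 2) ^ 2).

Definition Y0 (x : R) : R :=
  2 / PI * (ln (x / 2) + euler_gamma) * J0 x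
  - 2 / PI * PSeries (fun k => (-1) ^ k * harmonic k / (INR (fact k)) ^ 2)
                     ((x / 2) ^ 2).

Definition H10 (x : R) : C := (J0 x, Y0 x).

(** * Differential operators on complex-valued functions of a point *)

Definition partial (j : ix) (f : R2 -> C) (x : R2) : C :=
  match j with
  | i1 => (Derive (fun t => Re (f (t, snd x))) (fst x),
           Derive (fun t => Im (f (t, snd x))) (fst x))
  | i2 => (Derive (fun t => Re (f (fst x, t))) (snd x),
           Derive (fun t => Im (f (fst x, t))) (snd x))
  end.

Definition divergence (u : R2 -> ix -> C) (x : R2) : C :=
  (partial i1 (fun p => u p i1) x + partial i2 (fun p => u p i2) x)%C.

Definition curl (u : R2 -> ix -> C) (x : R2) : C :=
  (partial i1 (fun p => u p i2) x - partial i2 (fun p => u p i1) x)%C.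

Definition normal_derivative (n : R2) (u : R2 -> ix -> C) (x : R2) (i : ix) : C :=
  (RtoC (co n i1) * partial i1 (fun p => u p i) x
   + RtoC (co n i2) * partial i2 (fun p => u p i) x)%C.

(** [n] is the value of the unit normal at [x]. *)
Definition traction (lam mu : R) (n : R2) (u : R2 -> ix -> C) (x : R2) (i : ix) : C :=
  (RtoC (2 * mu) * normal_derivative n u x i
   + RtoC lam * divergence u x * RtoC (co n i)
   - RtoC mu * RtoC (co (tangent n) i) * curl u x)%C.

(** Traction with respect to the first variable, column by column. *)
Definition traction_x (lam mu : R) (n : R2 -> R2) (K : R2 -> R2 -> ix -> ix -> C)
    (x y : R2) (i j : ix) : C :=
  traction lam mu (n x) (fun p k => K p y k j) x i.

(** * Green's functions *)

Definition kp (lam mu rho omega : R) : R := omega * sqrt (rho / (lam + 2 * mu)).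
Definition ks (mu rho omega : R) : R := omega * sqrt (rho / mu).

Definition Gmat (lam mu rho omega : R) (x y : R2) (i j : ix) : C :=
  (Ci / RtoC (4 * mu) *
   (H10 (ks mu rho omega * dist2 x y) * RtoC (delta i j)
    + RtoC (/ (ks mu rho omega) ^ 2) *
      partial i (partial j (fun p =>
        H10 (ks mu rho omega * dist2 p y)
        - H10 (kp lam mu rho omega * dist2 p y))) x))%C.

Definition Emat (lam mu : R) (x y : R2) (i j : ix) : C :=
  RtoC ((lam + 3 * mu) / (4 * PI * mu * (lam + 2 * mu)) *
    (- ln (dist2 x y) * delta i j
     + (lam + mu) / (lam + 3 * mu) * / (dist2 x y) ^ 2
       * (co (sub2 x y) i * co (sub2 x y) j))).

(** * Domains of the plane *)

Definition closure2 (D : R2 -> Prop) (x : R2) : Prop :=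
  forall eps, 0 < eps -> exists y, D y /\ dist2 x y < eps.

Definition boundary (D : R2 -> Prop) (x : R2) : Prop :=
  closure2 D x /\ closure2 (fun y => ~ D y) x.

Definition open2 (D : R2 -> Prop) : Prop :=
  forall x, D x -> exists eps, 0 < eps /\ forall y, dist2 x y < eps -> D y.

Definition bounded2 (D : R2 -> Prop) : Prop :=
  exists M, forall x, D x -> len x <= M.

Definition plane_domain (D : R2 -> Prop) : Prop :=
  open2 D /\ (exists x, D x) /\
  ~ (exists U V : R2 -> Prop,
       open2 U /\ open2 V /\ (exists x, D x /\ U x) /\ (exists x, D x /\ V x) /\
       (forall x, D x -> U x \/ V x) /\ (forall x, D x -> ~ (U x /\ V x))).

(** * Curves *)

Definition smooth1 (f : R -> R) (a b : R) : Prop :=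
  forall k t, a < t < b -> ex_derive_n f k t.

Definition analytic1 (f : R -> R) (a b : R) : Prop :=
  forall t0, a < t0 < b ->
  exists (c : nat -> R) (rad : R), 0 < rad /\
    forall t, Rabs (t - t0) < rad -> is_pseries c (t - t0) (f t).

Definition velocity (z : R -> R2) (t : R) : R2 :=
  (Derive (fun s => fst (z s)) t, Derive (fun s => snd (z s)) t).

Definition regular_smooth (z : R -> R2) (a b : R) : Prop :=
  smooth1 (fun t => fst (z t)) a b /\ smooth1 (fun t => snd (z t)) a b /\
  forall t, a < t < b -> velocity z t <> (0, 0).

(** A regular smooth local parametrization of [Gamma]: the last clause says that
    [z] is an open map from the interval to [Gamma] (with the induced topology),
    so that [z] is a homeomorphism onto a relatively open piece of [Gamma]. *)
Definition local_param (Gamma : R2 -> Prop) (z : R -> R2) (a b : R) : Prop :=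
  regular_smooth z a b /\
  (forall t, a < t < b -> Gamma (z t)) /\
  (forall t s, a < t < b -> a < s < b -> z t = z s -> t = s) /\
  (forall t, a < t < b -> forall eta, 0 < eta ->
     exists d, 0 < d /\ forall x, Gamma x -> dist2 x (z t) < d ->
     exists s, a < s < b /\ Rabs (s - t) < eta /\ x = z s).

Definition analytic_param (z : R -> R2) (a b : R) : Prop :=
  analytic1 (fun t => fst (z t)) a b /\ analytic1 (fun t => snd (z t)) a b.

(** Near a corner [p], [Gamma] consists of two arcs issuing from [p], each smooth
    and regular up to [p] (the arcs are the restrictions of [z1], [z2] to [[0,b)]). *)
Definition corner (Gamma : R2 -> Prop) (p : R2) : Prop :=
  exists (z1 z2 : R -> R2) (b : R), 0 < b /\
    regular_smooth z1 (- b) b /\ regular_smooth z2 (- b) b /\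
    z1 0 = p /\ z2 0 = p /\
    (forall t, 0 <= t < b -> Gamma (z1 t) /\ Gamma (z2 t)) /\
    (forall t s, 0 <= t < b -> 0 <= s < b -> z1 t = z1 s -> t = s) /\
    (forall t s, 0 <= t < b -> 0 <= s < b -> z2 t = z2 s -> t = s) /\
    (forall t s, 0 < t < b -> 0 < s < b -> z1 t <> z2 s) /\
    (forall eta, 0 < eta -> exists d, 0 < d /\
       forall x, Gamma x -> dist2 x p < d ->
       exists t, 0 <= t < b /\ t < eta /\ (x = z1 t \/ x = z2 t)).

Definition piecewise_smooth (Gamma : R2 -> Prop) (corners : list R2) : Prop :=
  (forall p, In p corners -> Gamma p /\ corner Gamma p) /\
  (forall p, Gamma p -> ~ In p corners ->
     exists (z : R -> R2) (a b t : R),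
       local_param Gamma z a b /\ a < t < b /\ z t = p).

(** A continuous choice of unit normal away from the corners; the orientation
    (outward or inward) is left free. *)
Definition unit_normal (Gamma : R2 -> Prop) (corners : list R2) (n : R2 -> R2) : Prop :=
  (forall x, Gamma x -> ~ In x corners -> len (n x) = 1) /\
  (forall z a b t, local_param Gamma z a b -> a < t < b -> ~ In (z t) corners ->
     dot (n (z t)) (velocity z t) = 0) /\
  (forall x, Gamma x -> ~ In x corners -> forall eps, 0 < eps ->
     exists d, 0 < d /\ forall y, Gamma y -> ~ In y corners ->
       dist2 y x < d -> dist2 (n y) (n x) < eps).

(** * Regularity of kernels on [Gamma * Gamma] *)

(** Joint real-analyticity at a point: an absolutely convergent double power
    series, summed by total degree. *)
Definition analytic2_at (f : R -> R -> R) (t0 s0 : R) : Prop :=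
  exists (c : nat -> nat -> R) (rad : R), 0 < rad /\
    forall h k, Rabs h < rad -> Rabs k < rad ->
      ex_series (fun d => sum_f_R0 (fun m => Rabs (c m (d - m)%nat * h ^ m * k ^ (d - m))) d) /\
      is_series (fun d => sum_f_R0 (fun m => c m (d - m)%nat * h ^ m * k ^ (d - m)) d)
                (f (t0 + h) (s0 + k)).

(** On a curve that is merely smooth, analyticity of a function has no meaning in
    itself; a kernel on a smooth curve is called analytic when it is as regular
    as the curve permits, jointly in both variables and across the diagonal:
    infinitely differentiable in smooth local parametrizations, and real-analytic
    in every pair of real-analytic ones. *)
Definition analytic_on (Gamma : R2 -> Prop) (K : R2 -> R2 -> R) : Prop :=
  forall z a b w c d, local_param Gamma z a b -> local_param Gamma w c d ->
  forall t s, a < t < b -> c < s < d ->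
    (forall k : nat, ex_diff_n (fun t s => K (z t) (w s)) k t s) /\
    (analytic_param z a b -> analytic_param w c d ->
       analytic2_at (fun t s => K (z t) (w s)) t s).

(* Main.v *)
Require Import Defs.
From Stdlib Require Import Reals List Factorial Classical ClassicalEpsilon.
From Stdlib Require Import FunctionalExtensionality Lra Lia.
From Coquelicot Require Import Coquelicot.
Open Scope R_scope.

(** With s = |x - y|^2, J0(k|x-y|) is an entire function of s and Y0(k|x-y|) is
    (ln s / pi) J0 plus an entire function of s.  Hence in T_x G the coefficient of ln s is
    -(1/pi) Im T_x G, while the poles of the derivatives of ln s reproduce T_x E, up to one
    term (n(x).r) r_i r_j g(s) / s with g entire.  On the curve this term is regular: if
    x = z(t) and y = w(s) lie on the same arc, then z = w o phi with phi' = z_i' / w_i'(phi),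
    so that r = (phi(t) - s) delta(t, s) for a nonvanishing divided difference delta, and
    phi(t) - s cancels.

    Smoothness and real analyticity are handled together, through Cauchy-type bounds on all
    derivatives of order at most N, respectively on all derivatives.  The bounds are those of
    the majorants A (1 - L u)^(-p); the real exponent p makes this family closed under products,
    derivatives, compositions and solutions of differential equations. *)

(** * Majorants *)

(** The singular term comes from J0(k_s r) - J0(k_p r) = c s + s^2 e(s), with c a constant and e
    entire. In the third derivatives of (ln s / pi) times this difference, the part c s supplies
    poles of the static kernel, whereas s^2 e(s) leaves 2 e(s) / (pi s), multiplied by r_i r_j r_k.
    The traction reduces r_i r_j r_k / s to (n.r) r_i r_j / s and a polynomial: its curl part
    vanishes by symmetry and its divergence part is r_j.

    For the limit x -> y it is enough that r_i r_j / s is bounded, so corners are harmless. For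
    analyticity it is not: (n.r) r_i r_j / s is homogeneous of degree one in r and not
    differentiable at r = 0, so regularity has to come from the curve. There x and y are given by
    two unrelated parametrizations; the differential equation of phi plays the part of an inverse
    function theorem, in the smooth and in the analytic class at once.

    Bounds on iterated partial derivatives are a language common to both classes: an analytic
    function is one whose constants serve all orders. Only at the end are these bounds turned back
    into a double series. *)

Definition pd1 (f : R -> R -> R) (t s : R) : R := Derive (fun u => f u s) t.
Definition pd2 (f : R -> R -> R) (t s : R) : R := Derive (fun v => f t v) s.

(* All derivatives of [f] of order k <= n exist on [U] and are bounded by the k-th
   derivative of A (1 - L u)^(-p) at u = 0. *)
Fixpoint dominated (n : nat) (U : R -> R -> Prop) (A L p : R) (f : R -> R -> R) : Prop :=
  (forall t s, U t s -> Rabs (f t s) <= A) /\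
  match n with
  | O => True
  | S m =>
      (forall t s, U t s ->
         ex_derive (fun u => f u s) t /\ ex_derive (fun v => f t v) s) /\
      dominated m U (A * (p * L)) L (p + 1) (pd1 f) /\
      dominated m U (A * (p * L)) L (p + 1) (pd2 f)
  end.

(** Partial derivatives only see the two coordinate sections, so openness is asked of these.
    Cylinders over an open set of the first variable qualify, which serves functions of one
    variable. *)
Definition sec_open (U : R -> R -> Prop) : Prop :=
  forall t s, U t s -> locally t (fun u => U u s) /\ locally s (fun v => U t v).

Lemma dominated_bound n U A L p f t s :
  dominated n U A L p f -> U t s -> Rabs (f t s) <= A.
Proof. destruct n; intros [H _]; auto. Qed.

Lemma dominated_subset n U U' A L p f :
  (forall t s, U' t s -> U t s) -> dominated n U A L p f -> dominated n U' A L p f.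
Proof.
  intros HU; revert A p f; induction n as [|n IH]; intros A p f H; simpl in *.
  - split; [intros; apply H; auto | exact I].
  - destruct H as (H1 & H2 & H3 & H4).
    split; [auto | split; [auto | split; auto]].
Qed.

(** The k-th bound is A times the product of the factors (p + j) L for j < k. Each factor is at most
    (p' + j) L' as soon as p L <= p' L' and L <= L', so a larger rate pays for a smaller
    exponent. *)
Lemma dominated_weaken n U A A' L L' p p' f :
  0 <= A -> A <= A' -> 0 <= L -> L <= L' -> 0 <= p -> 0 <= p' -> p * L <= p' * L' ->
  dominated n U A L p f -> dominated n U A' L' p' f.
Proof.
  revert A A' p p' f; induction n as [|n IH]; intros A A' p p' f HA HA' HL HL' Hp Hp' Hpl H;
    simpl in *; destruct H as [H1 H2].
  - split; auto; intros; eapply Rle_trans; eauto.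
  - destruct H2 as (H2 & H3 & H4).
    assert (E0 : 0 <= p * L) by (apply Rmult_le_pos; auto).
    assert (E1 : 0 <= A * (p * L)) by (apply Rmult_le_pos; auto).
    assert (E2 : A * (p * L) <= A' * (p' * L')) by (apply Rmult_le_compat; auto).
    assert (E3 : (p + 1) * L <= (p' + 1) * L') by lra.
    assert (E4 : 0 <= p + 1) by lra.
    assert (E5 : 0 <= p' + 1) by lra.
    split; [intros; eapply Rle_trans; eauto | split; [exact H2 |]].
    split; apply (IH (A * (p * L)) _ (p + 1)); auto.
Qed.

Lemma dominated_le n m U A L p f : (m <= n)%nat -> dominated n U A L p f -> dominated m U A L p f.
Proof.
  revert m A p f; induction n as [|n IH]; intros m A p f Hm H.
  - replace m with 0%nat by lia; exact H.
  - destruct H as (H1 & H2 & H3 & H4); destruct m as [|m]; simpl.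
    + split; auto.
    + split; [auto | split; [auto |]]; split; apply IH; auto; lia.
Qed.

Lemma dominated_ext n U A L p f g :
  sec_open U -> (forall t s, U t s -> f t s = g t s) -> dominated n U A L p f ->
    dominated n U A L p g.
Proof.
  intros HU; revert A p f g; induction n as [|n IH]; intros A p f g Hfg H; simpl in *.
  - split; [intros t s Hts; rewrite <- Hfg by auto; apply H; auto | exact I].
  - destruct H as (H1 & H2 & H3 & H4).
    assert (L1 : forall t s, U t s -> locally t (fun u => f u s = g u s)).
    { intros t s Hts; generalize (proj1 (HU t s Hts)); apply filter_imp; auto. }
    assert (L2 : forall t s, U t s -> locally s (fun v => f t v = g t v)).
    { intros t s Hts; generalize (proj2 (HU t s Hts)); apply filter_imp; auto. }
    split; [intros t s Hts; rewrite <- Hfg by auto; auto |].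
    split; [intros t s Hts; destruct (H2 t s Hts) as [E1 E2]; split |].
    + apply (ex_derive_ext_loc (fun u => f u s)); auto.
    + apply (ex_derive_ext_loc (fun v => f t v)); auto.
    + split; [apply IH with (pd1 f) | apply IH with (pd2 f)]; auto; intros t s Hts;
        apply Derive_ext_loc; auto.
Qed.

Lemma dominated_swap n U A L p f :
  dominated n U A L p f -> dominated n (fun t s => U s t) A L p (fun t s => f s t).
Proof.
  revert A p f; induction n as [|n IH]; intros A p f H; simpl in *.
  - split; [intros; apply H; auto | exact I].
  - destruct H as (H1 & H2 & H3 & H4).
    split; [intros; apply H1; auto |].
    split; [intros t s Hts; destruct (H2 _ _ Hts) as [E1 E2]; split; [exact E2 | exact E1] |].
    split; [apply (IH _ _ (pd2 f)) | apply (IH _ _ (pd1 f))]; auto.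
Qed.

Lemma dominated_zero n U A L p : 0 <= A -> 0 <= L -> 0 <= p -> dominated n U A L p (fun _ _ => 0).
Proof.
  revert A p; induction n as [|n IH]; intros A p HA HL Hp; simpl.
  - split; auto; intros; rewrite Rabs_R0; auto.
  - split; [intros; rewrite Rabs_R0; auto |].
    split; [intros; split; apply ex_derive_const |].
    assert (0 <= A * (p * L)) by (repeat apply Rmult_le_pos; lra).
    replace (pd1 (fun _ _ : R => 0)) with (fun _ _ : R => 0)
      by (unfold pd1; extensionality t; extensionality s; symmetry; apply Derive_const).
    replace (pd2 (fun _ _ : R => 0)) with (fun _ _ : R => 0)
      by (unfold pd2; extensionality t; extensionality s; symmetry; apply Derive_const).
    split; apply IH; lra.
Qed.

Lemma dominated_const n U L p c : 0 <= L -> 0 <= p -> dominated n U (Rabs c) L p (fun _ _ => c).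
Proof.
  intros HL Hp; destruct n as [|n]; simpl.
  - split; auto; intros; lra.
  - split; [intros; lra |].
    split; [intros; split; apply ex_derive_const |].
    assert (0 <= Rabs c * (p * L)) by (repeat apply Rmult_le_pos; auto; apply Rabs_pos).
    replace (pd1 (fun _ _ : R => c)) with (fun _ _ : R => 0)
      by (unfold pd1; extensionality t; extensionality s; symmetry; apply Derive_const).
    replace (pd2 (fun _ _ : R => c)) with (fun _ _ : R => 0)
      by (unfold pd2; extensionality t; extensionality s; symmetry; apply Derive_const).
    split; apply dominated_zero; lra.
Qed.

Lemma dominated_plus n U A B L p f g :
  sec_open U -> dominated n U A L p f -> dominated n U B L p g ->
  dominated n U (A + B) L p (fun t s => f t s + g t s).
Proof.
  intros HU; revert A B p f g; induction n as [|n IH]; intros A B p f g Hf Hg; simpl in *.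
  - split; auto; intros; eapply Rle_trans; [apply Rabs_triang |].
    apply Rplus_le_compat; [apply Hf | apply Hg]; auto.
  - destruct Hf as (F1 & F2 & F3 & F4); destruct Hg as (G1 & G2 & G3 & G4).
    split; [intros; eapply Rle_trans; [apply Rabs_triang |];
            apply Rplus_le_compat; [apply F1 | apply G1]; auto |].
    split.
    { intros t s Hts; destruct (F2 t s Hts), (G2 t s Hts); split.
      - apply @ex_derive_plus; auto.
      - apply @ex_derive_plus; auto. }
    replace ((A + B) * (p * L)) with (A * (p * L) + B * (p * L)) by ring.
    split.
    + apply dominated_ext with (fun t s => pd1 f t s + pd1 g t s); auto.
      intros t s Hts; symmetry; destruct (F2 t s Hts), (G2 t s Hts); apply Derive_plus; assumption.
    + apply dominated_ext with (fun t s => pd2 f t s + pd2 g t s); auto.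
      intros t s Hts; symmetry; destruct (F2 t s Hts), (G2 t s Hts); apply Derive_plus; assumption.
Qed.

(* Leibniz' rule matches (1 - L u)^-p * (1 - L u)^-q = (1 - L u)^-(p + q). *)
Lemma dominated_mult n U A B L p q f g :
  sec_open U -> 0 <= A -> 0 <= B -> 0 <= L -> 0 <= p -> 0 <= q ->
  dominated n U A L p f -> dominated n U B L q g ->
  dominated n U (A * B) L (p + q) (fun t s => f t s * g t s).
Proof.
  intros HU; revert A B p q f g;
    induction n as [|n IH]; intros A B p q f g HA HB HL Hp Hq Hf Hg.
  - simpl in *; split; auto; intros; rewrite Rabs_mult.
    apply Rmult_le_compat; try apply Rabs_pos; [apply Hf | apply Hg]; auto.
  - assert (Hf' := dominated_le _ n _ _ _ _ _ (Nat.le_succ_diag_r n) Hf).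
    assert (Hg' := dominated_le _ n _ _ _ _ _ (Nat.le_succ_diag_r n) Hg).
    assert (0 <= A * (p * L)) by (repeat apply Rmult_le_pos; lra).
    assert (0 <= B * (q * L)) by (repeat apply Rmult_le_pos; lra).
    destruct Hf as (F1 & F2 & F3 & F4); destruct Hg as (G1 & G2 & G3 & G4).
    split; [intros; rewrite Rabs_mult;
            apply Rmult_le_compat; try apply Rabs_pos; [apply F1 | apply G1]; auto |].
    split.
    { intros t s Hts; destruct (F2 t s Hts), (G2 t s Hts); split.
      - apply ex_derive_mult; auto.
      - apply ex_derive_mult; auto. }
    replace (A * B * ((p + q) * L)) with (A * (p * L) * B + A * (B * (q * L))) by ring.
    split.
    + apply dominated_ext with (fun t s => pd1 f t s * g t s + f t s * pd1 g t s); auto.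
      { intros t s Hts; symmetry; destruct (F2 t s Hts), (G2 t s Hts); apply Derive_mult;
        assumption. }
      apply dominated_plus; auto.
      * replace (p + q + 1) with (p + 1 + q) by ring; apply IH; auto; lra.
      * replace (p + q + 1) with (p + (q + 1)) by ring; apply IH; auto; lra.
    + apply dominated_ext with (fun t s => pd2 f t s * g t s + f t s * pd2 g t s); auto.
      { intros t s Hts; symmetry; destruct (F2 t s Hts), (G2 t s Hts); apply Derive_mult;
        assumption. }
      apply dominated_plus; auto.
      * replace (p + q + 1) with (p + 1 + q) by ring; apply IH; auto; lra.
      * replace (p + q + 1) with (p + (q + 1)) by ring; apply IH; auto; lra.
Qed.

(** One variable is encoded as two with a constant second one, so that the rules for sums, products
    and extensionality apply as they are. *)
Definition dominated1 (n : nat) (V : R -> Prop) (A L p : R) (g : R -> R) : Prop :=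
  dominated n (fun t _ => V t) A L p (fun t _ => g t).

Lemma dominated1_bound n V A L p g t : dominated1 n V A L p g -> V t -> Rabs (g t) <= A.
Proof. intros H Ht; exact (dominated_bound _ _ _ _ _ _ t 0 H Ht). Qed.

Lemma dominated1_S_inv n V A L p g :
  dominated1 (S n) V A L p g ->
  (forall t, V t -> ex_derive g t) /\ dominated1 n V (A * (p * L)) L (p + 1) (Derive g).
Proof.
  intros (_ & H2 & H3 & _); split; [| exact H3].
  intros t Ht; exact (proj1 (H2 t 0 Ht)).
Qed.

Lemma dominated1_S n V A L p g :
  0 <= A -> 0 <= L -> 0 <= p ->
  (forall t, V t -> Rabs (g t) <= A) -> (forall t, V t -> ex_derive g t) ->
  dominated1 n V (A * (p * L)) L (p + 1) (Derive g) -> dominated1 (S n) V A L p g.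
Proof.
  intros HA HL Hp H1 H2 H3; split; [intros; auto |]; split.
  - intros t s Ht; split; [apply H2; auto | apply ex_derive_const].
  - split; [exact H3 |].
    replace (pd2 (fun t _ : R => g t)) with (fun _ _ : R => 0)
      by (unfold pd2; extensionality t; extensionality s; symmetry; apply Derive_const).
    apply dominated_zero; try lra; repeat apply Rmult_le_pos; lra.
Qed.

Lemma dominated1_of_dominated n U V A L p g :
  0 <= A -> 0 <= L -> 0 <= p ->
  (forall t, V t -> exists s, U t s) -> dominated n U A L p (fun t _ => g t) ->
    dominated1 n V A L p g.
Proof.
  intros HA HL Hp HV; revert A p g HA Hp; induction n as [|n IH]; intros A p g HA Hp H.
  - split; [| exact I]; intros t s Ht; destruct (HV t Ht) as [s' Hs'].
    exact (proj1 H t s' Hs').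
  - assert (0 <= A * (p * L)) by (repeat apply Rmult_le_pos; lra).
    destruct H as (H1 & H2 & H3 & _); apply dominated1_S; auto.
    + intros t Ht; destruct (HV t Ht) as [s' Hs']; exact (H1 t s' Hs').
    + intros t Ht; destruct (HV t Ht) as [s' Hs']; exact (proj1 (H2 t s' Hs')).
    + apply IH; auto; lra.
Qed.

Lemma sec_open_lift (V : R -> Prop) : open V -> sec_open (fun t _ => V t).
Proof.
  intros HV t s Ht; split; [exact (HV t Ht) | apply filter_forall; auto].
Qed.

(* The composition rule mirrors the identity D (1 - K v)^-q with
   v = (1 - sqrt (1 - 2 K C u)) / K, a solution of v' = C (1 - 2 K C u)^(-1/2). *)
Lemma dominated_comp n V D K q G U A L0 L f :
  sec_open U -> 0 <= D -> 0 <= K -> 0 <= q -> 0 <= A -> 0 <= L0 ->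
  4 * L0 <= L -> 2 * (K * (A * L0)) <= L ->
  (forall t s, U t s -> V (f t s)) ->
  dominated1 n V D K q G -> dominated n U A L0 1 f ->
  dominated n U D L (q / 2) (fun t s => G (f t s)).
Proof.
  intros HU HD HK Hq HA HL0 HL1 HL2 HV; revert D q G HD Hq.
  induction n as [|n IH]; intros D q G HD Hq HG Hf.
  - split; [| exact I]; intros t s Hts; apply (dominated1_bound _ _ _ _ _ _ _ HG); auto.
  - assert (HAL : 0 <= A * L0) by (apply Rmult_le_pos; lra).
    assert (HKAL : 0 <= K * (A * L0)) by (apply Rmult_le_pos; lra).
    assert (HDq0 : 0 <= D * q) by (apply Rmult_le_pos; lra).
    assert (HDq : 0 <= D * (q * K)) by (repeat apply Rmult_le_pos; lra).
    assert (Hf' := dominated_le _ n _ _ _ _ _ (Nat.le_succ_diag_r n) Hf).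
    assert (HG0 := HG); apply dominated1_S_inv in HG; destruct HG as [HG1 HG2].
    destruct Hf as (F1 & F2 & F3 & F4).
    assert (Hq1 : 0 <= q + 1) by lra.
    assert (HGf := IH _ _ _ HDq Hq1 HG2 Hf').
    assert (Key : forall f', dominated n U (A * (1 * L0)) L0 (1 + 1) f' ->
      dominated n U (D * (q / 2 * L)) L (q / 2 + 1) (fun t s => Derive G (f t s) * f' t s)).
    { intros f' Hd.
      (* A derivative of [f] has exponent 2 at the rate L0. As 2 L0 <= L / 2, it also has exponent
         1/2 at the rate L, and (q + 1) / 2 + 1 / 2 is the exponent q / 2 + 1 expected of a
         derivative. *)
      apply (dominated_weaken _ _ (A * (1 * L0)) (A * L0) L0 L (1 + 1) (1 / 2)) in Hd; try lra.
      assert (Hm := dominated_mult n U _ _ L ((q + 1) / 2) (1 / 2) _ _ HU HDq HAL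
                      ltac:(lra) ltac:(lra) ltac:(lra) HGf Hd).
      replace ((q + 1) / 2 + 1 / 2) with (q / 2 + 1) in Hm by field.
      eapply dominated_weaken; [| | | | | | | exact Hm]; try lra.
      - replace (D * (q * K) * (A * L0)) with ((D * q) * (K * (A * L0))) by ring.
        apply Rmult_le_pos; lra.
      - replace (D * (q * K) * (A * L0)) with ((D * q) * (K * (A * L0))) by ring.
        replace (D * (q / 2 * L)) with ((D * q) * (L / 2)) by field.
        apply Rmult_le_compat_l; lra. }
    split; [intros t s Hts; apply (dominated1_bound _ _ _ _ _ _ _ HG0); auto |].
    split.
    { intros t s Hts; destruct (F2 t s Hts); split.
      - apply (ex_derive_comp G (fun u => f u s)); auto.
      - apply (ex_derive_comp G (fun v => f t v)); auto. }
    split.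
    + apply dominated_ext with (fun t s => Derive G (f t s) * pd1 f t s); auto.
      intros t s Hts; symmetry; unfold pd1 at 1.
      rewrite (Derive_comp G (fun u => f u s)); [unfold pd1; ring | auto |
        exact (proj1 (F2 t s Hts))].
    + apply dominated_ext with (fun t s => Derive G (f t s) * pd2 f t s); auto.
      intros t s Hts; symmetry; unfold pd2 at 1.
      rewrite (Derive_comp G (fun u => f t u)); [unfold pd2; ring | auto |
        exact (proj2 (F2 t s Hts))].
Qed.

(* For phi' = Z(t) G(phi(t)) the majorant equation v' = C D (1 - K v)^-1 (1 - 3 K C D u)^(-1/3)
   is solved by 1 - K v = (1 - 3 K C D u)^(1/3). *)
Lemma dominated_ode_comp n V W D K C L B q G Z phi H :
  open W -> 0 <= D -> 0 <= K -> 0 <= C -> 0 <= B -> 0 <= q -> 3 * (K * (D * C)) <= L ->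
  (forall t, W t -> V (phi t)) ->
  (forall t, W t -> is_derive phi t (Z t * G (phi t))) ->
  dominated1 n V D K 1 G -> dominated1 n W C L (1 / 3) Z -> dominated1 n V B K q H ->
  dominated1 n W B L (q / 3) (fun t => H (phi t)).
Proof.
  intros HW HD HK HC HB Hq HL HV Hphi; revert B q H HB Hq.
  assert (HDC : 0 <= D * C) by (apply Rmult_le_pos; lra).
  assert (HKDC : 0 <= K * (D * C)) by (apply Rmult_le_pos; lra).
  induction n as [|n IH]; intros B q H HB Hq HG HZ HH.
  - split; [| exact I]; intros t s Hts; apply (dominated1_bound _ _ _ _ _ _ _ HH); auto.
  - assert (HBq : 0 <= B * (q * K)) by (repeat apply Rmult_le_pos; lra).
    assert (HBq0 : 0 <= B * q) by (apply Rmult_le_pos; lra).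
    assert (HG' := dominated_le _ n _ _ _ _ _ (Nat.le_succ_diag_r n) HG).
    assert (HZ' := dominated_le _ n _ _ _ _ _ (Nat.le_succ_diag_r n) HZ).
    assert (HH0 := HH); apply dominated1_S_inv in HH; destruct HH as [HH1 HH2].
    assert (Hq1 : 0 <= q + 1) by lra.
    assert (E1 := IH _ _ _ HBq Hq1 HG' HZ' HH2).
    (* The induction ranges over all outer functions, so it applies to [G] itself. This bounds the
       factor G(phi) of phi', although nothing was assumed about the higher derivatives of [phi]. *)
    assert (E2 := IH _ _ _ HD Rle_0_1 HG' HZ' HG').
    assert (SO := sec_open_lift W HW).
    apply dominated1_S; try lra.
    + intros t Ht; apply (dominated1_bound _ _ _ _ _ _ _ HH0); auto.
    + intros t Ht; apply (ex_derive_comp H phi); auto.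
      eexists; apply Hphi; auto.
    + apply dominated_ext with (fun t s => Derive H (phi t) * (Z t * G (phi t))); auto.
      { intros t _ Ht; symmetry.
        rewrite (Derive_comp H phi); auto; [| eexists; apply Hphi; auto].
        rewrite (is_derive_unique phi _ _ (Hphi t Ht)); ring. }
      assert (Hm := dominated_mult n _ _ _ L (1 / 3) (1 / 3) _ _ SO HC HD ltac:(lra) ltac:(lra)
        ltac:(lra) HZ' E2).
      assert (HCD : 0 <= C * D) by lra.
      assert (Hm2 := dominated_mult n _ _ _ L ((q + 1) / 3) (1 / 3 + 1 / 3)
        _ _ SO HBq HCD ltac:(lra) ltac:(lra) ltac:(lra) E1 Hm).
      simpl in Hm2; replace ((q + 1) / 3 + (1 / 3 + 1 / 3)) with (q / 3 + 1) in Hm2 by field.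
      eapply dominated_weaken; [| | | | | | | exact Hm2]; try lra.
      * repeat apply Rmult_le_pos; lra.
      * replace (B * (q * K) * (C * D)) with ((B * q) * (K * (D * C))) by ring.
        replace (B * (q / 3 * L)) with ((B * q) * (L / 3)) by field.
        apply Rmult_le_compat_l; lra.
Qed.

(** * Germs of smooth and of analytic functions *)

Definition ball1 (t0 d t : R) : Prop := Rabs (t - t0) < d.
Definition box (t0 s0 d t s : R) : Prop := ball1 t0 d t /\ ball1 s0 d s.

(* Near a point: real analyticity if [an] holds, infinite differentiability otherwise. *)
Definition regular (an : Prop) (f : R -> R -> R) (t0 s0 : R) : Prop :=
  forall N : nat, exists d A L, 0 < d /\ 0 <= A /\ 0 <= L /\
    forall n, an \/ (n <= N)%nat -> dominated n (box t0 s0 d) A L 1 f.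

Definition regular1 (an : Prop) (g : R -> R) (t0 : R) : Prop :=
  forall N : nat, exists d A L, 0 < d /\ 0 <= A /\ 0 <= L /\
    forall n, an \/ (n <= N)%nat -> dominated1 n (ball1 t0 d) A L 1 g.

Lemma open_ball1 t0 d : open (ball1 t0 d).
Proof.
  intros t Ht; unfold ball1 in *.
  assert (He : 0 < d - Rabs (t - t0)) by lra.
  exists (mkposreal _ He); intros u Hu.
  change (Rabs (u - t) < d - Rabs (t - t0)) in Hu.
  replace (u - t0) with ((u - t) + (t - t0)) by ring.
  eapply Rle_lt_trans; [apply Rabs_triang | lra].
Qed.

Lemma sec_open_box t0 s0 d : sec_open (box t0 s0 d).
Proof.
  intros t s [Ht Hs]; split.
  - generalize (open_ball1 t0 d t Ht); apply filter_imp; split; auto.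
  - generalize (open_ball1 s0 d s Hs); apply filter_imp; split; auto.
Qed.

Lemma ball1_center t0 d : 0 < d -> ball1 t0 d t0.
Proof. intros Hd; unfold ball1; replace (t0 - t0) with 0 by ring; rewrite Rabs_R0; auto. Qed.

Lemma ball1_le t0 d d' t : d <= d' -> ball1 t0 d t -> ball1 t0 d' t.
Proof. unfold ball1; lra. Qed.

Lemma box_le t0 s0 d d' t s : d <= d' -> box t0 s0 d t s -> box t0 s0 d' t s.
Proof. intros H [H1 H2]; split; eapply ball1_le; eauto. Qed.

Lemma box_center t0 s0 d : 0 < d -> box t0 s0 d t0 s0.
Proof. intros; split; apply ball1_center; auto. Qed.

(** Products and compositions change the exponent; this brings it back to 1, the value fixed in the
    definition of germs, since p L <= (p + 1) L. *)
Lemma dominated_unit_exponent n U A L p f :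
  0 <= A -> 0 <= L -> 0 <= p -> dominated n U A L p f -> dominated n U A ((p + 1) * L) 1 f.
Proof.
  intros HA HL Hp; assert (0 <= p * L) by (apply Rmult_le_pos; auto).
  apply dominated_weaken; lra.
Qed.

Lemma regular_intro an f t0 s0 :
  (forall N : nat, exists d A L p, 0 < d /\ 0 <= A /\ 0 <= L /\ 0 <= p /\
    forall n, an \/ (n <= N)%nat -> dominated n (box t0 s0 d) A L p f) -> regular an f t0 s0.
Proof.
  intros H N; destruct (H N) as (d & A & L & p & Hd & HA & HL & Hp & Hn).
  exists d, A, ((p + 1) * L); split; [auto |]; split; [auto |].
  split; [apply Rmult_le_pos; lra |].
  intros n Hn'; apply dominated_unit_exponent; auto.
Qed.

Lemma regular_ext an f g t0 s0 :
  (exists d, 0 < d /\ forall t s, box t0 s0 d t s -> f t s = g t s) ->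
  regular an f t0 s0 -> regular an g t0 s0.
Proof.
  intros (d & Hd & Hfg) H N; destruct (H N) as (d' & A & L & Hd' & HA & HL & Hn).
  exists (Rmin d d'), A, L; split; [apply Rmin_glb_lt; auto |]; split; [auto |]; split; [auto |].
  intros n Hn'; apply dominated_ext with f.
  - apply sec_open_box.
  - intros t s Hts; apply Hfg; eapply box_le; [apply Rmin_l | eauto].
  - eapply dominated_subset; [| apply Hn; auto].
    intros t s; apply box_le, Rmin_r.
Qed.

Lemma regular_const an c t0 s0 : regular an (fun _ _ => c) t0 s0.
Proof.
  intros N; exists 1, (Rabs c), 1; split; [lra |]; split; [apply Rabs_pos |]; split; [lra |].
  intros n _; apply dominated_const; lra.
Qed.

Lemma dominated_common n t0 s0 d d' A L L' f :
  0 <= A -> 0 <= L -> L <= L' -> d <= d' -> dominated n (box t0 s0 d') A L 1 f ->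
  dominated n (box t0 s0 d) A L' 1 f.
Proof.
  intros HA HL HL' Hd H; apply dominated_weaken with A L 1; try lra.
  eapply dominated_subset; [| exact H]; intros t s; apply box_le; auto.
Qed.

Lemma regular_plus an f g t0 s0 :
  regular an f t0 s0 -> regular an g t0 s0 -> regular an (fun t s => f t s + g t s) t0 s0.
Proof.
  intros Hf Hg N; destruct (Hf N) as (d & A & L & Hd & HA & HL & Hn).
  destruct (Hg N) as (d' & A' & L' & Hd' & HA' & HL' & Hn').
  exists (Rmin d d'), (A + A'), (Rmax L L'); split; [apply Rmin_glb_lt; auto |].
  split; [lra |]; split; [eapply Rle_trans; [exact HL | apply Rmax_l] |].
  intros n Hn0; apply dominated_plus; [apply sec_open_box | |];
    eapply dominated_common;
    [exact HA | exact HL | apply Rmax_l | apply Rmin_l | apply Hn; auto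
    | exact HA' | exact HL' | apply Rmax_r | apply Rmin_r | apply Hn'; auto].
Qed.

Lemma regular_mult an f g t0 s0 :
  regular an f t0 s0 -> regular an g t0 s0 -> regular an (fun t s => f t s * g t s) t0 s0.
Proof.
  intros Hf Hg; apply regular_intro; intros N; destruct (Hf N) as (d & A & L & Hd & HA & HL & Hn).
  destruct (Hg N) as (d' & A' & L' & Hd' & HA' & HL' & Hn').
  assert (0 <= Rmax L L') by (eapply Rle_trans; [exact HL | apply Rmax_l]).
  exists (Rmin d d'), (A * A'), (Rmax L L'), (1 + 1); split; [apply Rmin_glb_lt; auto |].
  split; [apply Rmult_le_pos; auto |]; split; [auto |]; split; [lra |].
  intros n Hn0; apply dominated_mult; try lra; [apply sec_open_box | |];
    eapply dominated_common;
    [exact HA | exact HL | apply Rmax_l | apply Rmin_l | apply Hn; auto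
    | exact HA' | exact HL' | apply Rmax_r | apply Rmin_r | apply Hn'; auto].
Qed.

Lemma regular_opp an f t0 s0 : regular an f t0 s0 -> regular an (fun t s => - f t s) t0 s0.
Proof.
  intros H; apply regular_ext with (fun t s => -1 * f t s).
  - exists 1; split; [lra | intros; ring].
  - apply regular_mult; [apply regular_const | auto].
Qed.

Lemma regular_minus an f g t0 s0 :
  regular an f t0 s0 -> regular an g t0 s0 -> regular an (fun t s => f t s - g t s) t0 s0.
Proof. intros; unfold Rminus; apply regular_plus; [| apply regular_opp]; auto. Qed.

Lemma regular_pow an f t0 s0 n : regular an f t0 s0 -> regular an (fun t s => f t s ^ n) t0 s0.
Proof.
  intros H; induction n as [|n IH]; simpl; [apply regular_const | apply regular_mult; auto].
Qed.

Lemma lipschitz_of_derive (g : R -> R) (a b M : R) (V : R -> Prop) :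
  (forall x, Rmin a b <= x <= Rmax a b -> V x) ->
  (forall x, V x -> ex_derive g x /\ Rabs (Derive g x) <= M) ->
  Rabs (g b - g a) <= M * Rabs (b - a).
Proof.
  intros HV H.
  destruct (MVT_gen g a b (Derive g)) as (c & Hc & E).
  - intros x Hx; apply Derive_correct, H, HV; lra.
  - intros x Hx; destruct (H x (HV x Hx)) as [H1 _].
    apply continuity_pt_filterlim, (ex_derive_continuous g x H1).
  - rewrite E, Rabs_mult; apply Rmult_le_compat_r; [apply Rabs_pos |].
    apply H, HV; auto.
Qed.

Lemma ball1_convex t0 d a b x :
  ball1 t0 d a -> ball1 t0 d b -> Rmin a b <= x <= Rmax a b -> ball1 t0 d x.
Proof.
  unfold ball1; intros Ha Hb Hx.
  apply Rabs_def2 in Ha; apply Rabs_def2 in Hb; apply Rabs_def1;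
    unfold Rmin, Rmax in Hx; destruct (Rle_dec a b); lra.
Qed.

Lemma dominated_lipschitz t0 s0 d A L p f t s t' s' :
  dominated 1 (box t0 s0 d) A L p f -> box t0 s0 d t s -> box t0 s0 d t' s' ->
  Rabs (f t' s' - f t s) <= A * (p * L) * (Rabs (t' - t) + Rabs (s' - s)).
Proof.
  intros (_ & H2 & [H3 _] & [H4 _]) [Ht Hs] [Ht' Hs'].
  replace (f t' s' - f t s) with ((f t' s' - f t s') + (f t s' - f t s)) by ring.
  eapply Rle_trans; [apply Rabs_triang |]; rewrite Rmult_plus_distr_l; apply Rplus_le_compat.
  - apply (lipschitz_of_derive (fun u => f u s') t t' _ (ball1 t0 d)).
    + intros x; apply ball1_convex; auto.
    + intros x Hx; split; [apply (H2 x s') | apply (H3 x s')]; split; auto.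
  - apply (lipschitz_of_derive (fun v => f t v) s s' _ (ball1 s0 d)).
    + intros x; apply ball1_convex; auto.
    + intros x Hx; split; [apply (H2 t x) | apply (H4 t x)]; split; auto.
Qed.

Lemma dominated_continuity t0 s0 d A L p f t s :
  0 <= A -> 0 <= L -> 0 <= p ->
  dominated 1 (box t0 s0 d) A L p f -> box t0 s0 d t s -> continuity_2d_pt f t s.
Proof.
  intros HA HL Hp H Hts eps.
  set (M := A * (p * L)); assert (HM : 0 <= M) by (repeat apply Rmult_le_pos; auto).
  destruct (sec_open_box t0 s0 d t s Hts) as [[e1 He1] [e2 He2]].
  assert (He : 0 < eps / (2 * (M + 1))).
  { apply Rdiv_lt_0_compat; [apply cond_pos | lra]. }
  exists (mkposreal _ (Rmin_glb_lt _ _ _ He (Rmin_glb_lt _ _ _ (cond_pos e1) (cond_pos e2)))).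
  simpl; intros u v Hu Hv.
  assert (K1 := Rmin_l (eps / (2 * (M + 1))) (Rmin e1 e2)).
  assert (K2 := Rmin_r (eps / (2 * (M + 1))) (Rmin e1 e2)).
  assert (K3 := Rmin_l e1 e2); assert (K4 := Rmin_r e1 e2).
  assert (Huv : box t0 s0 d u v).
  { split; [apply (He1 u) | apply (He2 v)]; unfold ball; simpl; unfold AbsRing_ball; simpl;
      [change (Rabs (u - t) < e1) | change (Rabs (v - s) < e2)]; lra. }
  eapply Rle_lt_trans; [apply (dominated_lipschitz _ _ _ _ _ _ _ _ _ _ _ H Hts Huv) |].
  fold M; apply Rle_lt_trans with (M * (2 * (eps / (2 * (M + 1))))).
  - apply Rmult_le_compat_l; lra.
  - replace (M * (2 * (eps / (2 * (M + 1))))) with (eps * (M / (M + 1))) by (field; lra).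
    rewrite <- (Rmult_1_r eps) at 2; apply Rmult_lt_compat_l; [apply cond_pos |].
    apply (Rmult_lt_reg_r (M + 1)); [lra |].
    unfold Rdiv; rewrite Rmult_assoc, Rinv_l; lra.
Qed.

Lemma regular_continuity an f t0 s0 : regular an f t0 s0 -> continuity_2d_pt f t0 s0.
Proof.
  intros H; destruct (H 1%nat) as (d & A & L & Hd & HA & HL & Hn).
  apply (dominated_continuity t0 s0 d A L 1); [auto | auto | lra | apply Hn; auto |
    apply box_center; auto].
Qed.

Lemma regular_near an f t0 s0 eps :
  regular an f t0 s0 -> 0 < eps ->
  exists d, 0 < d /\ forall t s, box t0 s0 d t s -> ball1 (f t0 s0) eps (f t s).
Proof.
  intros H Heps; destruct (regular_continuity _ _ _ _ H (mkposreal eps Heps)) as [d Hd].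
  exists d; split; [apply cond_pos |]; intros t s [Ht Hs]; apply (Hd t s Ht Hs).
Qed.

(** The outer functions to be composed with are real powers and power series. Their bounds hold for
    all orders with the same constants, whichever class [an] selects for [f]. *)
Lemma regular_comp an G f t0 s0 :
  (exists e D K q, 0 < e /\ 0 <= D /\ 0 <= K /\ 0 <= q /\
     forall n, dominated1 n (ball1 (f t0 s0) e) D K q G) ->
  regular an f t0 s0 -> regular an (fun t s => G (f t s)) t0 s0.
Proof.
  intros (e & D & K & q & He & HD & HK & Hq & HG) Hf; apply regular_intro; intros N.
  destruct (Hf N) as (d & A & L & Hd & HA & HL & Hn).
  destruct (regular_near _ _ _ _ e Hf He) as (d' & Hd' & Hnear).
  assert (0 <= K * (A * L)) by (repeat apply Rmult_le_pos; auto).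
  exists (Rmin d d'), D, (4 * L + 2 * (K * (A * L))), (q / 2).
  split; [apply Rmin_glb_lt; auto |]; split; [auto |]; split; [lra |]; split; [lra |].
  intros n Hn'; apply dominated_comp with (ball1 (f t0 s0) e) K A L; auto; try lra.
  - apply sec_open_box.
  - intros t s Hts; apply Hnear; eapply box_le; [apply Rmin_r | eauto].
  - eapply dominated_subset; [| apply Hn; auto]; intros t s; apply box_le, Rmin_l.
Qed.

Lemma is_derive_Rpower (c a x : R) :
  0 < x -> is_derive (fun v => c * Rpower v a) x (c * a * Rpower x (a - 1)).
Proof.
  intros Hx; rewrite Rmult_assoc; apply (is_derive_scal (fun v => Rpower v a) x).
  apply is_derive_Reals, derivable_pt_lim_power; auto.
Qed.

(** Writing v = m - u, one has v^(-q) = m^(-q) (1 - u / m)^(-q): the function is a member of the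
    family of majorants, and the absolute values of its derivatives decrease in v. *)
Lemma dominated_Rpower n m c q :
  0 < m -> 0 < q ->
  dominated1 n (fun v => m < v) (Rabs c * Rpower m (- q)) (/ m) q (fun v => c * Rpower v (- q)).
Proof.
  intros Hm; revert c q; induction n as [|n IH]; intros c q Hq;
    assert (HB : forall t, m < t -> Rabs (c * Rpower t (- q)) <= Rabs c * Rpower m (- q)).
  1, 3: intros t Ht; rewrite Rabs_mult; apply Rmult_le_compat_l; [apply Rabs_pos |];
      unfold Rpower; rewrite Rabs_pos_eq by (left; apply exp_pos);
      left; apply exp_increasing; assert (ln m < ln t) by (apply ln_increasing; lra); nra.
  - split; [intros; auto | exact I].
  - assert (0 < / m) by (apply Rinv_0_lt_compat; auto).
    apply dominated1_S; auto; try lra.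
    + apply Rmult_le_pos; [apply Rabs_pos | left; apply exp_pos].
    + intros t Ht; eexists; apply is_derive_Rpower; lra.
    + apply dominated_ext with (fun t _ => (c * - q) * Rpower t (- (q + 1))).
      * apply sec_open_lift, open_gt.
      * intros t _ Ht; symmetry; apply is_derive_unique.
        replace (- (q + 1)) with (- q - 1) by ring; apply is_derive_Rpower; lra.
      * replace (Rabs c * Rpower m (- q) * (q * / m))
          with (Rabs (c * - q) * Rpower m (- (q + 1))).
        { apply IH; lra. }
        rewrite Rabs_mult, Rabs_Ropp, (Rabs_pos_eq q) by lra.
        replace (- (q + 1)) with (- q + - (1)) by ring.
        rewrite Rpower_plus, (Rpower_Ropp m 1), Rpower_1 by auto; ring.
Qed.

Lemma regular_Rpower an f q t0 s0 :
  0 < q -> 0 < f t0 s0 -> regular an f t0 s0 ->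
  regular an (fun t s => Rpower (f t s) (- q)) t0 s0.
Proof.
  intros Hq Hf0 Hf; apply (regular_comp an (fun v => Rpower v (- q))); auto.
  set (m := f t0 s0 / 2); assert (Hm : 0 < m) by (unfold m; lra).
  exists m, (Rabs 1 * Rpower m (- q)), (/ m), q.
  split; [auto |]; split; [apply Rmult_le_pos; [apply Rabs_pos | left; apply exp_pos] |].
  split; [left; apply Rinv_0_lt_compat; auto |]; split; [lra |].
  intros n; apply dominated_ext with (fun t _ => 1 * Rpower t (- q)).
  - apply sec_open_lift, open_ball1.
  - intros; ring.
  - eapply dominated_subset; [| apply (dominated_Rpower n m 1 q Hm Hq)].
    intros t s Ht; apply Rabs_def2 in Ht; unfold m in *; lra.
Qed.

Lemma regular_inv an f t0 s0 :
  0 < f t0 s0 -> regular an f t0 s0 -> regular an (fun t s => / f t s) t0 s0.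
Proof.
  intros Hf0 Hf; apply regular_ext with (fun t s => Rpower (f t s) (- (1))).
  - destruct (regular_near _ _ _ _ _ Hf Hf0) as (d & Hd & Hn); exists d; split; auto.
    intros t s Hts; specialize (Hn t s Hts); apply Rabs_def2 in Hn.
    rewrite Rpower_Ropp, Rpower_1 by lra; auto.
  - apply regular_Rpower; auto; lra.
Qed.

Lemma regular_lift1 an g t0 s0 : regular1 an g t0 -> regular an (fun t _ => g t) t0 s0.
Proof.
  intros H N; destruct (H N) as (d & A & L & Hd & HA & HL & Hn); exists d, A, L.
  split; [auto |]; split; [auto |]; split; [auto |]; intros n Hn'.
  eapply dominated_subset; [| apply Hn; auto]; intros t s [Ht _]; exact Ht.
Qed.

Lemma regular_lift2 an g t0 s0 : regular1 an g s0 -> regular an (fun _ s => g s) t0 s0.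
Proof.
  intros H N; destruct (H N) as (d & A & L & Hd & HA & HL & Hn); exists d, A, L.
  split; [auto |]; split; [auto |]; split; [auto |]; intros n Hn'.
  eapply dominated_subset; [| apply (dominated_swap _ _ _ _ _ _ (Hn n Hn'))]; intros t s [_ Hs];
    exact Hs.
Qed.

Lemma regular1_of_regular an g t0 s0 : regular an (fun t _ => g t) t0 s0 -> regular1 an g t0.
Proof.
  intros H N; destruct (H N) as (d & A & L & Hd & HA & HL & Hn); exists d, A, L.
  split; [auto |]; split; [auto |]; split; [auto |]; intros n Hn'.
  apply (dominated1_of_dominated n (box t0 s0 d)); auto; [lra |].
  intros t Ht; exists s0; split; [exact Ht | apply ball1_center; auto].
Qed.

Lemma regular1_ex_derive an g t0 :
  regular1 an g t0 -> exists d, 0 < d /\ forall t, ball1 t0 d t -> ex_derive g t.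
Proof.
  intros H; destruct (H 1%nat) as (d & A & L & Hd & HA & HL & Hn); exists d; split; auto.
  apply (dominated1_S_inv 0 (ball1 t0 d) A L 1); apply Hn; auto.
Qed.

Lemma regular1_derive an g t0 : regular1 an g t0 -> regular1 an (Derive g) t0.
Proof.
  intros H; apply regular1_of_regular with 0, regular_intro; intros N.
  destruct (H (S N)) as (d & A & L & Hd & HA & HL & Hn); exists d, (A * (1 * L)), L, (1 + 1).
  split; [auto |]; split; [repeat apply Rmult_le_pos; lra |]; split; [auto |]; split; [lra |].
  intros n Hn'; eapply dominated_subset; [| apply (dominated1_S_inv n (ball1 t0 d) A L 1 g);
    apply Hn];
    [intros t s [Ht _]; exact Ht | destruct Hn'; [left | right; lia]; auto].
Qed.

Lemma regular1_continuous an g t0 : regular1 an g t0 -> continuity_pt g t0.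
Proof.
  intros H; destruct (regular1_ex_derive _ _ _ H) as (d & Hd & Hn).
  apply continuity_pt_filterlim, (ex_derive_continuous g t0), Hn, ball1_center; auto.
Qed.

Lemma regular1_id an t0 : regular1 an (fun t => t) t0.
Proof.
  intros N; exists 1, (Rabs t0 + 1), 1; assert (Ha := Rabs_pos t0).
  split; [lra |]; split; [lra |]; split; [lra |]; intros n _.
  assert (HB : forall t, ball1 t0 1 t -> Rabs t <= Rabs t0 + 1).
  { intros t Ht; unfold ball1 in Ht; replace t with ((t - t0) + t0) by ring.
    eapply Rle_trans; [apply Rabs_triang | lra]. }
  destruct n as [|n]; [split; [intros t s; apply HB | exact I] |].
  apply dominated1_S; auto; try lra; [intros; apply ex_derive_id |].
  apply dominated_ext with (fun _ _ => 1); [apply sec_open_lift, open_ball1 | |].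
  - intros t s _; symmetry; apply Derive_id.
  - apply dominated_weaken with (Rabs 1) 1 (1 + 1); try lra; [apply Rabs_pos | rewrite Rabs_R1;
    lra |].
    apply dominated_const; lra.
Qed.

Lemma smooth1_derive g a b : smooth1 g a b -> smooth1 (Derive g) a b.
Proof.
  intros H k t Ht; destruct k as [|k]; [exact I |].
  apply (ex_derive_ext (Derive_n g (S k))); [| exact (H (S (S k)) t Ht)].
  intros u; change (Derive_n g (S k) u = Derive_n (Derive_n g 1) k u).
  rewrite Derive_n_comp; f_equal; lia.
Qed.

(** Finitely many derivatives are locally bounded, and A absorbs all these bounds at the rate 1.
    Since A and the radius depend on n, a smooth germ only gets constants that depend on the
    order. *)
Lemma dominated1_smooth n a b t0 g :
  smooth1 g a b -> a < t0 < b ->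
  exists e A, 0 < e /\ 0 <= A /\ dominated1 n (ball1 t0 e) A 1 1 g.
Proof.
  intros Hg Ht0; revert g Hg.
  assert (Hin : exists e, 0 < e /\ forall t, ball1 t0 e t -> a < t < b).
  { exists (Rmin (t0 - a) (b - t0)); split; [apply Rmin_glb_lt; lra |]; intros t Ht.
    assert (K1 := Rmin_l (t0 - a) (b - t0)); assert (K2 := Rmin_r (t0 - a) (b - t0)).
    apply Rabs_def2 in Ht; lra. }
  destruct Hin as (e0 & He0 & Hin).
  assert (Hbnd : forall g, smooth1 g a b -> exists e, 0 < e /\
    forall t, ball1 t0 e t -> Rabs (g t) <= Rabs (g t0) + 1).
  { intros g Hg.
    assert (Hc : continuity_pt g t0)
      by (apply continuity_pt_filterlim, (ex_derive_continuous g t0), (Hg 1%nat t0 Ht0)).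
    destruct (proj1 (continuity_pt_locally g t0) Hc (mkposreal 1 Rlt_0_1)) as [e He].
    exists e; split; [apply cond_pos |]; intros t Ht; specialize (He t Ht); simpl in He.
    replace (g t) with ((g t - g t0) + g t0) by ring.
    eapply Rle_trans; [apply Rabs_triang | lra]. }
  induction n as [|n IH]; intros g Hg; destruct (Hbnd g Hg) as (e & He & HB);
    assert (Ha := Rabs_pos (g t0)).
  - exists e, (Rabs (g t0) + 1); split; [auto |]; split; [lra |].
    split; [intros t s; apply HB | exact I].
  - destruct (IH _ (smooth1_derive g a b Hg)) as (e' & A' & He' & HA' & HD).
    exists (Rmin e0 (Rmin e e')), (Rabs (g t0) + 1 + A').
    assert (K1 := Rmin_l e0 (Rmin e e')); assert (K2 := Rmin_r e0 (Rmin e e')).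
    assert (K3 := Rmin_l e e'); assert (K4 := Rmin_r e e').
    split; [repeat apply Rmin_glb_lt; auto |]; split; [lra |].
    apply dominated1_S; try lra.
    + intros t Ht; apply Rle_trans with (Rabs (g t0) + 1); [| lra].
      apply HB; eapply ball1_le; [| exact Ht]; lra.
    + intros t Ht; apply (Hg 1%nat), Hin; eapply ball1_le; [| exact Ht]; lra.
    + apply dominated_weaken with A' 1 1; try lra.
      eapply dominated_subset; [| exact HD]; intros t s Ht; eapply ball1_le; [| exact Ht]; lra.
Qed.

Lemma regular1_smooth a b t0 g : smooth1 g a b -> a < t0 < b -> regular1 False g t0.
Proof.
  intros Hg Ht0 N; destruct (dominated1_smooth N a b t0 g Hg Ht0) as (e & A & He & HA & HD).
  exists e, A, 1; split; [auto |]; split; [auto |]; split; [lra |].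
  intros n [[] | Hn]; eapply dominated_le; eauto.
Qed.

(** * Power series as majorized functions *)

Fixpoint poch (q : R) (k : nat) : R :=
  match k with O => 1 | S k => q * poch (q + 1) k end.

Lemma poch_S_r q k : poch q (S k) = poch q k * (q + INR k).
Proof.
  revert q; induction k as [|k IH]; intros q; [simpl; ring |].
  change (poch q (S (S k))) with (q * poch (q + 1) (S k)); rewrite IH.
  change (poch q (S k)) with (q * poch (q + 1) k); rewrite S_INR; ring.
Qed.

Lemma poch_1 k : poch 1 k = INR (fact k).
Proof.
  induction k as [|k IH]; [reflexivity |].
  rewrite poch_S_r, IH, fact_simpl, mult_INR, S_INR; ring.
Qed.

Lemma poch_nonneg q k : 0 <= q -> 0 <= poch q k.
Proof.
  revert q; induction k as [|k IH]; intros q Hq; simpl; [lra |].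
  apply Rmult_le_pos; auto; apply IH; lra.
Qed.

(** The k-th term of the binomial series of (1 - y)^(-q), where [poch q k] is the rising factorial q
    (q + 1) ... (q + k - 1). *)
Definition binomial_term (y q : R) (k : nat) : R := poch q k / INR (fact k) * y ^ k.

Lemma binomial_term_nonneg y q k : 0 <= y -> 0 <= q -> 0 <= binomial_term y q k.
Proof.
  intros Hy Hq; apply Rmult_le_pos; [| apply pow_le; auto].
  apply Rmult_le_pos; [apply poch_nonneg; auto | left; apply Rinv_0_lt_compat, INR_fact_lt_0].
Qed.

(* Pascal's rule for the series of (1 - y)^-q gives the bound (1 - y)^-m <= 2^m. *)
Lemma sum_binomial_term y m N :
  0 <= y <= / 2 -> sum_f_R0 (binomial_term y (INR m)) N <= 2 ^ m.
Proof.
  intros Hy; revert N; induction m as [|m IH]; intros N.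
  - assert (E : sum_f_R0 (binomial_term y (INR 0)) N = 1).
    { induction N as [|N IHN]; [unfold binomial_term; simpl; field |].
      rewrite tech5, IHN; unfold binomial_term; simpl poch; unfold Rdiv; ring. }
    rewrite E; simpl; lra.
  - assert (P : forall k, binomial_term y (INR (S m)) (S k) =
                binomial_term y (INR m) (S k) + y * binomial_term y (INR (S m)) k).
    { intros k; unfold binomial_term; rewrite S_INR, (poch_S_r (INR m + 1)).
      change (poch (INR m) (S k)) with (INR m * poch (INR m + 1) k).
      assert (H := INR_fact_lt_0 k); rewrite fact_simpl, mult_INR, S_INR; simpl pow.
      assert (H' := pos_INR k); field; split; lra. }
    assert (S' : forall N, sum_f_R0 (binomial_term y (INR (S m))) (S N) =
      sum_f_R0 (binomial_term y (INR m)) (S N) + y * sum_f_R0 (binomial_term y (INR (S m))) N).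
    { clear N; induction N as [|N IHN].
      - simpl sum_f_R0; rewrite P; unfold binomial_term; simpl; field.
      - rewrite (tech5 _ (S N)), (tech5 (binomial_term y (INR m)) (S N)), P.
        rewrite (tech5 (binomial_term y (INR (S m))) N) at 2; rewrite IHN; ring. }
    assert (H2 : 1 <= 2 ^ m) by (apply pow_R1_Rle; lra).
    change (2 ^ S m) with (2 * 2 ^ m); induction N as [|N IHN].
    + unfold binomial_term; simpl; lra.
    + rewrite S'; specialize (IH (S N)).
      assert (y * sum_f_R0 (binomial_term y (INR (S m))) N <= / 2 * (2 * 2 ^ m)).
      { apply Rmult_le_compat; try lra; apply cond_pos_sum; intros k.
        apply binomial_term_nonneg; [lra | apply pos_INR]. }
      lra.
Qed.

Lemma binomial_term_le y m k : 0 <= y <= / 2 -> binomial_term y (INR m) k <= 2 ^ m.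
Proof.
  intros Hy; eapply Rle_trans; [| apply (sum_binomial_term y m k Hy)].
  assert (H : forall j, 0 <= binomial_term y (INR m) j)
    by (intros; apply binomial_term_nonneg; [lra | apply pos_INR]).
  destruct k as [|k]; [simpl; lra |].
  rewrite tech5; assert (0 <= sum_f_R0 (binomial_term y (INR m)) k) by (apply cond_pos_sum; auto).
  lra.
Qed.

Lemma CV_radius_gt c x r M :
  Rabs x < r -> (forall k, Rabs (c k * r ^ k) <= M) -> Rbar_lt (Rabs x) (CV_radius c).
Proof.
  intros Hr HM; apply Rbar_lt_le_trans with (Finite r); [exact Hr |].
  apply (proj1 (CV_radius_bounded c)); exists M; auto.
Qed.

Lemma PSeries_binomial_bound B K m c x :
  0 <= B -> 0 < K ->
  (forall k, Rabs (c k) <= B * K ^ k * (poch (INR m) k / INR (fact k))) ->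
  K * Rabs x < / 2 ->
  Rbar_lt (Rabs x) (CV_radius c) /\ Rabs (PSeries c x) <= B * 2 ^ m.
Proof.
  intros HB HK Hc Hx.
  assert (Ht : forall k z, Rabs (c k * z ^ k) <= B * binomial_term (K * Rabs z) (INR m) k).
  { intros k z; unfold binomial_term; rewrite Rabs_mult, <- RPow_abs, Rpow_mult_distr.
    replace (B * (poch (INR m) k / INR (fact k) * (K ^ k * Rabs z ^ k)))
      with (B * K ^ k * (poch (INR m) k / INR (fact k)) * Rabs z ^ k) by ring.
    apply Rmult_le_compat_r; [apply pow_le, Rabs_pos | apply Hc]. }
  assert (HR : Rbar_lt (Rabs x) (CV_radius c)).
  { apply CV_radius_gt with (/ 2 / K) (B * 2 ^ m).
    - apply (Rmult_lt_reg_l K); auto; replace (K * (/ 2 / K)) with (/ 2) by (field; lra); auto.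
    - intros k; eapply Rle_trans; [apply Ht |]; apply Rmult_le_compat_l; auto.
      apply binomial_term_le.
      rewrite Rabs_pos_eq by (left; apply Rdiv_lt_0_compat; lra).
      replace (K * (/ 2 / K)) with (/ 2) by (field; lra); lra. }
  split; [exact HR |]; assert (HD := CV_disk_inside _ _ HR).
  eapply Rle_trans; [apply Series_Rabs, HD |].
  change (Rbar_le (Series (fun k => Rabs (c k * x ^ k))) (B * 2 ^ m)).
  apply is_lim_seq_le with (sum_n (fun k => Rabs (c k * x ^ k))) (fun _ => B * 2 ^ m);
    [| exact (Series_correct _ HD) | apply is_lim_seq_const].
  intros N; rewrite sum_n_Reals.
  apply Rle_trans with (B * sum_f_R0 (binomial_term (K * Rabs x) (INR m)) N).
  - rewrite scal_sum; apply sum_Rle; intros k _; rewrite Rmult_comm.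
    rewrite (Rmult_comm _ B); rewrite Rmult_comm; apply Ht.
  - apply Rmult_le_compat_l; auto; apply sum_binomial_term; split; [| lra].
    apply Rmult_le_pos; [lra | apply Rabs_pos].
Qed.

(** The hypothesis compares the coefficients with those of B (1 - K x)^(-m). Differentiation turns
    this majorant into B m K (1 - K x)^(-(m + 1)), so the hypothesis reproduces itself with m + 1.
    On K |x| < 1/2 the new factor (1 - K |x|)^(-1) is at most 2, whence the rate 2 K. *)
Lemma dominated1_pseries n B K m c :
  0 <= B -> 0 < K ->
  (forall k, Rabs (c k) <= B * K ^ k * (poch (INR m) k / INR (fact k))) ->
  dominated1 n (fun x => K * Rabs x < / 2) (B * 2 ^ m) (2 * K) (INR m) (PSeries c).
Proof.
  intros HB HK; revert B m c HB; induction n as [|n IH]; intros B m c HB Hc;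
    assert (Hb := fun x => PSeries_binomial_bound B K m c x HB HK Hc).
  - split; [intros x s; apply Hb | exact I].
  - assert (Hp := pos_INR m); assert (H2 : 0 <= 2 ^ m) by (apply pow_le; lra).
    apply dominated1_S; auto; try lra.
    + apply Rmult_le_pos; auto.
    + intros x Hxx; apply (Hb x Hxx).
    + intros x Hxx; eexists; apply is_derive_PSeries, (Hb x Hxx).
    + apply dominated_ext with (fun x _ => PSeries (PS_derive c) x).
      * apply sec_open_lift; intros x Hxx.
        assert (He : 0 < / 2 / K - Rabs x).
        { assert (Rabs x < / 2 / K); [| lra].
          apply (Rmult_lt_reg_l K); auto; replace (K * (/ 2 / K)) with (/ 2) by (field; lra);
            auto. }
        exists (mkposreal _ He); intros u Hu.
        change (Rabs (u - x) < / 2 / K - Rabs x) in Hu.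
        apply Rlt_le_trans with (K * (/ 2 / K)); [| right; field; lra].
        apply Rmult_lt_compat_l; auto; replace u with ((u - x) + x) by ring.
        eapply Rle_lt_trans; [apply Rabs_triang | lra].
      * intros x s Hxx; symmetry; apply is_derive_unique, is_derive_PSeries, (Hb x Hxx).
      * replace (B * 2 ^ m * (INR m * (2 * K)))
          with (B * (INR m * K) * 2 ^ S m) by (simpl; ring).
        rewrite <- S_INR; apply IH; [apply Rmult_le_pos; auto; apply Rmult_le_pos; lra |].
        intros k; unfold PS_derive; rewrite Rabs_mult, Rabs_pos_eq by apply pos_INR.
        eapply Rle_trans; [apply Rmult_le_compat_l; [apply pos_INR | apply Hc] |].
        right; change (poch (INR m) (S k)) with (INR m * poch (INR m + 1) k).
        rewrite (S_INR m), fact_simpl, mult_INR; simpl pow.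
        assert (H := INR_fact_lt_0 k); assert (0 < INR (S k)) by (apply lt_0_INR; lia).
        field; split; lra.
Qed.

Lemma regular_PSeries an c K f t0 s0 :
  0 < K -> K * Rabs (f t0 s0) < / 2 -> (exists B, forall k, Rabs (c k) <= B * K ^ k) ->
  regular an f t0 s0 -> regular an (fun t s => PSeries c (f t s)) t0 s0.
Proof.
  intros HK H0 [B HB]; apply regular_comp.
  assert (HB0 : 0 <= B).
  { specialize (HB 0%nat); simpl in HB; rewrite Rmult_1_r in HB.
    eapply Rle_trans; [apply Rabs_pos | exact HB]. }
  assert (He : 0 < / 2 / K - Rabs (f t0 s0)).
  { assert (Rabs (f t0 s0) < / 2 / K); [| lra].
    apply (Rmult_lt_reg_l K); auto; replace (K * (/ 2 / K)) with (/ 2) by (field; lra); auto. }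
  exists (/ 2 / K - Rabs (f t0 s0)), (B * 2 ^ 1), (2 * K), (INR 1).
  split; [auto |]; split; [apply Rmult_le_pos; [auto | simpl; lra] |].
  split; [lra |]; split; [simpl; lra |]; intros n.
  eapply dominated_subset; [| apply (dominated1_pseries n B K 1 c HB0 HK)].
  - intros u z Hu; unfold ball1 in Hu.
    apply Rlt_le_trans with (K * (/ 2 / K)); [| right; field; lra].
    apply Rmult_lt_compat_l; auto; replace u with ((u - f t0 s0) + f t0 s0) by ring.
    eapply Rle_lt_trans; [apply Rabs_triang | lra].
  - intros k; change (INR 1) with 1; rewrite poch_1; unfold Rdiv.
    rewrite Rinv_r, Rmult_1_r by apply INR_fact_neq_0; apply HB.
Qed.

Lemma regular1_analytic a b t0 g : analytic1 g a b -> a < t0 < b -> regular1 True g t0.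
Proof.
  intros Hg Ht0; destruct (Hg t0 Ht0) as (c & rad & Hrad & Hc).
  apply regular1_of_regular with 0, regular_ext with (fun t _ => PSeries c (t - t0)).
  - exists rad; split; auto; intros t s [Ht _]; apply is_pseries_unique, Hc, Ht.
  - assert (HK : 0 < 2 / rad) by (apply Rdiv_lt_0_compat; lra).
    apply regular_PSeries with (2 / rad); auto.
    + replace (t0 - t0) with 0 by ring; rewrite Rabs_R0; lra.
    (* The terms of the convergent series at distance rad / 2 tend to 0, hence are bounded by some
       M; this gives |c k| <= M (2 / rad)^k. *)
    + assert (Hr : Rabs (t0 + rad / 2 - t0) < rad).
      { replace (t0 + rad / 2 - t0) with (rad / 2) by ring; rewrite Rabs_pos_eq; lra. }
      specialize (Hc _ Hr); replace (t0 + rad / 2 - t0) with (rad / 2) in Hc by ring.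
      assert (Hs : ex_series (fun k => scal (pow_n (rad / 2) k) (c k))) by (eexists; exact Hc).
      assert (Hl := ex_series_lim_0 _ Hs).
      destruct (filterlim_bounded (fun k => scal (pow_n (rad / 2) k) (c k))) as [M HM].
      { exists 0; exact Hl. }
      exists M; intros k; specialize (HM k).
      change (Rabs (pow_n (rad / 2) k * c k) <= M) in HM; rewrite pow_n_pow in HM.
      assert (Hp : 0 < (2 / rad) ^ k) by (apply pow_lt; auto).
      replace (c k) with ((rad / 2) ^ k * c k * (2 / rad) ^ k).
      * rewrite Rabs_mult, (Rabs_pos_eq ((2 / rad) ^ k)) by lra.
        apply Rmult_le_compat_r; [lra | auto].
      * rewrite Rmult_assoc, (Rmult_comm (c k)), <- Rmult_assoc, <- Rpow_mult_distr.
        replace (rad / 2 * (2 / rad)) with 1 by (field; lra); rewrite pow1; ring.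
    + apply regular_minus; [apply regular_lift1, regular1_id | apply regular_const].
Qed.

(** [phi] is only known to be differentiable. Continuity keeps its values where [G] is bounded, the
    majorant equation bounds G(phi), and the product with [Z] bounds all the derivatives of phi'. *)
Lemma regular1_ode an Z G phi t0 :
  (exists d, 0 < d /\ forall t, ball1 t0 d t -> is_derive phi t (Z t * G (phi t))) ->
  regular1 an Z t0 -> regular1 an G (phi t0) -> regular1 an phi t0.
Proof.
  intros (d & Hd & Hphi) HZ HG; apply regular1_of_regular with 0, regular_intro; intros N.
  destruct (HZ N) as (dZ & C & LZ & Hd1 & HC & HLZ & HZn).
  destruct (HG N) as (e & D & K & He & HD & HK & HGn).
  assert (Hc : continuity_pt phi t0).
  { apply continuity_pt_filterlim, (ex_derive_continuous phi t0).
    eexists; apply Hphi, ball1_center; auto. }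
  destruct (proj1 (continuity_pt_locally phi t0) Hc (mkposreal e He)) as [e' He']; simpl in He'.
  set (W := ball1 t0 (Rmin d (Rmin dZ e'))).
  assert (K1 := Rmin_l d (Rmin dZ e')); assert (K2 := Rmin_r d (Rmin dZ e')).
  assert (K3 := Rmin_l dZ e'); assert (K4 := Rmin_r dZ e').
  assert (HW1 : forall t, W t -> ball1 t0 d t) by (intros t Ht; eapply ball1_le; [| exact Ht]; lra).
  assert (HW2 : forall t, W t -> ball1 t0 dZ t) by (intros t Ht; eapply ball1_le; [| exact Ht];
    lra).
  assert (HW3 : forall t, W t -> ball1 (phi t0) e (phi t)).
  { intros t Ht; apply He'; eapply ball1_le; [| exact Ht]; lra. }
  assert (HKDC : 0 <= K * (D * C)) by (repeat apply Rmult_le_pos; auto).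
  assert (HCD : 0 <= C * D) by (apply Rmult_le_pos; auto).
  assert (Hphi0 := Rabs_pos (phi t0)).
  (* The part 3 LZ turns the exponent 1 of [Z] into 1/3, and 3 K D C is the rate of the majorant
     equation. With L >= 1 and A >= C D, the bound C D of phi' is at most A L. *)
  set (L := 3 * LZ + 3 * (K * (D * C)) + 1).
  set (A := Rabs (phi t0) + e + C * D).
  exists (Rmin d (Rmin dZ e')), A, L, 1.
  split; [repeat apply Rmin_glb_lt; auto; apply cond_pos |].
  split; [unfold A; lra |]; split; [unfold L; lra |]; split; [lra |].
  intros n Hn; apply dominated_subset with (fun t _ => W t); [intros t s [Ht _]; exact Ht |].
  (* What is estimated is phi', so order n of the data yields order n + 1 of [phi]. *)
  apply dominated_le with (S n); [lia |]; apply dominated1_S; try (unfold A, L; lra).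
  - intros t Ht; apply HW3 in Ht; unfold ball1 in Ht.
    replace (phi t) with ((phi t - phi t0) + phi t0) by ring.
    eapply Rle_trans; [apply Rabs_triang | unfold A; lra].
  - intros t Ht; eexists; apply Hphi; auto.
  - assert (SO : sec_open (fun t _ => W t)) by (apply sec_open_lift, open_ball1).
    apply dominated_ext with (fun t _ => Z t * G (phi t)); auto.
    { intros t s Ht; symmetry; apply is_derive_unique, Hphi; auto. }
    assert (HZ' : dominated1 n W C L (1 / 3) Z).
    { apply dominated_weaken with C LZ 1; try (unfold L; lra).
      eapply dominated_subset; [| apply HZn; exact Hn]; intros t s Ht; apply HW2, Ht. }
    assert (HGp : dominated1 n W D L (1 / 3) (fun t => G (phi t))).
    { apply dominated_ode_comp with (ball1 (phi t0) e) D K C G Z; auto; try (unfold L; lra).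
      apply open_ball1. }
    apply dominated_weaken with (C * D) L (1 / 3 + 1 / 3); try (unfold L; lra).
    + rewrite Rmult_1_l; apply Rle_trans with (A * 1); [unfold A; lra |].
      apply Rmult_le_compat_l; unfold A, L; lra.
    + apply (dominated_mult n _ _ _ L (1 / 3) (1 / 3) (fun t _ => Z t) (fun t _ => G (phi t)));
        auto; unfold L; lra.
Qed.

(** * Divided differences *)

Lemma continuity_2d_pt_section (f : R -> R -> R) (x y : R) :
  continuity_2d_pt f x y -> continuous (fun v => f x v) y.
Proof.
  intros H; apply continuity_pt_filterlim, continuity_pt_locally; intros eps.
  destruct (H eps) as [d Hd]; exists d; intros v Hv; apply Hd; [| exact Hv].
  replace (x - x) with 0 by ring; rewrite Rabs_R0; apply cond_pos.
Qed.

Lemma continuity_2d_pt_of_1d (g : R -> R) (x y : R) :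
  continuity_pt g y -> continuity_2d_pt (fun _ v => g v) x y.
Proof.
  intros H; apply (continuity_1d_2d_pt_comp g (fun _ v => v)); [exact H |].
  apply continuity_2d_pt_id2.
Qed.

(** The point s + t (v - s) of a chord is affine in v and in s separately. The form al t + be t * u
    covers differentiation under the integral in either endpoint. *)
Lemma is_derive_RInt_affine (V : R -> Prop) (H w al be : R -> R) (x : R) :
  open V -> (forall t, V t -> ex_derive H t /\ continuity_pt (Derive H) t) ->
  (forall t, continuity_pt w t) -> (forall t, continuity_pt al t) ->
  (forall t, continuity_pt be t) ->
  locally x (fun u => forall t, 0 <= t <= 1 -> V (al t + be t * u)) ->
  is_derive (fun u => RInt (fun t => w t * H (al t + be t * u)) 0 1) x
    (RInt (fun t => w t * be t * Derive H (al t + be t * x)) 0 1).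
Proof.
  intros HV HH Hw Hal Hbe Hloc.
  assert (Hm : Rmin 0 1 = 0) by (apply Rmin_left; lra).
  assert (HM : Rmax 0 1 = 1) by (apply Rmax_right; lra).
  assert (Haff : forall u t, continuity_2d_pt (fun u t => al t + be t * u) u t).
  { intros u t; apply continuity_2d_pt_plus; [apply continuity_2d_pt_of_1d, Hal |].
    apply continuity_2d_pt_mult; [apply continuity_2d_pt_of_1d, Hbe | apply continuity_2d_pt_id1]. }
  assert (Hd : forall u t, V (al t + be t * u) ->
     is_derive (fun z => w t * H (al t + be t * z)) u (w t * be t * Derive H (al t + be t * u))).
  { intros u t Hut; rewrite Rmult_assoc; apply (is_derive_scal (fun z => H (al t + be t * z))).
    apply (is_derive_comp H (fun z => al t + be t * z)).
    - apply Derive_correct, HH, Hut.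
    - auto_derive; [exact I | ring]. }
  assert (E : is_derive (fun u => RInt (fun t => w t * H (al t + be t * u)) 0 1) x
    (RInt (fun t => Derive (fun z => w t * H (al t + be t * z)) x) 0 1)).
  { apply (is_derive_RInt_param (fun u t => w t * H (al t + be t * u))).
    - generalize Hloc; apply filter_imp; intros u Hu t Ht; eexists; apply Hd, Hu; lra.
    - intros t Ht; apply continuity_2d_pt_ext_loc with
        (fun u v => w v * be v * Derive H (al v + be v * u)).
      + assert (Hxt : V (al t + be t * x)) by (apply (locally_singleton _ _ Hloc); lra).
        destruct (HV _ Hxt) as [e He]; destruct (Haff x t e) as [d Hd'].
        exists d; intros u v Hu Hv; symmetry; apply is_derive_unique, Hd, He, (Hd' u v Hu Hv).
      + apply continuity_2d_pt_mult; [apply continuity_2d_pt_mult |].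
        * apply continuity_2d_pt_of_1d, Hw.
        * apply continuity_2d_pt_of_1d, Hbe.
        * apply (continuity_1d_2d_pt_comp (Derive H)); [| apply Haff].
          apply HH, (locally_singleton _ _ Hloc); lra.
    - generalize Hloc; apply filter_imp; intros u Hu; apply @ex_RInt_continuous.
      intros t Ht; apply (continuity_2d_pt_section (fun u t => w t * H (al t + be t * u))).
      apply continuity_2d_pt_mult; [apply continuity_2d_pt_of_1d, Hw |].
      apply (continuity_1d_2d_pt_comp H); [| apply Haff].
      apply continuity_pt_filterlim, (ex_derive_continuous H), HH, Hu; lra. }
  replace (RInt (fun t => w t * be t * Derive H (al t + be t * x)) 0 1)
    with (RInt (fun t => Derive (fun z => w t * H (al t + be t * z)) x) 0 1); [exact E |].
  apply RInt_ext; intros t Ht; apply is_derive_unique, Hd, (locally_singleton _ _ Hloc); lra.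
Qed.

(* The integrals [chord_integral a b H] form a family stable under both partial
   derivatives that contains the divided difference of any primitive of [H]. *)
Definition chord_integral (a b : nat) (H : R -> R) (v s : R) : R :=
  RInt (fun t => t ^ a * (1 - t) ^ b * H (s + t * (v - s))) 0 1.

Lemma ball1_segment s0 e v s t :
  ball1 s0 e v -> ball1 s0 e s -> 0 <= t <= 1 -> ball1 s0 e (s + t * (v - s)).
Proof.
  intros Hv Hs Ht; unfold ball1 in *.
  replace (s + t * (v - s) - s0) with ((1 - t) * (s - s0) + t * (v - s0)) by ring.
  eapply Rle_lt_trans; [apply Rabs_triang |].
  rewrite !Rabs_mult, (Rabs_pos_eq (1 - t)), (Rabs_pos_eq t) by lra.
  destruct (Req_dec t 0) as [-> | Hne]; [rewrite Rmult_0_l; lra |].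
  assert (t * Rabs (v - s0) < t * e) by (apply Rmult_lt_compat_l; lra).
  assert ((1 - t) * Rabs (s - s0) <= (1 - t) * e) by (apply Rmult_le_compat_l; lra).
  lra.
Qed.

Lemma continuity_pt_weight a b t : continuity_pt (fun t => t ^ a * (1 - t) ^ b) t.
Proof.
  apply continuity_pt_filterlim, (ex_derive_continuous (fun t => t ^ a * (1 - t) ^ b)).
  auto_derive; auto.
Qed.

Lemma continuity_pt_linear p q t : continuity_pt (fun t => p + q * t) t.
Proof.
  apply continuity_pt_filterlim, (ex_derive_continuous (fun t => p + q * t)).
  auto_derive; auto.
Qed.

Section ChordIntegral.
Variables (s0 e : R) (H : R -> R).

(** The weights t^a (1 - t)^b lie in [0, 1], and so raising a or b, as differentiation does, leaves
    the constant unchanged. *)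
Lemma chord_integral_bound a b B v s :
  (forall t, ball1 s0 e t -> continuity_pt H t /\ Rabs (H t) <= B) ->
  ball1 s0 e v -> ball1 s0 e s -> Rabs (chord_integral a b H v s) <= B.
Proof.
  intros HH Hv Hs; replace B with ((1 - 0) * B) by ring; apply abs_RInt_le_const; [lra | |].
  - apply @ex_RInt_continuous; intros t; rewrite Rmin_left, Rmax_right by lra; intros Ht.
    apply (continuity_2d_pt_section (fun _ t => t ^ a * (1 - t) ^ b * H (s + t * (v - s))) 0).
    apply continuity_2d_pt_of_1d, continuity_pt_mult; [apply continuity_pt_weight |].
    apply (continuity_pt_comp (fun t => s + t * (v - s)) H).
    + apply continuity_pt_ext with (fun t => s + (v - s) * t); [intros; ring |].
      apply continuity_pt_linear.
    + apply HH, ball1_segment; auto.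
  - intros t Ht; assert (HB := proj2 (HH _ (ball1_segment s0 e v s t Hv Hs Ht))).
    rewrite Rabs_mult; rewrite <- (Rmult_1_l B); apply Rmult_le_compat; try apply Rabs_pos; auto.
    assert (Hp : forall x n, 0 <= x <= 1 -> 0 <= x ^ n <= 1).
    { intros x n Hx; split; [apply pow_le; lra |].
      rewrite <- (pow1 n); apply pow_incr; auto. }
    assert (Ht' : 0 <= 1 - t <= 1) by lra.
    assert (H1 := Hp t a Ht); assert (H2 := Hp (1 - t) b Ht').
    destruct H1, H2; rewrite Rabs_pos_eq by (apply Rmult_le_pos; assumption).
    apply Rle_trans with (1 * 1); [apply Rmult_le_compat; assumption | lra].
Qed.

Hypothesis HH : forall t, ball1 s0 e t -> ex_derive H t /\ continuity_pt (Derive H) t.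

Lemma is_derive_chord_integral_1 a b v s :
  ball1 s0 e v -> ball1 s0 e s ->
  is_derive (fun v => chord_integral a b H v s) v (chord_integral (S a) b (Derive H) v s).
Proof.
  intros Hv Hs.
  assert (E := is_derive_RInt_affine (ball1 s0 e) H (fun t => t ^ a * (1 - t) ^ b)
    (fun t => s + (- s) * t) (fun t => 0 + 1 * t) v (open_ball1 s0 e) HH
    (continuity_pt_weight a b) (continuity_pt_linear s (- s)) (continuity_pt_linear 0 1)).
  replace (chord_integral (S a) b (Derive H) v s) with
    (RInt (fun t => t ^ a * (1 - t) ^ b * (0 + 1 * t) *
       Derive H (s + - s * t + (0 + 1 * t) * v)) 0 1).
  - apply is_derive_ext with (fun u => RInt (fun t => t ^ a * (1 - t) ^ b *
      H (s + - s * t + (0 + 1 * t) * u)) 0 1).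
    + intros u; apply RInt_ext; intros t _; f_equal; f_equal; ring.
    + apply E; generalize (open_ball1 s0 e v Hv); apply filter_imp; intros u Hu t Ht.
      replace (s + - s * t + (0 + 1 * t) * u) with (s + t * (u - s)) by ring.
      apply ball1_segment; auto.
  - apply RInt_ext; intros t _.
    replace (s + - s * t + (0 + 1 * t) * v) with (s + t * (v - s)) by ring; simpl; ring.
Qed.

Lemma is_derive_chord_integral_2 a b v s :
  ball1 s0 e v -> ball1 s0 e s ->
  is_derive (fun s => chord_integral a b H v s) s (chord_integral a (S b) (Derive H) v s).
Proof.
  intros Hv Hs.
  assert (E := is_derive_RInt_affine (ball1 s0 e) H (fun t => t ^ a * (1 - t) ^ b)
    (fun t => 0 + v * t) (fun t => 1 + (- (1)) * t) s (open_ball1 s0 e) HH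
    (continuity_pt_weight a b) (continuity_pt_linear 0 v) (continuity_pt_linear 1 (- (1)))).
  replace (chord_integral a (S b) (Derive H) v s) with
    (RInt (fun t => t ^ a * (1 - t) ^ b * (1 + - (1) * t) *
       Derive H (0 + v * t + (1 + - (1) * t) * s)) 0 1).
  - apply is_derive_ext with (fun u => RInt (fun t => t ^ a * (1 - t) ^ b *
      H (0 + v * t + (1 + - (1) * t) * u)) 0 1).
    + intros u; apply RInt_ext; intros t _; f_equal; f_equal; ring.
    + apply E; generalize (open_ball1 s0 e s Hs); apply filter_imp; intros u Hu t Ht.
      replace (0 + v * t + (1 + - (1) * t) * u) with (u + t * (v - u)) by ring.
      apply ball1_segment; auto.
  - apply RInt_ext; intros t _.
    replace (0 + v * t + (1 + - (1) * t) * s) with (s + t * (v - s)) by ring; simpl; ring.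
Qed.

End ChordIntegral.

(** The first derivative brings out phi' and is balanced as in a composition; the second brings out
    no such factor and is paid by 2 K <= L. The additional order of [H] gives the continuity used in
    integrating and in differentiating under the integral. *)
Lemma dominated_chord_integral n s0 e B K q H U A L0 L phi :
  sec_open U -> 0 <= B -> 0 <= K -> 0 <= q -> 0 <= A -> 0 <= L0 ->
  4 * L0 <= L -> 2 * (K * (A * L0)) <= L -> 2 * K <= L ->
  (forall t s, U t s -> ball1 s0 e (phi t) /\ ball1 s0 e s) ->
  dominated1 (S n) (ball1 s0 e) B K q H -> dominated n U A L0 1 (fun t _ => phi t) ->
  forall a b, dominated n U B L (q / 2) (fun t s => chord_integral a b H (phi t) s).
Proof.
  intros HU HB HK Hq HA HL0 HL1 HL2 HL3 HV; revert B q H HB Hq.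
  induction n as [|n IH]; intros B q H HB Hq HH Hphi a b;
    assert (HHc := proj1 (dominated1_S_inv _ _ _ _ _ _ HH));
    assert (Hbd : forall t s, U t s -> Rabs (chord_integral a b H (phi t) s) <= B);
    try (intros t s Hts; destruct (HV t s Hts); apply (chord_integral_bound s0 e); auto;
         intros u Hu; split;
         [apply continuity_pt_filterlim, (ex_derive_continuous H), HHc, Hu
         | apply (dominated1_bound _ _ _ _ _ _ _ HH Hu)]).
  - split; [exact Hbd | exact I].
  - assert (HAL : 0 <= A * L0) by (apply Rmult_le_pos; lra).
    assert (HKAL : 0 <= K * (A * L0)) by (apply Rmult_le_pos; lra).
    assert (HBq0 : 0 <= B * q) by (apply Rmult_le_pos; lra).
    assert (HBq : 0 <= B * (q * K)) by (repeat apply Rmult_le_pos; lra).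
    assert (Hq1 : 0 <= q + 1) by lra.
    assert (Hphi' := dominated_le _ n _ _ _ _ _ (Nat.le_succ_diag_r n) Hphi).
    destruct (dominated1_S_inv _ _ _ _ _ _ HH) as [_ HH'].
    assert (HHc' := proj1 (dominated1_S_inv _ _ _ _ _ _ HH')).
    assert (HHd : forall t, ball1 s0 e t -> ex_derive H t /\ continuity_pt (Derive H) t).
    { intros t Ht; split; [auto |].
      apply continuity_pt_filterlim, (ex_derive_continuous (Derive H)), HHc', Ht. }
    assert (IH' := IH _ _ _ HBq Hq1 HH' Hphi').
    destruct Hphi as (_ & P2 & P3 & _).
    assert (Hd1 : forall t s, U t s -> is_derive (fun u => chord_integral a b H (phi u) s) t
      (Derive phi t * chord_integral (S a) b (Derive H) (phi t) s)).
    { intros t s Hts; destruct (HV t s Hts).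
      apply (is_derive_comp (fun v => chord_integral a b H v s) phi).
      - apply (is_derive_chord_integral_1 s0 e); auto.
      - apply Derive_correct, (P2 t s Hts). }
    assert (Hd2 : forall t s, U t s -> is_derive (fun s => chord_integral a b H (phi t) s) s
      (chord_integral a (S b) (Derive H) (phi t) s)).
    { intros t s Hts; destruct (HV t s Hts); apply (is_derive_chord_integral_2 s0 e); auto. }
    split; [exact Hbd |].
    split; [intros t s Hts; split; eexists; [apply Hd1 | apply Hd2]; auto |].
    split.
    + apply dominated_ext with
        (fun t s => Derive phi t * chord_integral (S a) b (Derive H) (phi t) s); auto.
      { intros t s Hts; symmetry; apply is_derive_unique, Hd1, Hts. }
      change (dominated n U (A * (1 * L0)) L0 (1 + 1) (fun t _ => Derive phi t)) in P3.
      apply (dominated_weaken _ _ (A * (1 * L0)) (A * L0) L0 L (1 + 1) (1 / 2)) in P3; try lra.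
      assert (Hm := dominated_mult n U _ _ L (1 / 2) ((q + 1) / 2) _ _ HU HAL HBq
                      ltac:(lra) ltac:(lra) ltac:(lra) P3 (IH' (S a) b)).
      replace (1 / 2 + (q + 1) / 2) with (q / 2 + 1) in Hm by field.
      eapply dominated_weaken; [| | | | | | | exact Hm]; try lra.
      * apply Rmult_le_pos; auto.
      * replace (A * L0 * (B * (q * K))) with ((B * q) * (K * (A * L0))) by ring.
        replace (B * (q / 2 * L)) with ((B * q) * (L / 2)) by field.
        apply Rmult_le_compat_l; lra.
    + apply dominated_ext with (fun t s => chord_integral a (S b) (Derive H) (phi t) s); auto.
      { intros t s Hts; symmetry; apply is_derive_unique, Hd2, Hts. }
      eapply dominated_weaken; [| | | | | | | exact (IH' a (S b))]; try lra.
      * replace (B * (q * K)) with ((B * q) * K) by ring.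
        replace (B * (q / 2 * L)) with ((B * q) * (L / 2)) by field.
        apply Rmult_le_compat_l; lra.
Qed.

Lemma regular_chord_integral an H phi t0 a b :
  regular1 an H (phi t0) -> regular1 an phi t0 ->
  regular an (fun t s => chord_integral a b H (phi t) s) t0 (phi t0).
Proof.
  intros HH Hphi; apply regular_intro; intros N.
  destruct (HH (S N)) as (e & B & K & He & HB & HK & HHn).
  destruct (Hphi N) as (d & A & L & Hd & HA & HL & Hn).
  destruct (proj1 (continuity_pt_locally phi t0) (regular1_continuous _ _ _ Hphi) (mkposreal e He))
    as [e' He']; simpl in He'.
  assert (0 <= K * (A * L)) by (repeat apply Rmult_le_pos; auto).
  assert (K1 := Rmin_l d (Rmin e e')); assert (K2 := Rmin_r d (Rmin e e')).
  assert (K3 := Rmin_l e e'); assert (K4 := Rmin_r e e').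
  exists (Rmin d (Rmin e e')), B, (4 * L + 2 * (K * (A * L)) + 2 * K), (1 / 2).
  split; [repeat apply Rmin_glb_lt; auto; apply cond_pos |].
  split; [auto |]; split; [lra |]; split; [lra |].
  intros n Hn'; apply dominated_chord_integral with (phi t0) e K A L; auto; try lra.
  - apply sec_open_box.
  - intros t s [Ht Hs]; split; [| eapply ball1_le; [| exact Hs]; lra].
    apply He'; eapply ball1_le; [| exact Ht]; lra.
  - apply HHn; destruct Hn'; [left | right; lia]; auto.
  - eapply dominated_subset; [| apply Hn; auto]; intros t s [Ht _]; eapply ball1_le; [|
    exact Ht]; lra.
Qed.

Lemma chord_integral_diff w s0 e v s :
  (forall t, ball1 s0 e t -> ex_derive w t /\ continuity_pt (Derive w) t) ->
  ball1 s0 e v -> ball1 s0 e s ->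
  w v - w s = (v - s) * chord_integral 0 0 (Derive w) v s.
Proof.
  intros Hw Hv Hs.
  assert (Hc : forall t, 0 <= t <= 1 -> continuous (fun t => Derive w (s + t * (v - s))) t).
  { intros t Ht; apply continuity_pt_filterlim.
    apply (continuity_pt_comp (fun t => s + t * (v - s)) (Derive w)).
    - apply continuity_pt_ext with (fun t => s + (v - s) * t); [intros; ring |].
      apply continuity_pt_linear.
    - apply Hw, ball1_segment; auto. }
  assert (E : is_RInt (fun t => (v - s) * Derive w (s + t * (v - s))) 0 1
    (minus (w (s + 1 * (v - s))) (w (s + 0 * (v - s))))).
  { apply (is_RInt_derive (fun t => w (s + t * (v - s)))); intros t;
      rewrite Rmin_left, Rmax_right by lra; intros Ht.
    - apply (is_derive_comp w (fun t => s + t * (v - s))).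
      + apply Derive_correct, Hw, ball1_segment; auto.
      + auto_derive; [exact I | ring].
    - apply (continuous_scal_r (v - s) (fun t => Derive w (s + t * (v - s)))); auto. }
  apply (@is_RInt_unique R_CompleteNormedModule) in E.
  unfold minus, plus, opp in E; simpl in E.
  replace (s + 1 * (v - s)) with v in E by ring; replace (s + 0 * (v - s)) with s in E by ring.
  unfold Rminus at 1; rewrite <- E; unfold chord_integral.
  rewrite (RInt_ext (fun t => t ^ 0 * (1 - t) ^ 0 * Derive w (s + t * (v - s)))
    (fun t => Derive w (s + t * (v - s)))) by (intros; simpl; ring).
  apply (RInt_scal (fun t => Derive w (s + t * (v - s))) 0 1 (v - s)).
  apply @ex_RInt_continuous; intros t; rewrite Rmin_left, Rmax_right by lra; apply Hc.
Qed.

Lemma chord_integral_diag H s : chord_integral 0 0 H s s = H s.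
Proof.
  unfold chord_integral.
  rewrite (RInt_ext _ (fun _ => H s)).
  - rewrite RInt_const; unfold scal; simpl; unfold mult; simpl; ring.
  - intros t _; replace (s + t * (s - s)) with s by ring; simpl; ring.
Qed.

(** * From bounds to Taylor series *)

(** [ex_diff_n] also asks for continuity of the derivatives of top order, which a bound one order
    higher gives through a Lipschitz estimate. *)
Lemma ex_diff_n_of_dominated n t0 s0 d A L p f t s :
  0 <= A -> 0 <= L -> 0 <= p ->
  dominated (S n) (box t0 s0 d) A L p f -> box t0 s0 d t s -> ex_diff_n f n t s.
Proof.
  intros HA HL Hp H Hts; revert A p f HA Hp H; induction n as [|n IH]; intros A p f HA Hp H;
    assert (Hc : continuity_2d_pt f t s)
      by (apply (dominated_continuity t0 s0 d A L p); auto; apply dominated_le with (2 := H); lia).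
  - split; auto.
  - assert (0 <= A * (p * L)) by (repeat apply Rmult_le_pos; auto).
    destruct H as (H1 & H2 & H3 & H4); destruct (H2 t s Hts).
    split; [auto |]; split; [auto |]; split; [auto |].
    assert (0 <= p + 1) by lra.
    split; [apply (IH (A * (p * L)) (p + 1) (pd1 f)) | apply (IH (A * (p * L)) (p + 1)
      (pd2 f))]; auto.
Qed.

Lemma ex_diff_n_of_regular f t s n : regular False f t s -> ex_diff_n f n t s.
Proof.
  intros H; destruct (H (S n)) as (d & A & L & Hd & HA & HL & Hn).
  apply (ex_diff_n_of_dominated n t s d A L 1); auto; [lra | apply box_center; auto].
Qed.

(* [word_sum d f m] is the sum of all derivatives of order [d] of [f] in which [pd1]
   occurs [m] times, over all orders of differentiation; no symmetry of mixed
   derivatives is then required. *)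
Fixpoint word_sum (d : nat) (f : R -> R -> R) (m : nat) (t s : R) : R :=
  match d with
  | O => match m with O => f t s | S _ => 0 end
  | S d => match m with O => 0 | S m => word_sum d (pd1 f) m t s end + word_sum d (pd2 f) m t s
  end.

(** This is the iterated directional derivative (h D1 + k D2)^d f, with its words collected by the
    number m of occurrences of D1. *)
Definition taylor_form (d : nat) (f : R -> R -> R) (h k t s : R) : R :=
  sum_f_R0 (fun m => word_sum d f m t s * h ^ m * k ^ (d - m)) d.

Lemma word_sum_gt d f m t s : (d < m)%nat -> word_sum d f m t s = 0.
Proof.
  revert f m; induction d as [|d IH]; intros f m Hm; destruct m as [|m]; try lia; simpl; auto.
  rewrite !IH by lia; ring.
Qed.

Lemma sum_binary_form (u v : nat -> R) (h k : R) (d : nat) :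
  v (S d) = 0 ->
  sum_f_R0 (fun m => (match m with O => 0 | S m => u m end + v m) * h ^ m * k ^ (S d - m)) (S d) =
  h * sum_f_R0 (fun m => u m * h ^ m * k ^ (d - m)) d +
  k * sum_f_R0 (fun m => v m * h ^ m * k ^ (d - m)) d.
Proof.
  intros Hv.
  rewrite (sum_eq _ (fun m => match m with O => 0 | S m => u m end * h ^ m * k ^ (S d - m) +
     v m * h ^ m * k ^ (S d - m))) by (intros; ring).
  rewrite sum_plus; f_equal.
  - rewrite decomp_sum by lia; simpl Init.Nat.pred.
    rewrite !Rmult_0_l, Rplus_0_l, scal_sum; apply sum_eq; intros m Hm.
    change (S d - S m)%nat with (d - m)%nat; simpl; ring.
  - rewrite tech5, Hv, !Rmult_0_l, Rplus_0_r, scal_sum; apply sum_eq; intros m Hm.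
    replace (S d - m)%nat with (S (d - m)) by lia; simpl; ring.
Qed.

Lemma taylor_form_S d f h k t s :
  taylor_form (S d) f h k t s =
  h * taylor_form d (pd1 f) h k t s + k * taylor_form d (pd2 f) h k t s.
Proof.
  unfold taylor_form; simpl word_sum.
  apply (sum_binary_form (fun m => word_sum d (pd1 f) m t s) (fun m => word_sum d (pd2 f) m t s)).
  apply word_sum_gt; lia.
Qed.

(** Each word of length d is a derivative of order d, bounded by A L^d p (p + 1) ... (p + d - 1),
    and the monomials |h|^m |k|^(d - m) of all words add up to (|h| + |k|)^d. *)
Lemma taylor_form_abs_bound d U A L p f h k t s :
  dominated d U A L p f -> U t s ->
  sum_f_R0 (fun m => Rabs (word_sum d f m t s * h ^ m * k ^ (d - m))) d <=
  A * L ^ d * poch p d * (Rabs h + Rabs k) ^ d.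
Proof.
  intros H Hts; revert A p f H; induction d as [|d IH]; intros A p f H.
  - simpl; rewrite !Rmult_1_r; apply H; auto.
  - destruct H as (_ & _ & H3 & H4); apply IH in H3; apply IH in H4.
    assert (HE : forall g m i, Rabs (g * h ^ m * k ^ i) = Rabs g * Rabs h ^ m * Rabs k ^ i)
      by (intros; rewrite !Rabs_mult, !RPow_abs; ring).
    set (u := fun m => Rabs (word_sum d (pd1 f) m t s)).
    set (v := fun m => Rabs (word_sum d (pd2 f) m t s)).
    eapply Rle_trans; [apply sum_Rle with (Bn := fun m =>
      (match m with O => 0 | S m => u m end + v m) * Rabs h ^ m * Rabs k ^ (S d - m)) |].
    + intros m _; rewrite HE; apply Rmult_le_compat_r; [apply pow_le, Rabs_pos |].
      apply Rmult_le_compat_r; [apply pow_le, Rabs_pos |].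
      simpl word_sum; destruct m as [|m]; [rewrite !Rplus_0_l; unfold v; lra |].
      apply Rabs_triang.
    + rewrite sum_binary_form by (unfold v; rewrite word_sum_gt by lia; apply Rabs_R0).
      rewrite (sum_eq _ _ d (fun m _ => HE (word_sum d (pd1 f) m t s) m (d - m)%nat)) in H3.
      rewrite (sum_eq _ _ d (fun m _ => HE (word_sum d (pd2 f) m t s) m (d - m)%nat)) in H4.
      change (poch p (S d)) with (p * poch (p + 1) d).
      replace (A * L ^ S d * (p * poch (p + 1) d) * (Rabs h + Rabs k) ^ S d) with
        (Rabs h * (A * (p * L) * L ^ d * poch (p + 1) d * (Rabs h + Rabs k) ^ d) +
         Rabs k * (A * (p * L) * L ^ d * poch (p + 1) d * (Rabs h + Rabs k) ^ d))
        by (simpl; ring).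
      apply Rplus_le_compat; apply Rmult_le_compat_l; auto; apply Rabs_pos.
Qed.

Lemma taylor_form_bound d U A L p f h k t s :
  dominated d U A L p f -> U t s ->
  Rabs (taylor_form d f h k t s) <= A * L ^ d * poch p d * (Rabs h + Rabs k) ^ d.
Proof.
  intros H Hts; eapply Rle_trans; [apply Rsum_abs |].
  eapply taylor_form_abs_bound; eauto.
Qed.

Lemma is_derive_taylor_form d t0 s0 e A L p f h k x :
  0 <= A -> 0 <= L -> 0 <= p ->
  dominated (S (S d)) (box t0 s0 e) A L p f -> box t0 s0 e (t0 + x * h) (s0 + x * k) ->
  is_derive (fun x => taylor_form d f h k (t0 + x * h) (s0 + x * k)) x
    (taylor_form (S d) f h k (t0 + x * h) (s0 + x * k)).
Proof.
  intros HA HL Hp H Hx; revert A p f HA Hp H; induction d as [|d IH]; intros A p f HA Hp H.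
  - rewrite taylor_form_S; unfold taylor_form; simpl sum_f_R0; simpl word_sum.
    apply is_derive_ext with (fun x => f (t0 + x * h) (s0 + x * k)); [intros; simpl; ring |].
    assert (HAp : 0 <= A * (p * L)) by (repeat apply Rmult_le_pos; auto).
    destruct H as (_ & H2 & H3 & _).
    (* Joint differentiability follows from the partial derivatives near the point and the
       continuity of the first one. That continuity uses a second-order bound, whence the order d +
       2 in the hypothesis. *)
    assert (E : differentiable_pt_lim f (t0 + x * h) (s0 + x * k)
       (pd1 f (t0 + x * h) (s0 + x * k)) (pd2 f (t0 + x * h) (s0 + x * k))).
    { apply filterdiff_differentiable_pt_lim, is_derive_filterdiff.
      - apply (locally_2d_locally (fun u v => is_derive (fun z => f z v) u (pd1 f u v))).
        destruct Hx as [Hx1 Hx2].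
        destruct (open_ball1 t0 e _ Hx1) as [e1 He1]; destruct (open_ball1 s0 e _ Hx2) as [e2 He2].
        exists (mkposreal _ (Rmin_glb_lt _ _ _ (cond_pos e1) (cond_pos e2))); simpl.
        intros u v Hu Hv; apply Derive_correct, (H2 u v); split.
        + apply He1; eapply Rlt_le_trans; [exact Hu | apply Rmin_l].
        + apply He2; eapply Rlt_le_trans; [exact Hv | apply Rmin_r].
      - apply Derive_correct, (H2 _ _ Hx).
      - apply continuity_2d_pt_filterlim.
        apply (dominated_continuity t0 s0 e (A * (p * L)) L (p + 1) (pd1 f)); auto; lra. }
    apply is_derive_Reals.
    match goal with |- derivable_pt_lim _ _ ?l => replace l with
      (pd1 f (t0 + x * h) (s0 + x * k) * h + pd2 f (t0 + x * h) (s0 + x * k) * k)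
      by (simpl; ring) end.
    apply (derivable_pt_lim_comp_2d f (fun x => t0 + x * h) (fun x => s0 + x * k)); [exact E | |];
      apply is_derive_Reals; auto_derive; auto; ring.
  - assert (HAp : 0 <= A * (p * L)) by (repeat apply Rmult_le_pos; auto).
    destruct H as (_ & _ & H3 & H4); rewrite taylor_form_S.
    apply is_derive_ext with (fun x => h * taylor_form d (pd1 f) h k (t0 + x * h) (s0 + x * k) +
      k * taylor_form d (pd2 f) h k (t0 + x * h) (s0 + x * k));
      [intros; symmetry; apply taylor_form_S |].
    apply @is_derive_plus.
    + apply is_derive_scal, (IH (A * (p * L)) (p + 1)); auto; lra.
    + apply is_derive_scal, (IH (A * (p * L)) (p + 1)); auto; lra.
Qed.

(** Along the segment x -> (t0 + x h, s0 + x k) the n-th derivative is the Taylor form of order n.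
    With y = L (|h| + |k|) <= 1/2, the Lagrange remainder after order n is at most A y^(n + 1), and
    the same estimate makes the series converge absolutely. *)
Lemma analytic2_of_regular f t0 s0 : regular True f t0 s0 -> analytic2_at f t0 s0.
Proof.
  intros H; destruct (H 0%nat) as (e & A & L & He & HA & HL & Hn).
  assert (Hd : forall n, dominated n (box t0 s0 e) A L 1 f) by (intros; apply Hn; left; exact I).
  (* The bound e / 2 keeps the segment in the box for all |x| < 2, an open neighbourhood of [0, 1]
     on which derivatives in x can be taken; the other bound gives L (|h| + |k|) <= 1/2. *)
  set (rad := Rmin (e / 2) (/ (4 * (L + 1)))).
  assert (HL1 : 0 < / (4 * (L + 1))) by (apply Rinv_0_lt_compat; lra).
  assert (Hrad : 0 < rad) by (apply Rmin_glb_lt; lra).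
  exists (fun m k => word_sum (m + k) f m t0 s0 / INR (fact (m + k))), rad; split; [auto |].
  intros h k Hh Hk.
  assert (Hrho : 0 <= L * (Rabs h + Rabs k) <= / 2).
  { assert (R1 := Rmin_r (e / 2) (/ (4 * (L + 1)))); fold rad in R1.
    assert (P1 := Rabs_pos h); assert (P2 := Rabs_pos k).
    split; [apply Rmult_le_pos; lra |].
    apply Rle_trans with ((L + 1) * (2 * / (4 * (L + 1)))); [| right; field; lra].
    apply Rmult_le_compat; lra. }
  set (y := L * (Rabs h + Rabs k)) in *.
  assert (Hbox : forall x, Rabs x < 2 -> box t0 s0 e (t0 + x * h) (s0 + x * k)).
  { intros x Hx; assert (R1 := Rmin_l (e / 2) (/ (4 * (L + 1)))); fold rad in R1.
    split; unfold ball1;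
      [replace (t0 + x * h - t0) with (x * h) by ring | replace (s0 + x * k - s0) with (x * k)
        by ring];
      rewrite Rabs_mult;
      (eapply Rle_lt_trans; [apply Rmult_le_compat_r; [apply Rabs_pos | left; exact Hx] | lra]). }
  assert (Hf : forall n, 0 < INR (fact n)) by (intros; apply INR_fact_lt_0).
  assert (HB : forall n t s, box t0 s0 e t s ->
    A * L ^ n * poch 1 n * (Rabs h + Rabs k) ^ n = INR (fact n) * (A * y ^ n)).
  { intros n t s _; unfold y; rewrite poch_1, Rpow_mult_distr; ring. }
  assert (Hc : box t0 s0 e t0 s0) by (apply box_center; auto).
  split.
  - apply (ex_series_le (K := R_AbsRing) (V := R_CompleteNormedModule) _ (fun n => A * y ^ n)).
    + intros n; change (norm ?x) with (Rabs x).
      rewrite Rabs_pos_eq by (apply cond_pos_sum; intros; apply Rabs_pos).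
      assert (E := taylor_form_abs_bound n _ A L 1 f h k t0 s0 (Hd n) Hc).
      rewrite (HB n t0 s0 Hc) in E.
      apply (Rmult_le_reg_l (INR (fact n))); auto; eapply Rle_trans; [| exact E].
      right; rewrite scal_sum; apply sum_eq; intros m Hm.
      replace (m + (n - m))%nat with n by lia.
      rewrite <- (Rabs_pos_eq (INR (fact n))) at 2 by (left; auto).
      rewrite <- Rabs_mult; f_equal; field; apply INR_fact_neq_0.
    + apply (ex_series_scal A (fun n => y ^ n)), ex_series_geom; rewrite Rabs_pos_eq; lra.
  - set (g := fun x => f (t0 + x * h) (s0 + x * k)).
    assert (Dg : forall n x, Rabs x < 2 ->
      Derive_n g n x = taylor_form n f h k (t0 + x * h) (s0 + x * k)).
    { induction n as [|n IH]; intros x Hx; [unfold taylor_form, g; simpl; ring |].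
      simpl; rewrite (Derive_ext_loc _ (fun x => taylor_form n f h k (t0 + x * h) (s0 + x * k))).
      - apply is_derive_unique, (is_derive_taylor_form n t0 s0 e A L 1); auto; lra.
      - assert (Hx' : ball1 0 2 x) by (unfold ball1; rewrite Rminus_0_r; auto).
        generalize (open_ball1 0 2 x Hx'); apply filter_imp; intros u Hu; apply IH.
        unfold ball1 in Hu; rewrite Rminus_0_r in Hu; auto. }
    assert (Eg : forall n x, Rabs x < 2 -> ex_derive_n g n x).
    { intros [|n] x Hx; [exact I |]; simpl.
      apply ex_derive_ext_loc with (fun x => taylor_form n f h k (t0 + x * h) (s0 + x * k)).
      - assert (Hx' : ball1 0 2 x) by (unfold ball1; rewrite Rminus_0_r; auto).
        generalize (open_ball1 0 2 x Hx'); apply filter_imp; intros u Hu; symmetry; apply Dg.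
        unfold ball1 in Hu; rewrite Rminus_0_r in Hu; auto.
      - eexists; apply (is_derive_taylor_form n t0 s0 e A L 1); auto; lra. }
    assert (Ht : forall n, Rabs (sum_f_R0 (fun d => sum_f_R0 (fun m =>
        word_sum (m + (d - m)) f m t0 s0 / INR (fact (m + (d - m))) * h ^ m * k ^ (d - m)) d) n
        - f (t0 + h) (s0 + k)) <= A * y ^ S n).
    { intros n; destruct (Taylor_Lagrange g n 0 1 Rlt_0_1) as (x & Hx & E).
      { intros t Ht j _; apply Eg; rewrite Rabs_pos_eq; lra. }
      assert (Hx2 : Rabs x < 2) by (rewrite Rabs_pos_eq; lra).
      unfold g in E at 1; rewrite !Rmult_1_l in E; rewrite E.
      replace (sum_f_R0 (fun m => (1 - 0) ^ m / INR (fact m) * Derive_n g m 0) n) with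
        (sum_f_R0 (fun d => sum_f_R0 (fun m =>
        word_sum (m + (d - m)) f m t0 s0 / INR (fact (m + (d - m))) * h ^ m * k ^ (d - m)) d) n).
      - match goal with |- Rabs (?a - (?a + ?b)) <= _ =>
          replace (a - (a + b)) with (- b) by ring end.
        rewrite Rabs_Ropp, Dg by auto; replace (1 - 0) with 1 by ring; rewrite pow1.
        assert (Hbx := Hbox x Hx2).
        assert (E2 := taylor_form_bound (S n) _ A L 1 f h k _ _ (Hd (S n)) Hbx).
        rewrite (HB (S n) _ _ Hbx) in E2.
        rewrite Rabs_mult, Rabs_pos_eq by (left; apply Rdiv_lt_0_compat; auto; lra).
        apply (Rmult_le_reg_l (INR (fact (S n)))); auto.
        eapply Rle_trans; [| exact E2]; right; field; apply INR_fact_neq_0.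
      - apply sum_eq; intros d _; rewrite Dg by (rewrite Rabs_R0; lra).
        rewrite !Rmult_0_l, !Rplus_0_r; replace (1 - 0) with 1 by ring; rewrite pow1.
        unfold taylor_form; rewrite scal_sum; apply sum_eq; intros m Hm.
        replace (m + (d - m))%nat with d by lia; field; apply INR_fact_neq_0. }
    assert (Hlim : is_lim_seq (fun n => A * y ^ S n) 0).
    { replace (Finite 0) with (Rbar_mult A 0) by (simpl; f_equal; ring).
      apply is_lim_seq_scal_l, (is_lim_seq_incr_1 (fun n => y ^ n)), is_lim_seq_geom.
      rewrite Rabs_pos_eq; lra. }
    assert (Hlim2 : is_lim_seq (fun n => sum_f_R0 (fun d => sum_f_R0 (fun m =>
        word_sum (m + (d - m)) f m t0 s0 / INR (fact (m + (d - m))) * h ^ m * k ^ (d - m)) d) n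
        - f (t0 + h) (s0 + k)) 0).
    { apply is_lim_seq_abs_0, is_lim_seq_le_le with (fun _ => 0) (fun n => A * y ^ S n); auto.
      - intros n; split; [apply Rabs_pos | apply Ht].
      - apply is_lim_seq_const. }
    apply (is_lim_seq_plus' _ (fun _ => f (t0 + h) (s0 + k)) _ (f (t0 + h) (s0 + k))) in Hlim2;
      [| apply is_lim_seq_const].
    rewrite Rplus_0_l in Hlim2.
    match goal with |- is_series ?a ?l => change (is_lim_seq (sum_n a) l) end.
    eapply is_lim_seq_ext; [| exact Hlim2].
    intros n; simpl; rewrite sum_n_Reals; ring.
Qed.

(** * Radial profiles of the Hankel function *)

(** Equivalent to an infinite radius of convergence, stated as the geometric bounds of arbitrarily
    small rate that the regularity of power series takes as input. *)
Definition rapidly_decreasing (c : nat -> R) : Prop :=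
  forall rho, 0 < rho -> exists B, forall k, Rabs (c k) <= B * rho ^ k.

Lemma inv_fact_bound rho : 0 < rho -> exists B, forall k, / INR (fact k) <= B * rho ^ k.
Proof.
  intros Hr; assert (H := cv_speed_pow_fact (/ rho)); apply is_lim_seq_Reals in H.
  destruct (filterlim_bounded (fun k => (/ rho) ^ k / INR (fact k))) as [M HM].
  { exists 0; exact H. }
  exists M; intros k; specialize (HM k); change (norm ?x) with (Rabs x) in HM.
  assert (Hp : 0 < rho ^ k) by (apply pow_lt; auto).
  apply Rle_trans with ((/ rho) ^ k / INR (fact k) * rho ^ k).
  - right; rewrite pow_inv; field; split; [lra | apply INR_fact_neq_0].
  - apply Rmult_le_compat_r; [lra |]; eapply Rle_trans; [apply Rle_abs | exact HM].
Qed.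

Lemma rapidly_decreasing_of_inv_fact c :
  (forall k, Rabs (c k) <= / INR (fact k)) -> rapidly_decreasing c.
Proof.
  intros Hc rho Hr; destruct (inv_fact_bound rho Hr) as [B HB]; exists B; intros k.
  eapply Rle_trans; [apply Hc | apply HB].
Qed.

Lemma rapidly_decreasing_derive c : rapidly_decreasing c -> rapidly_decreasing (PS_derive c).
Proof.
  (* Halving the rate pays for the factor k + 1 <= 2^k that differentiation introduces. *)
  intros Hc rho Hr; destruct (Hc (rho / 2)) as [B HB]; [lra |].
  assert (HB0 : 0 <= B).
  { specialize (HB 0%nat); simpl in HB; rewrite Rmult_1_r in HB.
    eapply Rle_trans; [apply Rabs_pos | exact HB]. }
  exists (B * rho); intros k; unfold PS_derive; rewrite Rabs_mult, Rabs_pos_eq by apply pos_INR.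
  assert (H2 : forall k, INR (S k) <= 2 ^ k).
  { clear; induction k as [|k IH]; [simpl; lra |].
    rewrite S_INR; simpl pow; assert (1 <= 2 ^ k) by (apply pow_R1_Rle; lra); lra. }
  eapply Rle_trans; [apply Rmult_le_compat; [apply pos_INR | apply Rabs_pos | apply H2 |
    apply HB] |].
  replace (2 ^ k * (B * (rho / 2) ^ S k)) with (B * rho / 2 * (2 ^ k * (rho / 2) ^ k))
    by (simpl; field).
  rewrite <- Rpow_mult_distr; replace (2 * (rho / 2)) with rho by field.
  apply Rmult_le_compat_r; [apply pow_le; lra |].
  assert (0 <= B * rho) by (apply Rmult_le_pos; lra); lra.
Qed.

Lemma rapidly_decreasing_decr c n : rapidly_decreasing c -> rapidly_decreasing (PS_decr_n c n).
Proof.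
  intros Hc rho Hr; destruct (Hc rho Hr) as [B HB]; exists (B * rho ^ n); intros k.
  unfold PS_decr_n; eapply Rle_trans; [apply HB |]; right; rewrite pow_add; ring.
Qed.

Lemma rapidly_decreasing_radius c x : rapidly_decreasing c -> Rbar_lt (Rabs x) (CV_radius c).
Proof.
  intros Hc; assert (Hx := Rabs_pos x).
  destruct (Hc (/ (Rabs x + 1))) as [B HB]; [apply Rinv_0_lt_compat; lra |].
  apply CV_radius_gt with (Rabs x + 1) B; [lra |]; intros k.
  assert (Hp : 0 < (Rabs x + 1) ^ k) by (apply pow_lt; lra).
  rewrite Rabs_mult, (Rabs_pos_eq ((Rabs x + 1) ^ k)) by lra.
  apply Rle_trans with (B * (/ (Rabs x + 1)) ^ k * (Rabs x + 1) ^ k).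
  - apply Rmult_le_compat_r; [lra | apply HB].
  - right; rewrite pow_inv; field; lra.
Qed.

Definition PSeries_derivative (c : nat -> R) (j : nat) : R -> R :=
  PSeries (Nat.iter j PS_derive c).

Lemma rapidly_decreasing_iter c j :
  rapidly_decreasing c -> rapidly_decreasing (Nat.iter j PS_derive c).
Proof.
  intros Hc; induction j as [|j IH]; simpl; auto; apply rapidly_decreasing_derive, IH.
Qed.

Lemma is_derive_PSeries_derivative c j x :
  rapidly_decreasing c ->
  is_derive (PSeries_derivative c j) x (PSeries_derivative c (S j) x).
Proof.
  intros Hc; apply is_derive_PSeries, rapidly_decreasing_radius, rapidly_decreasing_iter, Hc.
Qed.

Lemma regular_PSeries_derivative an c j f t0 s0 :
  rapidly_decreasing c -> regular an f t0 s0 ->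
  regular an (fun t s => PSeries_derivative c j (f t s)) t0 s0.
Proof.
  intros Hc Hf; set (K := / (2 * (Rabs (f t0 s0) + 1))).
  assert (Ha := Rabs_pos (f t0 s0)).
  assert (HK : 0 < K) by (apply Rinv_0_lt_compat; lra).
  apply regular_PSeries with K; auto.
  - apply (Rmult_lt_reg_l (2 * (Rabs (f t0 s0) + 1))); [lra |].
    unfold K; rewrite <- Rmult_assoc, Rinv_r by lra; lra.
  - apply (rapidly_decreasing_iter c j Hc K HK).
Qed.

Definition J0_coef (k : nat) : R := (-1) ^ k / INR (fact k) ^ 2.
Definition Y0_coef (k : nat) : R := (-1) ^ k * harmonic k / INR (fact k) ^ 2.

Lemma harmonic_bound k : 0 <= harmonic k <= INR k.
Proof.
  induction k as [|k IH]; unfold harmonic in *.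
  - rewrite sum_n_m_zero by lia; unfold zero; simpl; lra.
  - rewrite sum_n_Sm by lia; change plus with Rplus.
    assert (1 <= INR (S k)) by (rewrite S_INR; assert (H := pos_INR k); lra).
    assert (0 < / INR (S k)) by (apply Rinv_0_lt_compat; lra).
    assert (/ INR (S k) <= 1) by (rewrite <- Rinv_1; apply Rinv_le_contravar; lra).
    rewrite S_INR at 3; lra.
Qed.

Lemma INR_fact_ge_1 k : 1 <= INR (fact k).
Proof. change 1 with (INR 1); apply le_INR; assert (H := lt_O_fact k); lia. Qed.

Lemma INR_le_fact k : INR k <= INR (fact k).
Proof.
  apply le_INR; destruct k as [|k]; [simpl; lia |].
  rewrite fact_simpl; assert (H := lt_O_fact k); nia.
Qed.

Lemma J0_coef_decreasing : rapidly_decreasing J0_coef.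
Proof.
  apply rapidly_decreasing_of_inv_fact; intros k; unfold J0_coef, Rdiv.
  assert (H := INR_fact_ge_1 k).
  rewrite Rabs_mult, pow_1_abs, Rmult_1_l, Rabs_pos_eq
    by (left; apply Rinv_0_lt_compat, pow_lt; lra).
  apply Rinv_le_contravar; [lra |]; simpl; nra.
Qed.

(** The harmonic number is at most k <= k!, so it uses up one of the two factorials and leaves the
    other. *)
Lemma Y0_coef_decreasing : rapidly_decreasing Y0_coef.
Proof.
  apply rapidly_decreasing_of_inv_fact; intros k; unfold Y0_coef, Rdiv.
  assert (H := INR_fact_ge_1 k); assert (H1 := INR_le_fact k); assert (H2 := harmonic_bound k).
  assert (Hp : 0 < INR (fact k) ^ 2) by (apply pow_lt; lra).
  rewrite !Rabs_mult, pow_1_abs, Rmult_1_l, !Rabs_pos_eq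
    by (try (left; apply Rinv_0_lt_compat; lra); lra).
  apply Rle_trans with (INR (fact k) * / INR (fact k) ^ 2).
  - apply Rmult_le_compat_r; [left; apply Rinv_0_lt_compat; lra | lra].
  - right; field; lra.
Qed.

(* J0(sqrt (4 v)) = 1 - v + v^2 (J0_tail 0 v), and the second series of Y0(sqrt (4 v)) is
   Y0_series 0 v. *)
Definition J0_tail (j : nat) : R -> R := PSeries_derivative (PS_decr_n J0_coef 2) j.
Definition Y0_series (j : nat) : R -> R := PSeries_derivative Y0_coef j.

Lemma is_derive_J0_tail j x : is_derive (J0_tail j) x (J0_tail (S j) x).
Proof.
  apply is_derive_PSeries_derivative, rapidly_decreasing_decr, J0_coef_decreasing.
Qed.

Lemma is_derive_Y0_series j x : is_derive (Y0_series j) x (Y0_series (S j) x).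
Proof. apply is_derive_PSeries_derivative, Y0_coef_decreasing. Qed.

(* [Jr kap j] and [Yr kap C j] are the [j]-th derivatives, as functions of the squared
   distance, of J0(k r) and Y0(k r), where kap = k^2 / 4 and C = 2 (ln (k / 2) + gamma). *)
Definition Jr (kap : R) (j : nat) (s : R) : R :=
  match j with
  | O => 1 - kap * s + (kap * s) ^ 2 * J0_tail 0 (kap * s)
  | 1%nat => - kap + 2 * kap ^ 2 * s * J0_tail 0 (kap * s) + kap ^ 3 * s ^ 2 * J0_tail 1 (kap * s)
  | 2%nat => 2 * kap ^ 2 * J0_tail 0 (kap * s) + 4 * kap ^ 3 * s * J0_tail 1 (kap * s)
             + kap ^ 4 * s ^ 2 * J0_tail 2 (kap * s)
  | _ => 6 * kap ^ 3 * J0_tail 1 (kap * s) + 6 * kap ^ 4 * s * J0_tail 2 (kap * s)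
         + kap ^ 5 * s ^ 2 * J0_tail 3 (kap * s)
  end.

Definition Yr (kap C : R) (j : nat) (s : R) : R :=
  match j with
  | O => (ln s + C) * Jr kap 0 s / PI
  | 1%nat => (Jr kap 0 s / s + (ln s + C) * Jr kap 1 s) / PI
  | 2%nat => (- Jr kap 0 s / s ^ 2 + 2 * Jr kap 1 s / s + (ln s + C) * Jr kap 2 s) / PI
  | _ => (2 * Jr kap 0 s / s ^ 3 - 3 * Jr kap 1 s / s ^ 2 + 3 * Jr kap 2 s / s
          + (ln s + C) * Jr kap 3 s) / PI
  end - 2 / PI * (kap ^ j * Y0_series j (kap * s)).

Lemma J0_expansion x : J0 x = Jr 1 0 ((x / 2) ^ 2).
Proof.
  unfold J0; change (fun k => (-1) ^ k / INR (fact k) ^ 2) with J0_coef.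
  rewrite (PSeries_decr_n J0_coef 1).
  - unfold Jr; rewrite !Rmult_1_l; unfold J0_tail, PSeries_derivative, J0_coef; simpl; field.
  - apply CV_disk_correct, CV_disk_inside, rapidly_decreasing_radius, J0_coef_decreasing.
Qed.

Ltac derive_series :=
  auto_derive;
  [repeat split; auto; try lra; eexists; (apply is_derive_J0_tail || apply is_derive_Y0_series)
  | rewrite ?(is_derive_unique _ _ _ (is_derive_J0_tail 0 _)),
      ?(is_derive_unique _ _ _ (is_derive_J0_tail 1 _)),
        ?(is_derive_unique _ _ _ (is_derive_J0_tail 2 _)) ].

Lemma is_derive_Jr kap j s : (j < 3)%nat -> is_derive (Jr kap j) s (Jr kap (S j) s).
Proof.
  intros Hj; destruct j as [|[|[|j]]]; try lia; unfold Jr; derive_series; simpl; ring.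
Qed.

Lemma is_derive_Yr kap C j s :
  (j < 3)%nat -> 0 < s -> is_derive (Yr kap C j) s (Yr kap C (S j) s).
Proof.
  intros Hj Hs; assert (HPI := PI_RGT_0).
  assert (HJ : forall i, (i < 3)%nat -> ex_derive (Jr kap i) s /\ Derive (Jr kap i) s =
    Jr kap (S i) s).
  { intros i Hi; split; [eexists | apply is_derive_unique]; apply is_derive_Jr, Hi. }
  assert (Hb : is_derive (fun s => 2 / PI * (kap ^ j * Y0_series j (kap * s))) s
                 (2 / PI * (kap ^ S j * Y0_series (S j) (kap * s)))).
  { replace (kap ^ S j * Y0_series (S j) (kap * s)) with (kap ^ j * (kap * Y0_series (S j)
    (kap * s)))
      by (simpl; ring).
    do 2 apply is_derive_scal; apply (is_derive_comp (Y0_series j) (fun s => kap * s));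
      [apply is_derive_Y0_series |].
    auto_derive; [exact I | ring]. }
  destruct (HJ 0%nat ltac:(lia)) as [E0 D0]; destruct (HJ 1%nat ltac:(lia)) as [E1 D1].
  destruct (HJ 2%nat ltac:(lia)) as [E2 D2].
  unfold Yr; apply @is_derive_minus; [| exact Hb].
  clear HJ Hb; revert E0 D0 E1 D1 E2 D2.
  generalize (Jr kap 0) (Jr kap 1) (Jr kap 2) (Jr kap 3); intros f0 f1 f2 f3 E0 D0 E1 D1 E2 D2.
  assert (Hs2 : s * (s * 1) <> 0) by (rewrite Rmult_1_r; apply Rmult_integral_contrapositive; lra).
  destruct j as [|[|[|j]]]; try lia; auto_derive;
    try (repeat split; try exact E0; try exact E1; try exact E2; try exact Hs2; lra);
    change (Derive (fun x => f0 x) s) with (Derive f0 s);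
    change (Derive (fun x => f1 x) s) with (Derive f1 s);
    change (Derive (fun x => f2 x) s) with (Derive f2 s);
    rewrite ?D0, ?D1, ?D2; field; lra.
Qed.

(** * Decomposition of the kernel *)

Definition sq (p y : R2) : R := dot (sub2 p y) (sub2 p y).

Definition upd (j : ix) (p : R2) (t : R) : R2 :=
  match j with i1 => (t, snd p) | i2 => (fst p, t) end.

Lemma upd_co j x : upd j x (co x j) = x.
Proof. destruct j, x; reflexivity. Qed.

Lemma partial_upd j f x :
  partial j f x = (Derive (fun t => Re (f (upd j x t))) (co x j),
                   Derive (fun t => Im (f (upd j x t))) (co x j)).
Proof. destruct j; reflexivity. Qed.

Lemma sq_pos x y : x <> y -> 0 < sq x y.
Proof.
  destruct x as [x1 x2], y as [y1 y2]; unfold sq, dot, sub2; simpl; intros H.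
  destruct (Req_dec x1 y1) as [-> | H1]; [destruct (Req_dec x2 y2) as [-> | H2] |].
  - contradiction H; reflexivity.
  - assert (0 < (x2 - y2) ^ 2) by (apply pow2_gt_0; lra); lra.
  - assert (0 < (x1 - y1) ^ 2) by (apply pow2_gt_0; lra).
    assert (0 <= (x2 - y2) ^ 2) by apply pow2_ge_0; lra.
Qed.

Lemma is_derive_val (f : R -> R) (x l l' : R) : is_derive f x l -> l = l' -> is_derive f x l'.
Proof. intros H <-; exact H. Qed.

Lemma is_derive_sq_upd j x y :
  is_derive (fun t => sq (upd j x t) y) (co x j) (2 * co (sub2 x y) j).
Proof. destruct j; unfold sq, dot, sub2; simpl; auto_derive; auto; ring. Qed.

Lemma is_derive_co_upd k i x y :
  is_derive (fun t => co (sub2 (upd k x t) y) i) (co x k) (delta k i).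
Proof. destruct k, i; unfold sub2; simpl; auto_derive; auto; ring. Qed.

Lemma is_derive_radial (f : R -> R) j x y l :
  is_derive f (sq x y) l ->
  is_derive (fun t => f (sq (upd j x t) y)) (co x j) (2 * co (sub2 x y) j * l).
Proof.
  intros Hf; apply (is_derive_comp f (fun t => sq (upd j x t) y)).
  - rewrite upd_co; exact Hf.
  - apply is_derive_sq_upd.
Qed.

(** A derivative depends only on the germ: [sq] stays positive near [x] along the coordinate line,
    so a closed formula valid away from [y] may be differentiated in place of [f]. *)
Lemma partial_eq j (f : R2 -> C) (gR gI : R2 -> R) x y lR lI :
  0 < sq x y -> (forall p, 0 < sq p y -> f p = (gR p, gI p)) ->
  is_derive (fun t => gR (upd j x t)) (co x j) lR ->
  is_derive (fun t => gI (upd j x t)) (co x j) lI ->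
  partial j f x = (lR, lI).
Proof.
  intros Hs Hf HR HI.
  assert (Hloc : locally (co x j) (fun t => f (upd j x t) = (gR (upd j x t), gI (upd j x t)))).
  { assert (Hc := ex_derive_continuous _ _ (ex_intro _ _ (is_derive_sq_upd j x y))).
    assert (Hp : locally (co x j) (fun t => 0 < sq (upd j x t) y)).
    { apply (Hc (fun v => 0 < v)), (open_gt 0); rewrite upd_co; exact Hs. }
    generalize Hp; apply filter_imp; intros t Ht; apply Hf, Ht. }
  rewrite partial_upd; apply injective_projections; apply is_derive_unique.
  - apply is_derive_ext_loc with (2 := HR); generalize Hloc; apply filter_imp.
    intros t ->; reflexivity.
  - apply is_derive_ext_loc with (2 := HI); generalize Hloc; apply filter_imp.
    intros t ->; reflexivity.
Qed.

(** The second derivatives of a radial function f(|r|^2), where [f1] and [f2] stand for f' and f''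
    at |r|^2. In the same way [third] gives its third derivatives, from f'' and f'''. *)
Definition hessian (r : R2) (i j : ix) (f1 f2 : R) : R :=
  2 * delta i j * f1 + 4 * (co r i * co r j) * f2.

Definition third (r : R2) (k i j : ix) (f2 f3 : R) : R :=
  4 * (delta i j * co r k + delta k i * co r j + delta k j * co r i) * f2
  + 8 * (co r i * co r j * co r k) * f3.

Lemma is_derive_grad (f1 : R -> R) i j x y l :
  is_derive f1 (sq x y) l ->
  is_derive (fun t => 2 * co (sub2 (upd i x t) y) j * f1 (sq (upd i x t) y)) (co x i)
    (hessian (sub2 x y) i j (f1 (sq x y)) l).
Proof.
  intros H; eapply is_derive_val.
  - apply (is_derive_mult (fun t => 2 * co (sub2 (upd i x t) y) j)
      (fun t => f1 (sq (upd i x t) y))); [| | exact Rmult_comm].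
    + apply is_derive_scal, is_derive_co_upd.
    + apply is_derive_radial, H.
  - unfold plus, mult; simpl; rewrite upd_co; unfold hessian; ring.
Qed.

Lemma is_derive_hessian (f1 f2 : R -> R) k i j x y l :
  is_derive f1 (sq x y) (f2 (sq x y)) -> is_derive f2 (sq x y) l ->
  is_derive (fun t => hessian (sub2 (upd k x t) y) i j (f1 (sq (upd k x t) y))
                        (f2 (sq (upd k x t) y))) (co x k)
    (third (sub2 x y) k i j (f2 (sq x y)) l).
Proof.
  intros H1 H2; unfold hessian; eapply is_derive_val.
  - apply (is_derive_plus (V := R_NormedModule)).
    + apply is_derive_scal, is_derive_radial, H1.
    + apply (is_derive_mult (fun t => 4 * (co (sub2 (upd k x t) y) i * co (sub2 (upd k x t) y) j))
        (fun t => f2 (sq (upd k x t) y))); [| | exact Rmult_comm].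
      * apply is_derive_scal, (is_derive_mult (fun t => co (sub2 (upd k x t) y) i)
          (fun t => co (sub2 (upd k x t) y) j)); [| | exact Rmult_comm]; apply is_derive_co_upd.
      * apply is_derive_radial, H2.
  - unfold plus, mult; simpl; unfold mult; simpl; rewrite upd_co; unfold third; ring.
Qed.

Lemma dist2_sq p y : dist2 p y = sqrt (sq p y).
Proof. reflexivity. Qed.

(** With s = r^2 one has 2 (ln (k r / 2) + gamma) = ln s + 2 (ln (k / 2) + gamma): this is the
    constant that accompanies ln s in Y0(k r). *)
Definition Yconst (k : R) : R := 2 * (ln (k / 2) + euler_gamma).

Lemma H10_dist2 k p y :
  0 < k -> 0 < sq p y ->
  H10 (k * dist2 p y) = (Jr (k ^ 2 / 4) 0 (sq p y), Yr (k ^ 2 / 4) (Yconst k) 0 (sq p y)).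
Proof.
  intros Hk Hs; assert (HPI := PI_RGT_0).
  assert (E : (k * dist2 p y / 2) ^ 2 = k ^ 2 / 4 * sq p y).
  { rewrite <- (pow2_sqrt (sq p y)) at 1 by lra; rewrite <- dist2_sq; field. }
  assert (EJ : J0 (k * dist2 p y) = Jr (k ^ 2 / 4) 0 (sq p y)).
  { rewrite J0_expansion, E; unfold Jr; rewrite !Rmult_1_l; reflexivity. }
  assert (Hd : 0 < dist2 p y) by (rewrite dist2_sq; apply sqrt_lt_R0, Hs).
  unfold H10; f_equal; [exact EJ |].
  unfold Y0; rewrite EJ, E.
  replace (ln (k * dist2 p y / 2)) with (ln (k / 2) + ln (sq p y) / 2).
  - unfold Yr, Yconst, Y0_series, PSeries_derivative; simpl Nat.iter; fold Y0_coef.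
    change (fun k0 => (-1) ^ k0 * harmonic k0 / INR (fact k0) ^ 2) with Y0_coef; simpl pow;
      field; lra.
  - replace (k * dist2 p y / 2) with (k / 2 * dist2 p y) by field.
    rewrite ln_mult by lra; f_equal.
    rewrite <- (pow2_sqrt (sq p y)) at 1 by lra; rewrite <- dist2_sq; simpl.
    rewrite Rmult_1_r, ln_mult by lra; field.
Qed.

(** The traction as a real linear form in the gradient, [d k i] being the derivative of the i-th
    component in direction k. Real and imaginary parts, and each piece of a decomposition, can then
    be treated separately. *)
Definition trac (lam mu : R) (n : R2) (d : ix -> ix -> R) (i : ix) : R :=
  2 * mu * (co n i1 * d i1 i + co n i2 * d i2 i) + lam * (d i1 i1 + d i2 i2) * co n i
  - mu * co (tangent n) i * (d i1 i2 - d i2 i1).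

Lemma traction_eq lam mu n (u : R2 -> ix -> C) x (dR dI : ix -> ix -> R) i :
  (forall k i, partial k (fun p => u p i) x = (dR k i, dI k i)) ->
  traction lam mu n u x i = (trac lam mu n dR i, trac lam mu n dI i).
Proof.
  intros H; unfold traction, normal_derivative, divergence, curl; rewrite !H.
  unfold trac; apply injective_projections; simpl; ring.
Qed.

(** * First derivatives of the Green's functions *)

Section Kernel.
Variables lam mu rho omega : R.
Hypothesis hmu : 0 < mu.
Hypothesis hlm : 0 < lam + mu.
Hypothesis hrho : 0 < rho.
Hypothesis homega : 0 < omega.

Let kaps : R := omega ^ 2 * rho / (4 * mu).
Let kapp : R := omega ^ 2 * rho / (4 * (lam + 2 * mu)).
Let Cs : R := Yconst (ks mu rho omega).
Let Cp : R := Yconst (kp lam mu rho omega).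

Lemma ks_pos : 0 < ks mu rho omega.
Proof. apply Rmult_lt_0_compat; auto; apply sqrt_lt_R0, Rdiv_lt_0_compat; auto. Qed.

Lemma kp_pos : 0 < kp lam mu rho omega.
Proof. apply Rmult_lt_0_compat; auto; apply sqrt_lt_R0, Rdiv_lt_0_compat; auto; lra. Qed.

Lemma ks_sq : ks mu rho omega ^ 2 = 4 * kaps.
Proof.
  unfold ks, kaps; rewrite Rpow_mult_distr, pow2_sqrt; [field; lra |].
  left; apply Rdiv_lt_0_compat; auto.
Qed.

Lemma kp_sq : kp lam mu rho omega ^ 2 = 4 * kapp.
Proof.
  unfold kp, kapp; rewrite Rpow_mult_distr, pow2_sqrt; [field; lra |].
  left; apply Rdiv_lt_0_compat; auto; lra.
Qed.

Lemma kaps_pos : 0 < kaps.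
Proof. assert (H := ks_sq); assert (0 < ks mu rho omega ^ 2) by (apply pow_lt, ks_pos); lra. Qed.

(** This ratio lets the poles match the static kernel: it gives kapp - kaps = - kaps (lam + mu) /
    (lam + 2 mu), which produces the elastic constants of [Emat]. *)
Lemma kapp_kaps : kapp = kaps * mu / (lam + 2 * mu).
Proof. unfold kapp, kaps; field; lra. Qed.

Definition Jd (j : nat) (s : R) : R := Jr kaps j s - Jr kapp j s.
Definition Yd (j : nat) (s : R) : R := Yr kaps Cs j s - Yr kapp Cp j s.

Lemma is_derive_Jd j s : (j < 3)%nat -> is_derive (Jd j) s (Jd (S j) s).
Proof. intros; apply @is_derive_minus; apply is_derive_Jr; auto. Qed.

Lemma is_derive_Yd j s : (j < 3)%nat -> 0 < s -> is_derive (Yd j) s (Yd (S j) s).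
Proof. intros; apply @is_derive_minus; apply is_derive_Yr; auto. Qed.

Lemma H10_difference p y : 0 < sq p y ->
  (H10 (ks mu rho omega * dist2 p y) - H10 (kp lam mu rho omega * dist2 p y))%C =
  (Jd 0 (sq p y), Yd 0 (sq p y)).
Proof.
  intros Hs; rewrite !H10_dist2 by (auto; apply ks_pos || apply kp_pos).
  rewrite ks_sq, kp_sq; replace (4 * kaps / 4) with kaps by field.
  replace (4 * kapp / 4) with kapp by field; reflexivity.
Qed.

Lemma partial_H10_difference j p y : 0 < sq p y ->
  partial j (fun p => H10 (ks mu rho omega * dist2 p y)
    - H10 (kp lam mu rho omega * dist2 p y))%C p =
  (2 * co (sub2 p y) j * Jd 1 (sq p y), 2 * co (sub2 p y) j * Yd 1 (sq p y)).
Proof.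
  intros Hs; apply partial_eq with (fun p => Jd 0 (sq p y)) (fun p => Yd 0 (sq p y)) y; auto.
  - intros q Hq; apply H10_difference, Hq.
  - apply (is_derive_radial (Jd 0)), is_derive_Jd; lia.
  - apply (is_derive_radial (Yd 0)), is_derive_Yd; auto; lia.
Qed.

(** The prefactor i turns J + i Y into - Y + i J. Thus the singular part is real and the imaginary
    part is entire in s; since the logarithm in Y carries J / pi, the imaginary part governs the
    logarithm of the real one. *)
Lemma Gmat_eq p y i j : 0 < sq p y ->
  Gmat lam mu rho omega p y i j =
  (- / (4 * mu) * (delta i j * Yr kaps Cs 0 (sq p y) +
     / (4 * kaps) * hessian (sub2 p y) i j (Yd 1 (sq p y)) (Yd 2 (sq p y))),
   / (4 * mu) * (delta i j * Jr kaps 0 (sq p y) +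
     / (4 * kaps) * hessian (sub2 p y) i j (Jd 1 (sq p y)) (Jd 2 (sq p y)))).
Proof.
  intros Hs; unfold Gmat; rewrite H10_dist2, ks_sq by (auto; apply ks_pos).
  replace (4 * kaps / 4) with kaps by field; fold Cs.
  rewrite (partial_eq i _ (fun p => 2 * co (sub2 p y) j * Jd 1 (sq p y))
    (fun p => 2 * co (sub2 p y) j * Yd 1 (sq p y)) p y
    (hessian (sub2 p y) i j (Jd 1 (sq p y)) (Jd 2 (sq p y)))
    (hessian (sub2 p y) i j (Yd 1 (sq p y)) (Yd 2 (sq p y)))); auto.
  - assert (Hk := kaps_pos); apply injective_projections; simpl; field; lra.
  - intros q Hq; apply partial_H10_difference, Hq.
  - apply is_derive_grad, is_derive_Jd; lia.
  - apply is_derive_grad, is_derive_Yd; auto; lia.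
Qed.

(** The derivative in direction k of the entry (i, j). The column index comes before the others so
    that [dG_re r j] is the gradient of column j in the form that [trac] takes. *)
Definition dG_re (r : R2) (j k i : ix) : R :=
  - / (4 * mu) * (delta i j * (2 * co r k * Yr kaps Cs 1 (dot r r)) +
     / (4 * kaps) * third r k i j (Yd 2 (dot r r)) (Yd 3 (dot r r))).

Definition dG_im (r : R2) (j k i : ix) : R :=
  / (4 * mu) * (delta i j * (2 * co r k * Jr kaps 1 (dot r r)) +
     / (4 * kaps) * third r k i j (Jd 2 (dot r r)) (Jd 3 (dot r r))).

Lemma partial_Gmat x y k i j : 0 < sq x y ->
  partial k (fun p => Gmat lam mu rho omega p y i j) x =
  (dG_re (sub2 x y) j k i, dG_im (sub2 x y) j k i).
Proof.
  intros Hs; eapply partial_eq; [exact Hs | intros p Hp; apply Gmat_eq, Hp | |];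
    apply is_derive_scal, (is_derive_plus (V := R_NormedModule)).
  - apply is_derive_scal, (is_derive_radial (Yr kaps Cs 0)), is_derive_Yr; auto; lia.
  - apply is_derive_scal, (is_derive_hessian (Yd 1) (Yd 2)); apply is_derive_Yd; auto; lia.
  - apply is_derive_scal, (is_derive_radial (Jr kaps 0)), is_derive_Jr; lia.
  - apply is_derive_scal, (is_derive_hessian (Jd 1) (Jd 2)); apply is_derive_Jd; lia.
Qed.

Definition dE (r : R2) (j k i : ix) : R :=
  / (4 * PI * mu * (lam + 2 * mu)) *
  (- (lam + 3 * mu) * (co r k * delta i j) / dot r r
   + (lam + mu) * ((delta k i * co r j + delta k j * co r i) / dot r r
                   - 2 * (co r i * co r j * co r k) / dot r r ^ 2)).

Lemma Emat_eq p y i j : 0 < sq p y ->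
  Emat lam mu p y i j =
  (/ (4 * PI * mu * (lam + 2 * mu)) * (- (lam + 3 * mu) * delta i j * (ln (sq p y) / 2)
     + (lam + mu) * (co (sub2 p y) i * co (sub2 p y) j * / sq p y)), 0).
Proof.
  intros Hs; assert (HPI := PI_RGT_0).
  assert (Hd : 0 < dist2 p y) by (rewrite dist2_sq; apply sqrt_lt_R0, Hs).
  unfold Emat, RtoC; f_equal.
  assert (E : dist2 p y ^ 2 = sq p y) by (rewrite dist2_sq; apply pow2_sqrt; lra).
  replace (ln (sq p y)) with (2 * ln (dist2 p y)).
  - rewrite E; field; repeat split; lra.
  - rewrite <- E; simpl; rewrite Rmult_1_r, ln_mult by lra; ring.
Qed.

Lemma partial_Emat x y k i j : 0 < sq x y ->
  partial k (fun p => Emat lam mu p y i j) x = (dE (sub2 x y) j k i, 0).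
Proof.
  intros Hs; assert (HPI := PI_RGT_0).
  eapply partial_eq; [exact Hs | intros p Hp; apply Emat_eq, Hp | |
    exact (is_derive_const (K := R_AbsRing) (V := R_NormedModule) 0 (co x k))].
  eapply is_derive_val.
  - apply is_derive_scal, (is_derive_plus (V := R_NormedModule)).
    + apply is_derive_scal, (is_derive_radial (fun s => ln s / 2) k x y (/ (2 * sq x y))).
      auto_derive; [exact Hs | field; lra].
    + apply is_derive_scal, (is_derive_mult
        (fun t => co (sub2 (upd k x t) y) i * co (sub2 (upd k x t) y) j)
        (fun t => / sq (upd k x t) y)); [| | exact Rmult_comm].
      * apply (is_derive_mult (fun t => co (sub2 (upd k x t) y) i)
          (fun t => co (sub2 (upd k x t) y) j)); [| | exact Rmult_comm]; apply is_derive_co_upd.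
      * apply (is_derive_radial (fun s => / s) k x y (- / sq x y ^ 2)).
        auto_derive; [lra | field; lra].
  - unfold plus, mult; simpl; unfold mult; simpl; rewrite upd_co; unfold dE; fold (sq x y).
    field; repeat split; lra.
Qed.

(** * Separation of poles and logarithm *)

Definition Jd_tail (j : nat) (s : R) : R :=
  kaps ^ (2 + j) * J0_tail j (kaps * s) - kapp ^ (2 + j) * J0_tail j (kapp * s).

Definition Ys_1_rest (s : R) : R :=
  (kaps ^ 2 * s * J0_tail 0 (kaps * s) - kaps + Cs * Jr kaps 1 s) / PI
  - 2 / PI * (kaps * Y0_series 1 (kaps * s)).

Definition Yd_2_rest (s : R) : R :=
  (3 * Jd_tail 0 s + 2 * s * Jd_tail 1 s + Cs * Jr kaps 2 s - Cp * Jr kapp 2 s) / PI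
  - 2 / PI * (kaps ^ 2 * Y0_series 2 (kaps * s) - kapp ^ 2 * Y0_series 2 (kapp * s)).

Definition Yd_3_rest (s : R) : R :=
  (9 * Jd_tail 1 s + 3 * s * Jd_tail 2 s + Cs * Jr kaps 3 s - Cp * Jr kapp 3 s) / PI
  - 2 / PI * (kaps ^ 3 * Y0_series 3 (kaps * s) - kapp ^ 3 * Y0_series 3 (kapp * s)).

Lemma Yr_1_split s : 0 < s -> Yr kaps Cs 1 s = (/ s + ln s * Jr kaps 1 s) / PI + Ys_1_rest s.
Proof.
  intros Hs; assert (HPI := PI_RGT_0); unfold Yr, Ys_1_rest; simpl (Jr kaps 0 s).
  generalize (Jr kaps 1 s); intros; field; lra.
Qed.

(** In the difference the constant terms of the two J0 cancel: [Jd 0 s] is c s + s^2 [Jd_tail 0 s]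
    with c = kapp - kaps. Hence the double pole of a single Y0 disappears, and the simple poles - c
    / s and 2 c / s add up to c / s. *)
Lemma Yd_2_split s : 0 < s ->
  Yd 2 s = ((kapp - kaps) / s + ln s * Jd 2 s) / PI + Yd_2_rest s.
Proof.
  intros Hs; assert (HPI := PI_RGT_0); unfold Yd, Jd, Yr, Yd_2_rest, Jd_tail.
  generalize (Jr kaps 2 s) (Jr kapp 2 s); unfold Jr; intros.
  generalize (J0_tail 0 (kaps * s)) (J0_tail 1 (kaps * s)) (J0_tail 0 (kapp * s))
    (J0_tail 1 (kapp * s)).
  generalize (Y0_series 2 (kaps * s)) (Y0_series 2 (kapp * s)) (ln s) Cs Cp kaps kapp.
  simpl; intros; field; lra.
Qed.

(** The part c s of [Jd 0] contributes (2 - 3) c / s^2. The part s^2 [Jd_tail 0] contributes the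
    coefficient 2 - 3 * 2 + 3 * 2 = 2 of [Jd_tail 0 s / s], the pole that no term of the static
    kernel matches. *)
Lemma Yd_3_split s : 0 < s ->
  Yd 3 s = (- (kapp - kaps) / s ^ 2 + 2 * Jd_tail 0 s / s + ln s * Jd 3 s) / PI + Yd_3_rest s.
Proof.
  intros Hs; assert (HPI := PI_RGT_0); unfold Yd, Jd, Yr, Yd_3_rest, Jd_tail.
  generalize (Jr kaps 3 s) (Jr kapp 3 s); unfold Jr; intros.
  generalize (J0_tail 0 (kaps * s)) (J0_tail 1 (kaps * s)) (J0_tail 2 (kaps * s)).
  generalize (J0_tail 0 (kapp * s)) (J0_tail 1 (kapp * s)) (J0_tail 2 (kapp * s)).
  generalize (Y0_series 3 (kaps * s)) (Y0_series 3 (kapp * s)) (ln s) Cs Cp kaps kapp.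
  simpl; intros; field; lra.
Qed.

Definition dR_re (r : R2) (j k i : ix) : R :=
  - / (4 * mu) * (delta i j * (2 * co r k * Ys_1_rest (dot r r)) +
     / (4 * kaps) * third r k i j (Yd_2_rest (dot r r)) (Yd_3_rest (dot r r))).

(** The poles with constant coefficients assemble into [dE] by the ratio of [kapp] to [kaps], and
    the factors of ln s into [dG_im]. The remaining pole 2 [Jd_tail 0] / (pi s) meets 8 r_i r_j r_k,
    and 1 / (4 mu) * 1 / (4 kaps) * 8 * 2 / pi = 1 / (pi mu kaps). *)
Lemma dG_re_split r j k i : 0 < dot r r ->
  dG_re r j k i =
  dE r j k i + ln (dot r r) / 2 * (- (2 / PI) * dG_im r j k i)
  + (dR_re r j k i
     + - / (PI * mu * kaps) * Jd_tail 0 (dot r r) * (co r i * co r j * co r k / dot r r)).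
Proof.
  intros Hs; assert (HPI := PI_RGT_0); assert (Hk := kaps_pos).
  unfold dG_re, dG_im, dR_re; rewrite Yr_1_split, Yd_2_split, Yd_3_split by auto.
  generalize (Ys_1_rest (dot r r)) (Yd_2_rest (dot r r)) (Yd_3_rest (dot r r))
    (Jd_tail 0 (dot r r)) (Jr kaps 1 (dot r r))
    (Jd 2 (dot r r)) (Jd 3 (dot r r)).
  intros n1 n2 n3 e0 q1 q2 q3; unfold dE, third; rewrite kapp_kaps.
  revert Hk Hs; generalize (dot r r) kaps; intros s kap Hk Hs.
  field; repeat split; lra.
Qed.

Definition kernel_F (n r : R2) (i j : ix) : R :=
  - (2 / PI) * trac lam mu n (dG_im r j) i.

(* The real part of the remainder; its last term is the only one that is not a
   regular function of [r] across [r = 0] (where it is [0], since [/ 0 = 0]). *)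
Definition kernel_R (n r : R2) (i j : ix) : R :=
  trac lam mu n (dR_re r j) i
  + - / (PI * mu * kaps) * Jd_tail 0 (dot r r) *
    (2 * mu * (dot n r * (co r i * co r j / dot r r)) + lam * (co n i * co r j)).

Lemma trac_ext n d d' i : (forall k l, d k l = d' k l) -> trac lam mu n d i = trac lam mu n d' i.
Proof. intros H; unfold trac; rewrite !H; reflexivity. Qed.

(** The traction of the array r_i r_j r_k / s has no curl part, by symmetry in i and k. Its
    divergence part loses the denominator, as r_k r_k = s, and becomes lam n_i r_j; only the normal
    derivative keeps the quotient, with the factor n.r. *)
Lemma trac_dG_re n r i j : 0 < dot r r ->
  trac lam mu n (dG_re r j) i =
  trac lam mu n (dE r j) i + ln (dot r r) / 2 * kernel_F n r i j + kernel_R n r i j.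
Proof.
  intros Hs; rewrite (trac_ext n _ _ i (fun k l => dG_re_split r j k l Hs)).
  unfold kernel_F, kernel_R.
  generalize (- / (PI * mu * kaps) * Jd_tail 0 (dot r r)) (ln (dot r r) / 2) (- (2 / PI)).
  intros c l p; unfold trac.
  generalize (dE r j i1 i1) (dE r j i1 i2) (dE r j i2 i1) (dE r j i2 i2).
  generalize (dG_im r j i1 i1) (dG_im r j i1 i2) (dG_im r j i2 i1) (dG_im r j i2 i2).
  generalize (dR_re r j i1 i1) (dR_re r j i1 i2) (dR_re r j i2 i1) (dR_re r j i2 i2).
  revert Hs; unfold dot; destruct r as [r1 r2], n as [n1 n2]; simpl; intros Hs.
  destruct i, j; simpl; intros; field; lra.
Qed.

Lemma trac_dE n r i j : 0 < dot r r ->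
  trac lam mu n (dE r j) i =
  - (dot n r / (2 * PI * len r ^ 2)) * delta i j
  + mu / (lam + 2 * mu) * (dot (tangent n) r / (2 * PI * len r ^ 2)) * Lmat i j
  + (lam + mu) / (lam + 2 * mu) *
    (- (dot n r * (co r i * co r j) / (PI * len r ^ 4))
     + dot n r / (2 * PI * len r ^ 2) * delta i j).
Proof.
  intros Hs; assert (HPI := PI_RGT_0).
  replace (len r ^ 4) with ((len r ^ 2) ^ 2) by ring.
  replace (len r ^ 2) with (dot r r) by (unfold len; rewrite pow2_sqrt; lra).
  revert Hs; unfold trac, dE, dot, tangent; destruct r as [r1 r2], n as [n1 n2]; simpl; intros Hs.
  destruct i, j; simpl; field; repeat split; lra.
Qed.

Lemma traction_Gmat n x y i j : x <> y ->
  traction_x lam mu n (Gmat lam mu rho omega) x y i j =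
  (trac lam mu (n x) (dG_re (sub2 x y) j) i, trac lam mu (n x) (dG_im (sub2 x y) j) i).
Proof.
  intros Hxy; apply (traction_eq lam mu (n x) (fun p k => Gmat lam mu rho omega p y k j)).
  intros k l; apply partial_Gmat, sq_pos, Hxy.
Qed.

Lemma traction_Emat n x y i j : x <> y ->
  traction_x lam mu n (Emat lam mu) x y i j = RtoC (trac lam mu (n x) (dE (sub2 x y) j) i).
Proof.
  intros Hxy; unfold traction_x.
  rewrite (traction_eq lam mu (n x) (fun p k => Emat lam mu p y k j) x
    (dE (sub2 x y) j) (fun _ _ => 0)) by (intros; apply partial_Emat, sq_pos, Hxy).
  unfold RtoC; f_equal; unfold trac; ring.
Qed.

Lemma ln_len r : 0 < dot r r -> ln (len r) = ln (dot r r) / 2.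
Proof.
  intros Hs; assert (Hd : 0 < len r) by (apply sqrt_lt_R0, Hs).
  replace (dot r r) with (len r * len r) by (apply sqrt_sqrt; lra).
  rewrite ln_mult by auto; field.
Qed.

(** The static kernel and the logarithmic term are real, so the whole imaginary part of the traction
    of G belongs to the remainder. *)
Definition remainder (n r : R2) (i j : ix) : C :=
  (kernel_R n r i j, trac lam mu n (dG_im r j) i).

Lemma traction_decomposition n x y i j : x <> y ->
  let r := sub2 x y in
  let TG := traction_x lam mu n (Gmat lam mu rho omega) x y i j in
  TG = (traction_x lam mu n (Emat lam mu) x y i j
        + RtoC (ln (len r)) * RtoC (kernel_F (n x) r i j) + remainder (n x) r i j)%C /\
  kernel_F (n x) r i j = - (2 / PI) * Im TG.
Proof.
  intros Hxy r TG; unfold TG; rewrite traction_Gmat, traction_Emat by auto.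
  split; [| reflexivity].
  fold r; assert (Hs : 0 < dot r r) by apply (sq_pos x y Hxy).
  rewrite trac_dG_re, ln_len by auto; unfold remainder.
  apply injective_projections; simpl; ring.
Qed.

End Kernel.

(** * Regularity of the kernels in terms of normal and chord *)

Lemma regular_J0_tail an j f t0 s0 : regular an f t0 s0 ->
  regular an (fun t s => J0_tail j (f t s)) t0 s0.
Proof.
  apply (regular_PSeries_derivative an (PS_decr_n J0_coef 2) j).
  apply rapidly_decreasing_decr, J0_coef_decreasing.
Qed.

Lemma regular_Y0_series an j f t0 s0 : regular an f t0 s0 ->
  regular an (fun t s => Y0_series j (f t s)) t0 s0.
Proof. apply (regular_PSeries_derivative an Y0_coef j), Y0_coef_decreasing. Qed.

Lemma regular_div_const an f c t0 s0 : regular an f t0 s0 -> regular an (fun t s => f t s / c)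
  t0 s0.
Proof. intros H; apply regular_mult; [exact H | apply regular_const]. Qed.

Ltac regularity :=
  lazymatch goal with
  | |- regular _ (fun _ _ => ?c) _ _ => apply regular_const
  | |- regular _ (fun t s => @?f t s + @?g t s) _ _ => apply (regular_plus _ f g); regularity
  | |- regular _ (fun t s => @?f t s - @?g t s) _ _ => apply (regular_minus _ f g); regularity
  | |- regular _ (fun t s => - @?f t s) _ _ => apply (regular_opp _ f); regularity
  | |- regular _ (fun t s => @?f t s * @?g t s) _ _ => apply (regular_mult _ f g); regularity
  | |- regular _ (fun t s => @?f t s / ?c) _ _ => apply (regular_div_const _ f); regularity
  | |- regular _ (fun t s => @?f t s ^ _) _ _ => apply (regular_pow _ f); regularity
  | |- regular _ (fun t s => J0_tail _ (@?f t s)) _ _ => apply (regular_J0_tail _ _ f); regularity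
  | |- regular _ (fun t s => Y0_series _ (@?f t s)) _ _ => apply (regular_Y0_series _ _ f);
    regularity
  | _ => auto
  end.

Section KernelRegularity.
Variables (an : Prop) (n1 n2 r1 r2 : R -> R -> R) (t0 s0 : R).
Hypothesis Hn1 : regular an n1 t0 s0.
Hypothesis Hn2 : regular an n2 t0 s0.
Hypothesis Hr1 : regular an r1 t0 s0.
Hypothesis Hr2 : regular an r2 t0 s0.

Let n t s : R2 := (n1 t s, n2 t s).
Let r t s : R2 := (r1 t s, r2 t s).

Lemma regular_co_n i : regular an (fun t s => co (n t s) i) t0 s0.
Proof. destruct i; [exact Hn1 | exact Hn2]. Qed.

Lemma regular_co_r i : regular an (fun t s => co (r t s) i) t0 s0.
Proof. destruct i; [exact Hr1 | exact Hr2]. Qed.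

Lemma regular_tangent i : regular an (fun t s => co (tangent (n t s)) i) t0 s0.
Proof. destruct i; simpl; [apply regular_opp; exact Hn2 | exact Hn1]. Qed.

Lemma regular_dot_r : regular an (fun t s => dot (r t s) (r t s)) t0 s0.
Proof. unfold dot; simpl; regularity. Qed.

Lemma regular_Jr kap j : regular an (fun t s => Jr kap j (dot (r t s) (r t s))) t0 s0.
Proof. assert (H := regular_dot_r); destruct j as [|[|[|j]]]; unfold Jr; regularity. Qed.

Lemma regular_trac lam mu (d : R -> R -> ix -> ix -> R) i :
  (forall k l, regular an (fun t s => d t s k l) t0 s0) ->
  regular an (fun t s => trac lam mu (n t s) (d t s) i) t0 s0.
Proof.
  intros H; assert (H1 := regular_co_n); assert (H2 := regular_tangent).
  unfold trac; regularity.
Qed.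

Lemma regular_third k i j (f g : R -> R -> R) :
  regular an f t0 s0 -> regular an g t0 s0 ->
  regular an (fun t s => third (r t s) k i j (f t s) (g t s)) t0 s0.
Proof.
  intros Hf Hg; assert (H := regular_co_r); unfold third; regularity.
Qed.

Variables lam mu rho omega : R.

Lemma regular_dG_im j k i :
  regular an (fun t s => dG_im lam mu rho omega (r t s) j k i) t0 s0.
Proof.
  assert (H := regular_co_r); assert (HJ := regular_Jr); unfold dG_im.
  regularity; apply regular_third; unfold Jd; regularity.
Qed.

Lemma regular_kernel_F i j :
  regular an (fun t s => kernel_F lam mu rho omega (n t s) (r t s) i j) t0 s0.
Proof.
  unfold kernel_F; apply regular_mult; [apply regular_const |].
  apply regular_trac; intros; apply regular_dG_im.
Qed.

Lemma regular_Jd_tail j :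
  regular an (fun t s => Jd_tail lam mu rho omega j (dot (r t s) (r t s))) t0 s0.
Proof. assert (H := regular_dot_r); unfold Jd_tail; regularity. Qed.

Lemma regular_dR_re j k i :
  regular an (fun t s => dR_re lam mu rho omega (r t s) j k i) t0 s0.
Proof.
  assert (H := regular_co_r); assert (H' := regular_dot_r); assert (HJ := regular_Jr).
  assert (HE := regular_Jd_tail); unfold dR_re; regularity; [unfold Ys_1_rest; regularity |].
  apply regular_third; unfold Yd_2_rest, Yd_3_rest; regularity.
Qed.

Lemma regular_kernel_R i j :
  regular an (fun t s => dot (n t s) (r t s) *
    (co (r t s) i * co (r t s) j / dot (r t s) (r t s))) t0 s0 ->
  regular an (fun t s => kernel_R lam mu rho omega (n t s) (r t s) i j) t0 s0.
Proof.
  intros Hq; assert (H := regular_co_r); assert (H' := regular_co_n); assert (HE :=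
    regular_Jd_tail).
  unfold kernel_R; apply regular_plus; [apply regular_trac; intros; apply regular_dR_re |].
  apply regular_mult; [regularity |]; apply regular_plus; [apply regular_mult; [regularity |
    exact Hq] | regularity].
Qed.

End KernelRegularity.

(** * Limit of the remainder at the diagonal *)

Section Vanishing.
Variables (T : Type) (F : (T -> Prop) -> Prop).
Context {FF : Filter F}.

(** Working along an arbitrary filter lets x approach y within the curve in any manner, and covers
    the case where y is a corner. *)
Definition bounded_along (f : T -> R) : Prop := exists M, F (fun x => Rabs (f x) <= M).
Definition vanishing (f : T -> R) : Prop := forall eps, 0 < eps -> F (fun x => Rabs (f x) < eps).

Lemma bounded_const c : bounded_along (fun _ => c).
Proof. exists (Rabs c); apply filter_forall; intros; lra. Qed.

Lemma bounded_vanishing f : vanishing f -> bounded_along f.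
Proof.
  intros H; exists 1; generalize (H 1 Rlt_0_1); apply filter_imp; intros; lra.
Qed.

Lemma bounded_plus f g : bounded_along f -> bounded_along g -> bounded_along (fun x => f x + g x).
Proof.
  intros [M HM] [M' HM']; exists (M + M'); generalize (filter_and _ _ HM HM').
  apply filter_imp; intros x [H1 H2]; eapply Rle_trans; [apply Rabs_triang | lra].
Qed.

Lemma bounded_mult f g : bounded_along f -> bounded_along g -> bounded_along (fun x => f x * g x).
Proof.
  intros [M HM] [M' HM']; exists (M * M'); generalize (filter_and _ _ HM HM').
  apply filter_imp; intros x [H1 H2]; rewrite Rabs_mult.
  apply Rmult_le_compat; auto; apply Rabs_pos.
Qed.

Lemma bounded_opp f : bounded_along f -> bounded_along (fun x => - f x).
Proof.
  intros [M HM]; exists M; generalize HM; apply filter_imp; intros x; rewrite Rabs_Ropp; auto.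
Qed.

Lemma bounded_minus f g : bounded_along f -> bounded_along g -> bounded_along (fun x => f x - g x).
Proof. intros; apply bounded_plus; [| apply bounded_opp]; auto. Qed.

Lemma bounded_div_const f c : bounded_along f -> bounded_along (fun x => f x / c).
Proof. intros; apply bounded_mult; [auto | apply bounded_const]. Qed.

Lemma bounded_pow f k : bounded_along f -> bounded_along (fun x => f x ^ k).
Proof.
  intros; induction k as [|k IH]; simpl; [apply bounded_const | apply bounded_mult; auto].
Qed.

Lemma vanishing_plus f g : vanishing f -> vanishing g -> vanishing (fun x => f x + g x).
Proof.
  intros Hf Hg eps He; assert (He2 : 0 < eps / 2) by lra.
  generalize (filter_and _ _ (Hf _ He2) (Hg _ He2)).
  apply filter_imp; intros x [H1 H2]; eapply Rle_lt_trans; [apply Rabs_triang | lra].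
Qed.

Lemma vanishing_opp f : vanishing f -> vanishing (fun x => - f x).
Proof.
  intros Hf eps He; generalize (Hf eps He); apply filter_imp; intros x; rewrite Rabs_Ropp; auto.
Qed.

Lemma vanishing_minus f g : vanishing f -> vanishing g -> vanishing (fun x => f x - g x).
Proof. intros; apply vanishing_plus; [| apply vanishing_opp]; auto. Qed.

Lemma vanishing_mult_l f g : vanishing f -> bounded_along g -> vanishing (fun x => f x * g x).
Proof.
  intros Hf [M HM] eps He; assert (Ha := Rabs_pos M).
  assert (He2 : 0 < eps / (Rabs M + 1)) by (apply Rdiv_lt_0_compat; lra).
  generalize (filter_and _ _ (Hf _ He2) HM); apply filter_imp; intros x [H1 H2].
  rewrite Rabs_mult; apply Rle_lt_trans with (Rabs (f x) * (Rabs M + 1)).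
  - apply Rmult_le_compat_l; [apply Rabs_pos |]; assert (H := Rle_abs M); lra.
  - replace eps with (eps / (Rabs M + 1) * (Rabs M + 1)) by (field; lra).
    apply Rmult_lt_compat_r; lra.
Qed.

Lemma vanishing_mult_r f g : bounded_along f -> vanishing g -> vanishing (fun x => f x * g x).
Proof.
  intros Hf Hg eps He; generalize (vanishing_mult_l g f Hg Hf eps He); apply filter_imp.
  intros x; rewrite Rmult_comm; auto.
Qed.

Lemma bounded_comp (g : R -> R) f :
  continuity_pt g 0 -> vanishing f -> bounded_along (fun x => g (f x)).
Proof.
  intros Hg Hf; destruct (proj1 (continuity_pt_locally g 0) Hg (mkposreal 1 Rlt_0_1)) as [e He].
  exists (Rabs (g 0) + 1); generalize (Hf e (cond_pos e)); apply filter_imp; intros x Hx.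
  assert (H : Rabs (g (f x) - g 0) < 1).
  { apply He; change (Rabs (f x - 0) < e); rewrite Rminus_0_r; exact Hx. }
  replace (g (f x)) with ((g (f x) - g 0) + g 0) by ring.
  eapply Rle_trans; [apply Rabs_triang | lra].
Qed.

Variables (nn rr : T -> R2).
Hypothesis Hn : forall i, bounded_along (fun x => co (nn x) i).
Hypothesis Hr : forall i, vanishing (fun x => co (rr x) i).

Lemma vanishing_dot_r : vanishing (fun x => dot (rr x) (rr x)).
Proof.
  apply vanishing_plus; apply vanishing_mult_l; try apply bounded_vanishing;
    (exact (Hr i1) || exact (Hr i2)).
Qed.

Lemma bounded_J0_tail j kap : bounded_along (fun x => J0_tail j (kap * dot (rr x) (rr x))).
Proof.
  apply (bounded_comp (J0_tail j)).
  - apply continuity_pt_filterlim, (ex_derive_continuous (J0_tail j)); eexists;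
    apply is_derive_J0_tail.
  - apply vanishing_mult_r; [apply bounded_const | apply vanishing_dot_r].
Qed.

Lemma bounded_Y0_series j kap : bounded_along (fun x => Y0_series j (kap * dot (rr x) (rr x))).
Proof.
  apply (bounded_comp (Y0_series j)).
  - apply continuity_pt_filterlim, (ex_derive_continuous (Y0_series j)); eexists;
    apply is_derive_Y0_series.
  - apply vanishing_mult_r; [apply bounded_const | apply vanishing_dot_r].
Qed.

Lemma bounded_dot_r : bounded_along (fun x => dot (rr x) (rr x)).
Proof. apply bounded_vanishing, vanishing_dot_r. Qed.

Ltac boundedness :=
  lazymatch goal with
  | |- bounded_along (fun _ => ?c) => apply bounded_const
  | |- bounded_along (fun x => @?f x + @?g x) => apply (bounded_plus f g); boundedness
  | |- bounded_along (fun x => @?f x - @?g x) => apply (bounded_minus f g); boundedness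
  | |- bounded_along (fun x => - @?f x) => apply (bounded_opp f); boundedness
  | |- bounded_along (fun x => @?f x * @?g x) => apply (bounded_mult f g); boundedness
  | |- bounded_along (fun x => @?f x / ?c) => apply (bounded_div_const f); boundedness
  | |- bounded_along (fun x => @?f x ^ _) => apply (bounded_pow f); boundedness
  | |- bounded_along (fun x => J0_tail _ _) => apply bounded_J0_tail
  | |- bounded_along (fun x => Y0_series _ _) => apply bounded_Y0_series
  | |- bounded_along (fun x => dot (rr x) (rr x)) => apply bounded_dot_r
  | _ => auto
  end.

Lemma bounded_Jr kap j : bounded_along (fun x => Jr kap j (dot (rr x) (rr x))).
Proof.
  destruct j as [|[|[|j]]]; unfold Jr; boundedness.
Qed.

Lemma vanishing_third k i j f g :
  bounded_along f -> bounded_along g -> vanishing (fun x => third (rr x) k i j (f x) (g x)).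
Proof.
  intros Hf Hg; assert (Hb := fun i => bounded_vanishing _ (Hr i)).
  assert (Hc := bounded_const); unfold third; apply vanishing_plus; apply vanishing_mult_l; auto.
  - apply vanishing_mult_r; auto.
    repeat apply vanishing_plus; apply vanishing_mult_r; auto.
  - apply vanishing_mult_r; auto.
    apply vanishing_mult_l; auto; apply vanishing_mult_l; auto.
Qed.

Lemma vanishing_trac lam mu (d : T -> ix -> ix -> R) i :
  (forall k l, vanishing (fun x => d x k l)) ->
  vanishing (fun x => trac lam mu (nn x) (d x) i).
Proof.
  intros H; assert (Hc := bounded_const).
  assert (Ht : bounded_along (fun x => co (tangent (nn x)) i))
    by (destruct i; simpl; [apply bounded_opp; exact (Hn i2) | exact (Hn i1)]).
  unfold trac; apply vanishing_minus; [apply vanishing_plus |].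
  - apply vanishing_mult_r; auto; apply vanishing_plus; apply vanishing_mult_r; auto.
  - apply vanishing_mult_l; auto; apply vanishing_mult_r; auto; apply vanishing_plus; auto.
  - apply vanishing_mult_r; [boundedness | apply vanishing_minus; auto].
Qed.

Variables lam mu rho omega : R.

Lemma bounded_Jd_tail j : bounded_along (fun x => Jd_tail lam mu rho omega j (dot (rr x) (rr x))).
Proof. unfold Jd_tail; boundedness. Qed.

Lemma vanishing_dG_im j k i : vanishing (fun x => dG_im lam mu rho omega (rr x) j k i).
Proof.
  unfold dG_im; apply vanishing_mult_r; [boundedness |]; apply vanishing_plus.
  - apply vanishing_mult_r; [boundedness |]; apply vanishing_mult_l; [| apply bounded_Jr].
    apply vanishing_mult_r; [boundedness | apply Hr].
  - apply vanishing_mult_r; [boundedness |]; unfold Jd.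
    apply vanishing_third; apply bounded_minus; apply bounded_Jr.
Qed.

Lemma vanishing_dR_re j k i : vanishing (fun x => dR_re lam mu rho omega (rr x) j k i).
Proof.
  assert (HJ := bounded_Jr); assert (HE := bounded_Jd_tail).
  unfold dR_re; apply vanishing_mult_r; [boundedness |]; apply vanishing_plus.
  - apply vanishing_mult_r; [boundedness |]; apply vanishing_mult_l.
    + apply vanishing_mult_r; [boundedness | apply Hr].
    + unfold Ys_1_rest; boundedness.
  - apply vanishing_mult_r; [boundedness |]; apply vanishing_third; unfold Yd_2_rest, Yd_3_rest;
    boundedness.
Qed.

Lemma co_product_over_dot (r : R2) i j : Rabs (co r i * co r j / dot r r) <= 1.
Proof.
  destruct r as [x y]; unfold dot; simpl.
  destruct (Req_dec (x * x + y * y) 0) as [-> | H].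
  - unfold Rdiv; rewrite Rinv_0, Rmult_0_r, Rabs_R0; lra.
  - assert (Hp : 0 < x * x + y * y) by nra.
    unfold Rdiv; rewrite Rabs_mult, (Rabs_pos_eq (/ _)) by (left; apply Rinv_0_lt_compat, Hp).
    apply (Rmult_le_reg_r (x * x + y * y)); auto; rewrite Rmult_assoc, Rinv_l by auto.
    rewrite Rmult_1_l, Rmult_1_r; apply Rabs_le; destruct i, j; simpl; split; nra.
Qed.

(** In the singular term n.r tends to 0 while r_i r_j / |r|^2 stays bounded by 1, whatever the
    direction of r; all the other terms carry a component of r as a factor. *)
Lemma vanishing_kernel_R i j : vanishing (fun x => kernel_R lam mu rho omega (nn x) (rr x) i j).
Proof.
  assert (Hb := fun i => bounded_vanishing _ (Hr i)).
  unfold kernel_R; apply vanishing_plus; [apply vanishing_trac; intros; apply vanishing_dR_re |].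
  apply vanishing_mult_r; [apply bounded_mult; [boundedness | apply bounded_Jd_tail] |].
  apply vanishing_plus; (apply vanishing_mult_r; [boundedness |]).
  - apply vanishing_mult_l.
    + unfold dot; apply vanishing_plus; apply vanishing_mult_r;
        [exact (Hn i1) | exact (Hr i1) | exact (Hn i2) | exact (Hr i2)].
    + exists 1; apply filter_forall; intros x; apply co_product_over_dot.
  - apply vanishing_mult_r; auto.
Qed.

End Vanishing.

(** * Parametrizations of the curve *)

Lemma dist2_lt x y eps :
  Rabs (fst x - fst y) < eps / 2 -> Rabs (snd x - snd y) < eps / 2 -> dist2 x y < eps.
Proof.
  intros H1 H2; assert (P1 := Rabs_pos (fst x - fst y)); assert (P2 := Rabs_pos (snd x - snd y)).
  apply Rle_lt_trans with (Rabs (fst x - fst y) + Rabs (snd x - snd y)); [| lra].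
  unfold dist2, len, dot, sub2; simpl.
  rewrite <- (sqrt_Rsqr (Rabs (fst x - fst y) + Rabs (snd x - snd y))) by lra.
  apply sqrt_le_1_alt; change (?u * ?u) with (Rsqr u).
  rewrite (Rsqr_abs (fst x - fst y)), (Rsqr_abs (snd x - snd y)); unfold Rsqr.
  assert (H := Rmult_le_pos _ _ P1 P2); lra.
Qed.

Lemma Rabs_co_le_len x i : Rabs (co x i) <= len x.
Proof.
  rewrite <- sqrt_Rsqr_abs; apply sqrt_le_1_alt; unfold Rsqr, dot; destruct i; simpl; nra.
Qed.

Lemma sub2_co x y i : co (sub2 x y) i = co x i - co y i.
Proof. destruct i; reflexivity. Qed.

Lemma Rabs_co_sub_le x y i : Rabs (co x i - co y i) <= dist2 x y.
Proof. rewrite <- sub2_co; apply Rabs_co_le_len. Qed.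

Definition coord (z : R -> R2) (i : ix) (t : R) : R := co (z t) i.

Lemma smooth_coord z a b i : regular_smooth z a b -> smooth1 (coord z i) a b.
Proof. intros (H1 & H2 & _); destruct i; [exact H1 | exact H2]. Qed.

Lemma smooth_continuity g a b t : smooth1 g a b -> a < t < b -> continuity_pt g t.
Proof.
  intros H Ht; apply continuity_pt_filterlim, (ex_derive_continuous g), (H 1%nat t Ht).
Qed.

Lemma curve_near z a b t eps :
  regular_smooth z a b -> a < t < b -> 0 < eps ->
  exists d, 0 < d /\ forall u, ball1 t d u -> a < u < b /\ dist2 (z u) (z t) < eps.
Proof.
  intros Hz Ht He; assert (He2 : 0 < eps / 2) by lra.
  destruct (proj1 (continuity_pt_locally _ _)
    (smooth_continuity _ _ _ _ (smooth_coord z a b i1 Hz) Ht) (mkposreal _ He2)) as [d1 H1].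
  destruct (proj1 (continuity_pt_locally _ _)
    (smooth_continuity _ _ _ _ (smooth_coord z a b i2 Hz) Ht) (mkposreal _ He2)) as [d2 H2].
  set (e := Rmin (t - a) (b - t)); assert (K1 := Rmin_l (t - a) (b - t)).
  assert (K2 := Rmin_r (t - a) (b - t)); fold e in K1, K2.
  exists (Rmin e (Rmin d1 d2)); split.
  { unfold e; repeat apply Rmin_glb_lt; try lra; apply cond_pos. }
  intros u Hu; assert (K3 := Rmin_l e (Rmin d1 d2)); assert (K4 := Rmin_r e (Rmin d1 d2)).
  assert (K5 := Rmin_l d1 d2); assert (K6 := Rmin_r d1 d2); unfold ball1 in Hu.
  split; [apply Rabs_def2 in Hu; lra |].
  apply dist2_lt; [apply (H1 u) | apply (H2 u)];
    [change (Rabs (u - t) < d1) | change (Rabs (u - t) < d2)]; lra.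
Qed.

(** * The unit normal along a parametrization *)

Section Normal.
Variables (an : Prop) (Gamma : R2 -> Prop) (n : R2 -> R2) (z : R -> R2) (a b t0 : R).
Hypothesis Hn : unit_normal Gamma nil n.
Hypothesis Hz : local_param Gamma z a b.
Hypothesis Ht0 : a < t0 < b.
Hypothesis Han : forall i, regular1 an (coord z i) t0.

Let speed2 (t : R) : R := dot (velocity z t) (velocity z t).

Lemma regular_velocity i s0 : regular an (fun t _ => co (velocity z t) i) t0 s0.
Proof.
  apply regular_lift1; destruct i; [apply (regular1_derive an (coord z i1)) |
    apply (regular1_derive an (coord z i2))]; apply Han.
Qed.

Lemma speed2_pos t : a < t < b -> 0 < speed2 t.
Proof.
  intros Ht; destruct Hz as [(_ & _ & Hv) _]; specialize (Hv t Ht).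
  unfold speed2; revert Hv; destruct (velocity z t) as [x y]; unfold dot; simpl; intros Hv.
  destruct (Req_dec x 0) as [-> | H]; [| nra].
  destruct (Req_dec y 0) as [-> | H]; [contradiction Hv; reflexivity | nra].
Qed.

Let unit_ (i : ix) (t : R) : R := Rpower (speed2 t) (- / 2) * co (tangent (velocity z t)) i.

Lemma regular_unit i s0 : regular an (fun t _ => unit_ i t) t0 s0.
Proof.
  assert (H1 := regular_velocity i1 s0); assert (H2 := regular_velocity i2 s0); simpl in H1, H2.
  assert (Hs : regular an (fun t _ => speed2 t) t0 s0).
  { apply regular_plus; apply regular_mult; assumption. }
  apply regular_mult.
  - apply regular_Rpower; [lra | apply speed2_pos, Ht0 | exact Hs].
  - destruct i; [apply regular_opp; exact H2 | exact H1].
Qed.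

(** A unit vector orthogonal to the velocity is plus or minus the rotated unit velocity [unit_]. The
    sign s is its inner product with [unit_], and s^2 = 1 is Lagrange's identity (n.v)^2 + (n.v')^2
    = |n|^2 |v|^2, with v' the rotated velocity v and n.v = 0. *)
Lemma normal_eq t : a < t < b ->
  let s := co (n (z t)) i1 * unit_ i1 t + co (n (z t)) i2 * unit_ i2 t in
  (s = 1 \/ s = -1) /\ forall i, co (n (z t)) i = s * unit_ i t.
Proof.
  intros Ht; destruct Hn as (H1 & H2 & _).
  specialize (H2 z a b t Hz Ht (fun H => H)).
  specialize (H1 (z t) (proj1 (proj2 Hz) t Ht) (fun H => H)).
  assert (Hsp := speed2_pos t Ht).
  assert (H1' : dot (n (z t)) (n (z t)) = 1).
  { rewrite <- (pow2_sqrt (dot (n (z t)) (n (z t)))) by (unfold dot; nra).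
    change (len (n (z t)) ^ 2 = 1); rewrite H1; ring. }
  assert (Hw : Rpower (speed2 t) (- / 2) * Rpower (speed2 t) (- / 2) * speed2 t = 1).
  { rewrite <- Rpower_plus; replace (- / 2 + - / 2) with (- (1)) by field.
    rewrite Rpower_Ropp, Rpower_1 by auto; field; lra. }
  unfold unit_; revert H1' H2 Hw; unfold speed2; generalize (Rpower (dot (velocity z t)
    (velocity z t)) (- / 2)).
  destruct (n (z t)) as [p q], (velocity z t) as [x y]; unfold dot, tangent; simpl.
  intros w H1' H2 Hw.
  assert (Hsq : (p * (w * - y) + q * (w * x)) * (p * (w * - y) + q * (w * x)) = 1).
  { transitivity ((w * w * (x * x + y * y)) * (p * p + q * q) - w * w * ((p * x + q * y)
    * (p * x + q * y)));
      [ring | rewrite H2, Hw, H1'; ring]. }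
  split; [apply Rsqr_eq; unfold Rsqr; lra |].
  intros i; destruct i; simpl.
  - transitivity (p * (w * w * (x * x + y * y)) - w * w * x * (p * x + q * y));
      [rewrite H2, Hw; ring | ring].
  - transitivity (q * (w * w * (x * x + y * y)) - w * w * y * (p * x + q * y));
      [rewrite H2, Hw; ring | ring].
Qed.

Lemma normal_continuity i : continuity_pt (fun t => co (n (z t)) i) t0.
Proof.
  apply continuity_pt_locally; intros eps.
  destruct (proj2 (proj2 Hn) (z t0) (proj1 (proj2 Hz) t0 Ht0) (fun H => H) eps (cond_pos eps))
    as (d & Hd & Hnd).
  destruct (curve_near z a b t0 d (proj1 Hz) Ht0 Hd) as (e & He & Hze).
  exists (mkposreal e He); intros u Hu; destruct (Hze u Hu) as [Hu1 Hu2].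
  eapply Rle_lt_trans; [apply Rabs_co_sub_le |].
  apply Hnd; auto; apply (proj1 (proj2 Hz)), Hu1.
Qed.

(* The sign relating [n] to the rotated velocity is locally constant by continuity. *)
Lemma regular_normal i s0 : regular an (fun t _ => co (n (z t)) i) t0 s0.
Proof.
  set (sg := fun t => co (n (z t)) i1 * unit_ i1 t + co (n (z t)) i2 * unit_ i2 t).
  assert (Hc : continuity_pt sg t0).
  { apply continuity_pt_plus; apply continuity_pt_mult; try apply normal_continuity;
      apply regular1_continuous with an, (regular1_of_regular an _ t0 0), regular_unit. }
  destruct (proj1 (continuity_pt_locally _ _) Hc (mkposreal 1 Rlt_0_1)) as [e He].
  destruct (curve_near z a b t0 1 (proj1 Hz) Ht0 Rlt_0_1) as (d & Hd & Hzd).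
  apply regular_ext with (fun t _ => sg t0 * unit_ i t).
  - exists (Rmin d e); split; [apply Rmin_glb_lt; [auto | apply cond_pos] |].
    intros t s [Ht _].
    assert (Ht' : a < t < b) by (apply Hzd; eapply ball1_le; [apply Rmin_l | exact Ht]).
    destruct (normal_eq t Ht') as [S1 S2]; destruct (normal_eq t0 Ht0) as [S3 _].
    rewrite S2; f_equal; fold (sg t) in *; fold (sg t0) in *.
    assert (H : Rabs (sg t - sg t0) < 1).
    { apply (He t); change (Rabs (t - t0) < e).
      eapply Rlt_le_trans; [exact Ht | apply Rmin_r]. }
    apply Rabs_def2 in H; lra.
  - apply regular_mult; [apply regular_const | apply regular_unit].
Qed.

End Normal.

(** * Change of parametrization *)

Lemma curve_transition Gamma z a b t0 w c d s0 :
  local_param Gamma z a b -> local_param Gamma w c d -> a < t0 < b -> c < s0 < d ->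
  z t0 = w s0 ->
  exists phi e, 0 < e /\ phi t0 = s0 /\
    (forall t, ball1 t0 e t -> a < t < b /\ c < phi t < d /\ z t = w (phi t)) /\
    (forall t, ball1 t0 e t -> continuity_pt phi t).
Proof.
  intros Hz Hw Ht0 Hs0 E; destruct Hw as (Hw1 & Hw2 & Hw3 & Hw4).
  destruct (Hw4 s0 Hs0 1 Rlt_0_1) as (d0 & Hd0 & Hn0).
  destruct (curve_near z a b t0 d0 (proj1 Hz) Ht0 Hd0) as (e & He & Hze).
  (* A choice of parameter for the inverse of [w] composed with [z]: openness of [w] makes the
     choice possible near t0, injectivity of [w] makes it unique, and elsewhere the value is
     arbitrary. *)
  set (phi := fun t => epsilon (inhabits 0) (fun s => c < s < d /\ z t = w s)).
  assert (Hphi : forall t, ball1 t0 e t -> c < phi t < d /\ z t = w (phi t)).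
  { intros t Ht; apply (epsilon_spec (inhabits 0) (fun s => c < s < d /\ z t = w s)).
    destruct (Hze t Ht) as [Ht1 Ht2]; rewrite E in Ht2.
    destruct (Hn0 (z t) (proj1 (proj2 Hz) t Ht1) Ht2) as (s & Hs & _ & Hs'); exists s; auto. }
  exists phi, e; split; [auto |]; split; [| split].
  - destruct (Hphi t0 (ball1_center t0 e He)) as [H1 H2]; apply Hw3; auto; congruence.
  - intros t Ht; split; [apply Hze, Ht | apply Hphi, Ht].
  - intros t Ht; apply continuity_pt_locally; intros eta.
    destruct (Hphi t Ht) as [H1 H2].
    (* That [w] is an open map onto the curve is continuity of its inverse: points of the curve near
       w (phi t) have parameters within eta of phi t. *)
    destruct (Hw4 (phi t) H1 eta (cond_pos eta)) as (d1 & Hd1 & Hn1).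
    destruct (curve_near z a b t d1 (proj1 Hz) (proj1 (Hze t Ht)) Hd1) as (e1 & He1 & Hz1).
    generalize (filter_and _ _ (open_ball1 t0 e t Ht)
      (open_ball1 t e1 t (ball1_center t e1 He1))).
    apply filter_imp; intros u [Hu1 Hu2].
    destruct (Hz1 u Hu2) as [Hu3 Hu4]; rewrite H2 in Hu4.
    destruct (Hn1 (z u) (proj1 (proj2 Hz) u Hu3) Hu4) as (s & Hs1 & Hs2 & Hs3).
    destruct (Hphi u Hu1) as [H3 H4].
    replace (phi u) with s; [exact Hs2 | apply Hw3; auto; congruence].
Qed.

(** The difference quotient of [phi] is that of [g], which tends to l, divided by the quotient of
    the increments of [g] and [phi]. By continuity of [phi] the latter tends to m; injectivity keeps
    the increment of [phi] nonzero. *)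
Lemma is_derive_implicit (w g phi : R -> R) (t l m e : R) :
  0 < e -> m <> 0 ->
  (forall u, ball1 t e u -> g u = w (phi u)) ->
  (forall u, ball1 t e u -> phi u = phi t -> u = t) ->
  continuity_pt phi t -> is_derive g t l -> is_derive w (phi t) m ->
  is_derive phi t (l / m).
Proof.
  intros He Hm Hg Hinj Hphi Dg Dw.
  apply is_derive_Reals in Dg; apply is_derive_Reals in Dw.
  apply uniqueness_step2 in Dg; apply uniqueness_step2 in Dw.
  apply is_derive_Reals, uniqueness_step3.
  assert (L1 : limit1_in (fun h => phi (t + h) - phi t) (fun h => h <> 0) 0 0).
  { intros eps Heps; destruct (proj1 (continuity_pt_locally phi t) Hphi (mkposreal eps Heps))
      as [d Hd].
    exists d; split; [apply cond_pos |]; intros h [_ Hh]; simpl in *.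
    unfold R_dist in *; rewrite Rminus_0_r in *.
    apply Hd; change (Rabs (t + h - t) < d); replace (t + h - t) with h by ring; exact Hh. }
  assert (L2 := limit_comp _ _ _ _ _ _ _ L1 Dw).
  assert (L3 := limit_inv _ _ _ _ L2 Hm); cbv beta in L3.
  intros eps Heps.
  assert (L4 : limit1_in (fun h => (g (t + h) - g t) / h)
     (Dgf (fun h => h <> 0) (fun h => h <> 0) (fun h => phi (t + h) - phi t)) l 0).
  { intros x Hx; destruct (Dg x Hx) as (d & Hd & Hd'); exists d; split; auto.
    intros h [[Hh _] Hh']; apply Hd'; split; auto. }
  destruct (limit_mul _ _ _ _ _ _ L4 L3 eps Heps) as (d & Hd & Hd').
  (* Within |m| of its limit m, the quotient of the increments is nonzero and may be inverted. *)
  destruct (L2 (Rabs m) (Rabs_pos_lt m Hm)) as (d' & Hd2 & Hd3).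
  exists (Rmin d' (Rmin d e)); split; [repeat apply Rmin_glb_lt; auto |].
  assert (K1 := Rmin_l d' (Rmin d e)); assert (K2 := Rmin_r d' (Rmin d e)).
  assert (K3 := Rmin_l d e); assert (K4 := Rmin_r d e).
  match goal with |- forall x : _, @?P x => change (forall x : R, P x) end.
  intros h [Hh0 Hh]; simpl in Hh, Hd', Hd3 |- *; unfold R_dist in *; rewrite Rminus_0_r in Hh.
  assert (Hb : ball1 t e (t + h)).
  { unfold ball1; replace (t + h - t) with h by ring; lra. }
  assert (Hne : phi (t + h) - phi t <> 0).
  { intros H; apply Hh0; assert (t + h = t) by (apply Hinj; auto; lra); lra. }
  assert (HD := Hd' h); assert (HQ := Hd3 h); rewrite Rminus_0_r in HD, HQ.
  replace (phi t + (phi (t + h) - phi t)) with (phi (t + h)) in HD, HQ by ring.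
  rewrite <- (Hg (t + h) Hb), <- (Hg t (ball1_center t e He)) in HD, HQ.
  assert (Hq : (g (t + h) - g t) / (phi (t + h) - phi t) <> 0).
  { intros H0; rewrite H0 in HQ; unfold Rminus in HQ; rewrite Rplus_0_l, Rabs_Ropp in HQ.
    apply (Rlt_irrefl (Rabs m)), HQ; split; [split; auto | lra]. }
  assert (Hg0 : g (t + h) - g t <> 0).
  { intros H0; apply Hq; rewrite H0; unfold Rdiv; ring. }
  replace ((phi (t + h) - phi t) / h) with
    ((g (t + h) - g t) / h * / ((g (t + h) - g t) / (phi (t + h) - phi t))) by (field; auto).
  apply HD; split; [split; auto | lra].
Qed.

Lemma nonzero_velocity_coord z a b t :
  regular_smooth z a b -> a < t < b -> exists i, Derive (coord z i) t <> 0.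
Proof.
  intros (_ & _ & Hv) Ht; specialize (Hv t Ht).
  destruct (Req_dec (Derive (coord z i1) t) 0) as [H1 |]; [| exists i1; auto].
  destruct (Req_dec (Derive (coord z i2) t) 0) as [H2 |]; [| exists i2; auto].
  contradiction Hv; apply injective_projections; [exact H1 | exact H2].
Qed.

Lemma regular1_transition an Gamma z a b t0 w c d s0 :
  local_param Gamma z a b -> local_param Gamma w c d -> a < t0 < b -> c < s0 < d ->
  (forall i, regular1 an (coord z i) t0) -> (forall i, regular1 an (coord w i) s0) ->
  z t0 = w s0 ->
  exists phi e, 0 < e /\ phi t0 = s0 /\
    (forall t, ball1 t0 e t -> z t = w (phi t)) /\ regular1 an phi t0.
Proof.
  intros Hz Hw Ht0 Hs0 Az Aw E.
  destruct (curve_transition Gamma z a b t0 w c d s0 Hz Hw Ht0 Hs0 E)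
    as (phi & e & He & Hphi0 & Hphi & Hcont).
  exists phi, e; split; [auto |]; split; [auto |]; split; [intros t Ht; apply Hphi, Ht |].
  destruct (nonzero_velocity_coord w c d s0 (proj1 Hw) Hs0) as [i Hi].
  assert (Cw := regular1_derive _ _ _ (Aw i)).
  destruct (proj1 (continuity_pt_locally _ _) (regular1_continuous _ _ _ Cw)
    (mkposreal _ (Rabs_pos_lt _ Hi))) as [d1 H1].
  destruct (proj1 (continuity_pt_locally _ _) (Hcont t0 (ball1_center t0 e He)) d1) as [e1 H2].
  rewrite Hphi0 in H2.
  (* The reciprocal of w_i' is written w_i' / (w_i')^2, because reciprocals are established for
     positive functions and the sign of w_i' is free. *)
  apply regular1_ode with (Derive (coord z i))
    (fun s => Derive (coord w i) s * / (Derive (coord w i) s * Derive (coord w i) s)).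
  - exists (Rmin e e1); split; [apply Rmin_glb_lt; [auto | apply cond_pos] |]; intros t Ht.
    assert (Hte : ball1 t0 e t) by (eapply ball1_le; [apply Rmin_l | exact Ht]).
    assert (Hm : Derive (coord w i) (phi t) <> 0).
    { assert (H3 := H1 (phi t) (H2 t (Rlt_le_trans _ _ _ Ht (Rmin_r _ _)))); simpl in H3.
      intros H0; rewrite H0 in H3; unfold Rminus in H3; rewrite Rplus_0_l, Rabs_Ropp in H3; lra. }
    destruct (Hphi t Hte) as (Ht1 & Ht2 & _); destruct (open_ball1 t0 e t Hte) as [e2 He2].
    apply is_derive_val with (Derive (coord z i) t / Derive (coord w i) (phi t)); [| field; auto].
    apply is_derive_implicit with (coord w i) (coord z i) e2; auto.
    + apply cond_pos.
    + intros u Hu; unfold coord; f_equal; apply Hphi, (He2 u), Hu.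
    + intros u Hu Hut; destruct (Hphi u (He2 u Hu)) as (Hu1 & _ & Hu2).
      destruct (Hphi t Hte) as (_ & _ & Ht3).
      apply (proj1 (proj2 (proj2 Hz))); auto; congruence.
    + apply Derive_correct, (smooth_coord z a b i (proj1 Hz) 1%nat t Ht1).
    + apply Derive_correct, (smooth_coord w c d i (proj1 Hw) 1%nat _ Ht2).
  - apply regular1_derive, Az.
  - rewrite Hphi0; apply regular1_of_regular with 0.
    assert (Cw' := regular_lift1 _ _ _ 0 Cw).
    apply (regular_mult _ (fun t _ => Derive (coord w i) t)); [exact Cw' |].
    apply (regular_inv _ (fun t _ => Derive (coord w i) t * Derive (coord w i) t)).
    + apply Rsqr_pos_lt, Hi.
    + apply regular_mult; exact Cw'.
Qed.

(** * The kernels along a pair of parametrizations *)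

Section CurveKernel.
Variables (an : Prop) (Gamma : R2 -> Prop) (n : R2 -> R2).
Variables (z : R -> R2) (a b t0 : R) (w : R -> R2) (c d s0 : R).
Hypothesis Hn : unit_normal Gamma nil n.
Hypothesis Hz : local_param Gamma z a b.
Hypothesis Hw : local_param Gamma w c d.
Hypothesis Ht0 : a < t0 < b.
Hypothesis Hs0 : c < s0 < d.
Hypothesis Az : forall i, regular1 an (coord z i) t0.
Hypothesis Aw : forall i, regular1 an (coord w i) s0.

Let r (t s : R) : R2 := sub2 (z t) (w s).

Lemma regular_chord i : regular an (fun t s => co (r t s) i) t0 s0.
Proof.
  destruct i; (apply regular_minus; [apply regular_lift1 | apply regular_lift2]);
    [exact (Az i1) | exact (Aw i1) | exact (Az i2) | exact (Aw i2)].
Qed.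

Lemma regular_normal_dot : regular an (fun t s => dot (n (z t)) (r t s)) t0 s0.
Proof.
  apply regular_plus; apply regular_mult; try apply (regular_chord i1);
    try apply (regular_chord i2).
  - apply (regular_normal an Gamma n z a b t0 Hn Hz Ht0 Az i1).
  - apply (regular_normal an Gamma n z a b t0 Hn Hz Ht0 Az i2).
Qed.

(* On the diagonal, [z t = w (phi t)] factors the chord as [(phi t - s) * delta_ t s] with a
   regular and nonvanishing divided difference [delta_], and [phi t - s] cancels. *)
Lemma regular_projection i j :
  regular an (fun t s => dot (n (z t)) (r t s) * (co (r t s) i * co (r t s) j / dot (r t s)
    (r t s)))
    t0 s0.
Proof.
  destruct (classic (z t0 = w s0)) as [E | E].
  - destruct (regular1_transition an Gamma z a b t0 w c d s0 Hz Hw Ht0 Hs0 Az Aw E)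
      as (phi & e & He & Hphi0 & Hphi & Aphi).
    set (delta_ := fun i t s => chord_integral 0 0 (Derive (coord w i)) (phi t) s).
    assert (Adelta : forall i, regular an (delta_ i) t0 s0).
    { intros k; unfold delta_; rewrite <- Hphi0; apply regular_chord_integral; auto.
      rewrite Hphi0; apply regular1_derive, Aw. }
    set (N := fun t s => delta_ i1 t s * delta_ i1 t s + delta_ i2 t s * delta_ i2 t s).
    assert (AN : regular an N t0 s0) by (apply regular_plus; apply regular_mult; apply Adelta).
    assert (HN0 : 0 < N t0 s0).
    { unfold N, delta_; rewrite Hphi0, !chord_integral_diag.
      destruct (nonzero_velocity_coord w c d s0 (proj1 Hw) Hs0) as [[|] Hi];
        apply Rsqr_pos_lt in Hi; unfold Rsqr in Hi;
        assert (H1 := Rle_0_sqr (Derive (coord w i1) s0));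
        assert (H2 := Rle_0_sqr (Derive (coord w i2) s0)); unfold Rsqr in H1, H2; lra. }
    apply regular_ext with (fun t s => dot (n (z t)) (r t s)
      * (delta_ i t s * delta_ j t s * / N t s)).
    + destruct (regular_near _ _ _ _ _ AN HN0) as (e1 & He1 & HN).
      set (eta := Rmin (s0 - c) (d - s0)).
      assert (Heta0 : 0 < eta) by (apply Rmin_glb_lt; lra).
      destruct (proj1 (continuity_pt_locally phi t0) (regular1_continuous _ _ _ Aphi)
        (mkposreal eta Heta0)) as [e2 He2]; simpl in He2; rewrite Hphi0 in He2.
      assert (Heta : forall s, ball1 s0 eta s -> c < s < d).
      { intros s Hs; apply Rabs_def2 in Hs; unfold eta in Hs.
        assert (K1 := Rmin_l (s0 - c) (d - s0)); assert (K2 := Rmin_r (s0 - c) (d - s0)); lra. }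
      clearbody eta; set (rad := Rmin (Rmin e e1) (Rmin e2 eta)).
      assert (K1 := Rmin_l (Rmin e e1) (Rmin e2 eta)); assert (K2 := Rmin_r (Rmin e e1)
        (Rmin e2 eta)).
      assert (K3 := Rmin_l e e1); assert (K4 := Rmin_r e e1).
      assert (K5 := Rmin_l e2 eta); assert (K6 := Rmin_r e2 eta); fold rad in K1, K2.
      exists rad; split.
      { unfold rad; repeat apply Rmin_glb_lt; auto; apply cond_pos. }
      intros t s [Ht Hs]; unfold ball1 in Ht, Hs.
      assert (HNts : 0 < N t s).
      { assert (H : ball1 (N t0 s0) (N t0 s0) (N t s)) by (apply HN; split; unfold ball1; lra).
        apply Rabs_def2 in H; lra. }
      assert (Hr : forall k, co (r t s) k = (phi t - s) * delta_ k t s).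
      { intros k; unfold r; rewrite sub2_co, (Hphi t) by (unfold ball1; lra).
        apply (chord_integral_diff (coord w k) s0 eta).
        - intros u Hu; assert (Hsm := smooth_coord w c d k (proj1 Hw)); split.
          + apply (Hsm 1%nat u), Heta, Hu.
          + apply (smooth_continuity _ c d); [apply smooth1_derive, Hsm | apply Heta, Hu].
        - apply He2; change (Rabs (t - t0) < e2); lra.
        - unfold ball1; lra. }
      assert (Hrr : dot (r t s) (r t s) = (phi t - s) * (phi t - s) * N t s).
      { change (co (r t s) i1 * co (r t s) i1 + co (r t s) i2 * co (r t s) i2 =
          (phi t - s) * (phi t - s) * N t s); rewrite !Hr; unfold N; ring. }
      (* On the diagonal the chord is zero, so both expressions vanish through their factor n.r; the
         conventional value of the quotient does not affect the product. *)
      destruct (Req_dec (phi t - s) 0) as [H0 | H0].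
      * replace (dot (n (z t)) (r t s)) with 0; [ring |].
        change (0 = co (n (z t)) i1 * co (r t s) i1 + co (n (z t)) i2 * co (r t s) i2).
        rewrite !Hr, H0; ring.
      * rewrite Hrr, !Hr; field; split; lra.
    + apply regular_mult; [apply regular_normal_dot |].
      apply regular_mult; [apply regular_mult; apply Adelta | apply regular_inv; auto].
  - apply regular_mult; [apply regular_normal_dot |].
    apply regular_mult; [apply regular_mult; apply regular_chord |].
    apply regular_inv; [apply sq_pos, E |].
    apply regular_plus; apply regular_mult; (apply (regular_chord i1) || apply (regular_chord i2)).
Qed.

Variables lam mu rho omega : R.

Lemma regular_curve_kernels i j :
  regular an (fun t s => kernel_F lam mu rho omega (n (z t)) (r t s) i j) t0 s0 /\
  regular an (fun t s => kernel_R lam mu rho omega (n (z t)) (r t s) i j) t0 s0 /\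
  regular an (fun t s => trac lam mu (n (z t)) (dG_im lam mu rho omega (r t s) j) i) t0 s0.
Proof.
  assert (A1 := regular_normal an Gamma n z a b t0 Hn Hz Ht0 Az i1 s0).
  assert (A2 := regular_normal an Gamma n z a b t0 Hn Hz Ht0 Az i2 s0).
  assert (B1 := regular_chord i1); assert (B2 := regular_chord i2).
  assert (P : forall t, n (z t) = (co (n (z t)) i1, co (n (z t)) i2))
    by (intros; apply surjective_pairing).
  assert (Ext : forall K : R2 -> R2 -> R,
    regular an (fun t s => K (co (n (z t)) i1, co (n (z t)) i2) (co (r t s) i1, co (r t s) i2))
      t0 s0 ->
    regular an (fun t s => K (n (z t)) (r t s)) t0 s0).
  { intros K; apply regular_ext; exists 1; split; [lra |]; intros t s _; rewrite (P t);
    reflexivity. }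
  split; [| split].
  - apply (Ext (fun n r => kernel_F lam mu rho omega n r i j)), regular_kernel_F; auto.
  - apply (Ext (fun n r => kernel_R lam mu rho omega n r i j)), regular_kernel_R; auto.
    eapply regular_ext; [| apply regular_projection with (i := i) (j := j)].
    exists 1; split; [lra |]; intros t s _; rewrite (P t); reflexivity.
  - apply (Ext (fun n r => trac lam mu n (dG_im lam mu rho omega r j) i)), regular_trac; auto.
    intros k l; apply regular_dG_im; auto.
Qed.

End CurveKernel.

(** One hypothesis, uniform in [an], serves twice: with [False] it yields derivatives of every order
    in smooth parametrizations, with [True] the double series in analytic ones. *)
Lemma analytic_on_of_regular Gamma (K : R2 -> R2 -> R) :
  (forall (an : Prop) z a b t w c d s,
     local_param Gamma z a b -> local_param Gamma w c d -> a < t < b -> c < s < d ->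
     (forall i, regular1 an (coord z i) t) -> (forall i, regular1 an (coord w i) s) ->
     regular an (fun t s => K (z t) (w s)) t s) ->
  analytic_on Gamma K.
Proof.
  intros H z a b w c d Hz Hw t s Ht Hs; split.
  - intros k; apply ex_diff_n_of_regular, (H False z a b t w c d s); auto; intros i.
    + apply regular1_smooth with a b; [apply smooth_coord, Hz | auto].
    + apply regular1_smooth with c d; [apply smooth_coord, Hw | auto].
  - intros [Z1 Z2] [W1 W2]; apply analytic2_of_regular, (H True z a b t w c d s); auto; intros [|];
      first [apply (regular1_analytic a b); assumption | apply (regular1_analytic c d); assumption].
Qed.

Theorem corollary3p8 :
  forall (lam mu rho omega : R)
    (hmu : 0 < mu) (hlm : 0 < lam + mu) (hrho : 0 < rho) (homega : 0 < omega)
    (Omega Gamma : R2 -> Prop) (corners : list R2) (n : R2 -> R2)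
    (hOmega : plane_domain Omega)
    (hbounded : bounded2 Omega \/ bounded2 (fun x => ~ closure2 Omega x))
    (hGamma : forall x, Gamma x <-> boundary Omega x)
    (hsmooth : piecewise_smooth Gamma corners)
    (hn : unit_normal Gamma corners n),
  exists (F : R2 -> R2 -> ix -> ix -> R) (Rem : R2 -> R2 -> ix -> ix -> C),
    (forall x y, Gamma x -> ~ In x corners -> Gamma y -> x <> y ->
       forall i j,
         let r := sub2 x y in
         let TG := traction_x lam mu n (Gmat lam mu rho omega) x y in
         let TE := traction_x lam mu n (Emat lam mu) x y in
         TG i j = (TE i j + RtoC (ln (len r)) * RtoC (F x y i j) + Rem x y i j)%C /\
         TE i j = RtoC
           (- (dot (n x) r / (2 * PI * len r ^ 2)) * delta i j
            + mu / (lam + 2 * mu) * (dot (tangent (n x)) r / (2 * PI * len r ^ 2))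
              * Lmat i j
            + (lam + mu) / (lam + 2 * mu) *
              (- (dot (n x) r * (co r i * co r j) / (PI * len r ^ 4))
               + dot (n x) r / (2 * PI * len r ^ 2) * delta i j)) /\
         F x y i j = - (2 / PI) * Im (TG i j)) /\
    (forall y, Gamma y -> forall i j,
       filterlim (fun x => Rem x y i j)
         (within (fun x => Gamma x /\ ~ In x corners /\ x <> y) (locally (y : R * R)))
         (locally (RtoC 0))) /\
    (corners = nil -> forall i j,
       analytic_on Gamma (fun x y => F x y i j) /\
       analytic_on Gamma (fun x y => Re (Rem x y i j)) /\
       analytic_on Gamma (fun x y => Im (Rem x y i j))).
Proof.
  intros.
  (* The witnesses are formulas in n(x) and x - y that also have the right values at x = y, where
     the Green's function is singular. Analyticity across the diagonal is a statement about these
     extended kernels. *)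
  exists (fun x y => kernel_F lam mu rho omega (n x) (sub2 x y)),
    (fun x y => remainder lam mu rho omega (n x) (sub2 x y)).
  split; [| split].
  - intros x y _ _ _ Hxy i j r TG TE.
    destruct (traction_decomposition lam mu rho omega hmu hlm hrho homega n x y i j Hxy) as [H1 H2].
    split; [exact H1 |]; split; [| exact H2].
    unfold TE; rewrite traction_Emat by auto; f_equal; apply trac_dE; auto.
    apply (sq_pos x y Hxy).
  - intros y Hy i j.
    set (F := within (fun x => Gamma x /\ ~ In x corners /\ x <> y) (locally (y : R * R))).
    assert (FF : Filter F) by (apply within_filter, locally_filter).
    (* The normal has length 1 away from the corners; boundedness is what remains of it when x
       approaches a corner, where it may have no limit. *)
    assert (Hb : forall k, bounded_along R2 F (fun x => co (n x) k)).
    { intros k; exists 1; unfold F, within; apply filter_forall; intros x (Hx & Hxc & _).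
      rewrite <- (proj1 hn x Hx Hxc); apply Rabs_co_le_len. }
    assert (Hr : forall k, vanishing R2 F (fun x => co (sub2 x y) k)).
    { intros k eps Heps; unfold F, within; exists (mkposreal eps Heps).
      intros x [B1 B2] _; rewrite sub2_co; destruct k; [exact B1 | exact B2]. }
    assert (HR := vanishing_kernel_R R2 F n (fun x => sub2 x y) Hb Hr lam mu rho omega i j).
    assert (HI := vanishing_trac R2 F n Hb lam mu
      (fun x => dG_im lam mu rho omega (sub2 x y) j) i
      (fun k l => vanishing_dG_im R2 F (fun x => sub2 x y) Hr lam mu rho omega j k l)).
    intros P [eps HP]; unfold filtermap.
    generalize (filter_and _ _ (HR eps (cond_pos eps)) (HI eps (cond_pos eps))).
    apply filter_imp; intros x [H1 H2]; apply HP; split;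
      [change (Rabs (kernel_R lam mu rho omega (n x) (sub2 x y) i j - 0) < eps)
      | change (Rabs (trac lam mu (n x) (dG_im lam mu rho omega (sub2 x y) j) i - 0) < eps)];
      rewrite Rminus_0_r; assumption.
  - intros -> i j.
    assert (H := fun an z a b t w c d s Hz Hw Ht Hs Az Aw =>
      regular_curve_kernels an Gamma n z a b t w c d s hn Hz Hw Ht Hs Az Aw lam mu rho omega i j).
    split; [| split]; apply analytic_on_of_regular; intros; eapply H; eauto.
Qed.
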